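(* Loop isomorphism can be solved in average-case polynomial time: there is an algorithm which, given the Cayley table of a loop on $[n]$, outputs a permutation $\pi$ of $[n]$ such that the loop obtained by renaming each element $x$ as $\pi(x)$ depends only on the isomorphism class of the input, and whose expected running time on a uniformly random loop on $[n]$ is bounded by a polynomial in $n$.
   Context: A quasigroup on $[n]$ is a binary operation $\circ$ on $[n]$ whose Cayley table is a Latin square. A loop is a quasigroup with an identity element $e$ ($e\circ x=x\circ e=x$ for all $x$). Two loops $([n],\circ)$ and $([n],* )$ are isomorphic if there is a permutation $\pi$ of $[n]$ with $\pi(x)*\pi(y)=\pi(x\circ y)$ for all $x,y$. A uniformly random loop on $[n]$ is chosen uniformly among all loop operations on $[n]$. *)

(* Defs.v *)
From HB Require Import structures.
From mathcomp Require Import all_boot all_order all_algebra all_fingroup.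
Set Implicit Arguments.
Unset Strict Implicit.
Unset Printing Implicit Defensive.
Import Order.TTheory GRing.Theory Num.Theory.
Local Open Scope ring_scope.

(* A binary operation on [n] = 'I_n is given by its Cayley table T : 'M['I_n]_n,
   where T x y is the product of x and y. *)

Definition latin_square n (T : 'M['I_n]_n) : bool :=
  [forall x, forall z, #|[set y | T x y == z]| == 1%N] &&
  [forall y, forall z, #|[set x | T x y == z]| == 1%N].

Definition has_identity n (T : 'M['I_n]_n) : bool :=
  [exists e, forall x, (T e x == x) && (T x e == x)].

Definition is_loop n : {pred 'M['I_n]_n} :=
  fun T => latin_square T && has_identity T.

Definition isomorphic n (T T' : 'M['I_n]_n) : Prop :=
  exists pi : {perm 'I_n}, forall x y, T' (pi x) (pi y) = pi (T x y).

Definition relabel n (pi : {perm 'I_n}) (T : 'M['I_n]_n) : 'M['I_n]_n :=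
  \matrix_(x, y) pi (T (pi^-1%g x) (pi^-1%g y)).

Definition uniform_expectation (I : finType) (A : {pred I}) (X : I -> rat) :
  rat := (\sum_(i in A) X i) / #|A|%:R.

(* The model of computation is a random access machine with structured control
   flow: registers and arrays, both named by natural numbers, hold natural
   numbers, and every operation has unit cost.  As in Cook and Reckhow's machine
   the only arithmetic operations are addition and (truncated) subtraction.
   There is deliberately no unit-cost multiplication: the bit length of every
   stored value is then bounded by the size of the input plus a linear function
   of the time elapsed, so that running times are polynomially related to those
   of Turing machines. *)

Inductive expr : Type :=
| Const of nat
| Reg of nat
| Get of nat & expr
| Add of expr & expr
| Sub of expr & expr.

(* [Put a i e] writes e in cell i of array a; a guard holds when it is
   nonzero. *)
Inductive prog : Type :=
| Skip
| Assign of nat & expr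
| Put of nat & expr & expr
| Seq of prog & prog
| If of expr & prog & prog
| While of expr & prog.

Record state : Type := State {
  reg : nat -> nat;
  arr : nat -> nat -> nat
}.

Definition set_reg (s : state) (r v : nat) : state :=
  State (fun r' => if r' == r then v else reg s r') (arr s).

Definition set_arr (s : state) (a i v : nat) : state :=
  State (reg s)
    (fun a' i' => if (a' == a) && (i' == i) then v else arr s a' i').

Fixpoint eval (s : state) (e : expr) : nat :=
  match e with
  | Const c => c
  | Reg r => reg s r
  | Get a e1 => arr s a (eval s e1)
  | Add e1 e2 => (eval s e1 + eval s e2)%N
  | Sub e1 e2 => (eval s e1 - eval s e2)%N
  end.

Fixpoint cost (e : expr) : nat :=
  match e with
  | Const _ | Reg _ => 1%N
  | Get _ e1 => (cost e1).+1
  | Add e1 e2 | Sub e1 e2 => (cost e1 + cost e2).+1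
  end.

(* [exec P s t s'] : started in state s, the program P halts in state s' after
   exactly t steps. *)
Inductive exec : prog -> state -> nat -> state -> Prop :=
| ExecSkip s : exec Skip s 1 s
| ExecAssign s r e :
    exec (Assign r e) s (cost e).+1 (set_reg s r (eval s e))
| ExecPut s a i e :
    exec (Put a i e) s (cost i + cost e).+1
      (set_arr s a (eval s i) (eval s e))
| ExecSeq s s1 s2 P Q t u :
    exec P s t s1 -> exec Q s1 u s2 -> exec (Seq P Q) s (t + u) s2
| ExecIfTrue s s1 e P Q t :
    eval s e != 0%N -> exec P s t s1 ->
    exec (If e P Q) s (cost e + t).+1 s1
| ExecIfFalse s s1 e P Q t :
    eval s e = 0%N -> exec Q s t s1 ->
    exec (If e P Q) s (cost e + t).+1 s1
| ExecWhileTrue s s1 s2 e P t u :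
    eval s e != 0%N -> exec P s t s1 -> exec (While e P) s1 u s2 ->
    exec (While e P) s (cost e + t + u).+1 s2
| ExecWhileFalse s e P :
    eval s e = 0%N -> exec (While e P) s (cost e).+1 s.

Lemma exec_deterministic P s t1 s1 t2 s2 :
  exec P s t1 s1 -> exec P s t2 s2 -> t1 = t2 /\ s1 = s2.
Proof.
move=> H; elim: H t2 s2 => {P s t1 s1}; intros;
  match goal with H : exec _ _ _ ?x |- _ = _ /\ _ = ?x => inversion H; subst end;
  repeat match goal with
  | H : is_true (?x != 0%N), H' : ?x = 0%N |- _ => by rewrite H' in H
  | IH : forall t s, exec ?P ?s0 t s -> _, H : exec ?P ?s0 _ _ |- _ =>
      case: (IH _ _ H) => ? ?; subst; clear H
  end; by [].
Qed.

(* On input, register 0 holds n, array 0 holds the n * n table in row-major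
   order, and everything else is 0. *)
Definition input n (T : 'M['I_n]_n) : state :=
  State (fun r => if r == 0%N then n else 0%N)
    (fun a k =>
       if a == 0%N then
         if [pick xy : 'I_n * 'I_n | k == (xy.1 * n + xy.2)%N] is Some xy
         then nat_of_ord (T xy.1 xy.2) else 0%N
       else 0%N).

(* On output, the first n cells of array 1 hold the values of the permutation. *)
Definition outputs n (s : state) (pi : {perm 'I_n}) : Prop :=
  forall x : 'I_n, arr s 1 x = pi x.

Definition labels_in (P : prog) n (T : 'M['I_n]_n) (pi : {perm 'I_n})
    (t : nat) : Prop :=
  exists2 s, exec P (input T) t s & outputs s pi.

Lemma input_cell n (T : 'M['I_n]_n) (x y : 'I_n) :
  arr (input T) 0 (x * n + y)%N = T x y.
Proof.
rewrite /=; case: pickP => [[x' y'] /= /eqP E|/(_ (x, y))]; last by rewrite eqxx.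
have n_gt0 : (0 < n)%N by apply: leq_ltn_trans (ltn_ord x).
have Ex : x = x'.
  apply: val_inj; move: (congr1 (divn^~ n) E) => /=.
  by rewrite !divnMDl // !divn_small ?ltn_ord // !addn0.
by subst x'; congr (nat_of_ord (T _ _)); apply: val_inj; move/addnI: E.
Qed.

(* Main.v *)
(* The algorithm tries all pairs (y, z): it lists y, z and then, round after
   round, all products of listed elements. A pair generating the loop yields a
   labelling by position in the list, equivariant under isomorphisms, and the
   output is the labelling whose table is lexicographically least. If no pair
   generates the loop, all n^n tuples of length n are tried instead; so it
   suffices that loops not generated by two elements have density O(n^-n).

   With m(d) = ln(d!)/d, Bregman's theorem applied row by row bounds the number
   of Latin squares by exp(n (m(1) + ... + m(n))), and the lower bound (d/e)^n
   for the permanent of a d-regular 0/1 matrix (Gurvits' capacity argument)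
   shows that this is sharp up to exp(O(n ln(n)^2)). If no two elements generate
   the loop, then for every h either there is a proper subloop with more than h
   elements (its order is at most n/2), or every orbit of every left translation
   has at most h elements. The first event loses a factor exp(c h^2) in the row by row
   count, the second one a factor exp(c n^2/h); for h close to n^(2/3) both losses
   exceed exp(O(n ln(n)^2)), n^n, the 2^n choices of a subloop, and the factor
   (n!)^2 between Latin squares and loops. *)
Require Import Defs.
From HB Require Import structures.
From mathcomp Require Import all_boot all_order all_algebra all_fingroup.
From mathcomp Require Import Rstruct boolp reals.
From mathcomp.analysis Require Import sequences exp.
From mathcomp Require Import ring lra zify.
Set Implicit Arguments.
Unset Strict Implicit.
Unset Printing Implicit Defensive.
Import Order.TTheory GRing.Theory Num.Theory.
Local Open Scope ring_scope.

(** * The mean of ln 1, ..., ln d *)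

(** The two bounds on the number of Latin squares reveal the rows one by one, and in a row with d
    admissible values per cell their exponents differ by at most n (1 + ln d) / d. Every event is
    therefore measured as a saving in the exponent [logmain] of the upper count, and any saving of
    larger order than n ln(n)^2 suffices: the factors n^n, (n!)^2 and 2^n are smaller still. The
    savings are h^2 and n^2 / h up to constants. Both are large enough for every power h = n^a with
    1/2 < a < 1, and a = 2/3 makes them equal.

    A proper subloop has at most n / 2 elements because it is disjoint from its translate by an
    outside element. A left translation with short orbits is expensive because a permutation of this
    kind has so many transversals of its orbits: altering it on a transversal produces far more
    permutations than the few values left free there account for.

    On the program side everything is phrased by positions in lists of natural numbers, never by
    names of elements, so an isomorphism commutes with each step. *)

Section Analysis.
Variable R : realType.
Implicit Types (x y t : R) (d n a b : nat).

Lemma ln_ge_1V x : 0 < x -> 1 - x^-1 <= ln x.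
Proof.
move=> x0; have Vx0 : 0 < x^-1 by rewrite invr_gt0.
have : ln (1 + (x^-1 - 1)) <= x^-1 - 1 by apply: le_ln1Dx; lra.
by rewrite addrC subrK lnV ?posrE //; lra.
Qed.

Lemma lnS_le d : (0 < d)%N -> ln d.+1%:R - ln d%:R <= d%:R^-1 :> R.
Proof.
move=> d0; have d0' : 0 < d%:R :> R by rewrite ltr0n.
rewrite -ln_div ?posrE ?ltr0Sn // -natr1 mulrDl divff ?gt_eqF // mul1r.
by apply: le_ln1Dx; rewrite (lt_trans _ (_ : 0 < _)) ?invr_gt0 // ltrN10.
Qed.

Lemma lnS_ge d : (0 < d)%N -> d.+1%:R^-1 <= ln d.+1%:R - ln d%:R :> R.
Proof.
move=> d0; have d0' : 0 < d%:R :> R by rewrite ltr0n.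
have := ln_ge_1V (x := d.+1%:R / d%:R :> R).
rewrite divr_gt0 ?ltr0Sn // => /(_ isT); rewrite ln_div ?posrE ?ltr0Sn //.
apply: le_trans; rewrite invf_div -natr1.
have -> : d%:R / (d%:R + 1) = 1 - (d%:R + 1)^-1 :> R by field; lra.
lra.
Qed.

(** The logarithm of Bregman's factor (d!)^(1/d) for a line with d admissible values; it is 0 at d =
    0. *)
Definition meanln d : R := ln (d`!)%:R / d%:R.

Lemma meanlnE d : d%:R * meanln d = ln (d`!)%:R.
Proof.
case: d => [|d]; first by rewrite fact0 ln1 mul0r.
by rewrite mulrC divfK ?pnatr_eq0.
Qed.

Lemma ln_factS d : ln (d.+1)`!%:R = ln d.+1%:R + ln d`!%:R :> R.
Proof. by rewrite factS natrM lnM ?posrE ?ltr0n ?fact_gt0. Qed.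

Lemma meanlnS d : ln d.+1%:R + d%:R * meanln d = d.+1%:R * meanln d.+1.
Proof. by rewrite !meanlnE ln_factS. Qed.

Lemma meanln_leS d : meanln d <= ln d.+1%:R.
Proof.
case: d => [|d]; first by rewrite /meanln invr0 mulr0 ln1.
rewrite ler_pdivrMr ?ltr0Sn //; elim: d => [|d IH].
  by rewrite ln1 mulr1 ln_ge0 // ler1n.
have : ln d.+2%:R <= ln d.+3%:R :> R by rewrite ler_ln ?posrE ?ltr0Sn // ler_nat.
have -> : d.+2%:R = d.+1%:R + 1 :> R by rewrite natr1.
rewrite ln_factS natr1; move: IH (ltr0Sn R d) => /=; set w := d.+1%:R.
set u := ln d.+2%:R; set v := ln d.+3%:R; rewrite -natr1 -/w; nra.
Qed.

Lemma meanln_homo a b : (a <= b)%N -> meanln a <= meanln b.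
Proof.
move=> /subnK <-; elim: (b - a)%N => [|k IH] //; rewrite addSn.
apply: le_trans IH _; have E := meanlnS (k + a).
rewrite -(ler_pM2l (ltr0Sn R (k + a))) -E.
apply: le_trans (_ : _ <= (1 + (k + a)%:R) * meanln (k + a)) _; last first.
  by rewrite mulrDl mul1r lerD2r meanln_leS.
by rewrite addrC natr1.
Qed.

Lemma meanln_ge d : (0 < d)%N -> ln d%:R - 1 <= meanln d.
Proof.
case: d => // d _; rewrite ler_pdivlMr ?ltr0Sn //.
elim: d => [|d IH]; first by rewrite ln1 mulr1; lra.
have := lnS_le (ltn0Sn d); rewrite -(ler_pM2r (ltr0Sn R d)) mulVf ?pnatr_eq0 //.
rewrite ln_factS -[in X in _ * X <= _]natr1; move: IH; set u := ln _; set v := ln d.+2%:R.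
move: (ltr0Sn R d); set w := d.+1%:R; nra.
Qed.

(** Stirling in the form d! <= e d (d/e)^d. The excess (1 + ln d) / d over [meanln_ge] is what sums
    to (1 + ln n)^2 in [logmain_le]. *)
Lemma meanln_le d : (0 < d)%N ->
  meanln d <= ln d%:R - 1 + (1 + ln d%:R) / d%:R.
Proof.
case: d => // d _; rewrite ler_pdivrMr ?ltr0Sn // mulrDl divfK ?pnatr_eq0 //.
elim: d => [|d IH]; first by rewrite ln1; lra.
have := lnS_ge (ltn0Sn d); rewrite -(ler_pM2r (ltr0Sn R d.+1)) mulVf ?pnatr_eq0 //.
rewrite ln_factS; move: IH; have := @natr1 R d.+1.
set u := ln d.+1%:R; set v := ln d.+2%:R; set w' := d.+2%:R; set w := d.+1%:R => <-.
nra.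
Qed.

Lemma fact_double a : (2 ^ a * (a`! * a`!) <= (a.*2)`!)%N.
Proof.
elim: a => // a IH; rewrite doubleS !factS expnS.
have : (2 * a.+1 * a.+1 * (2 ^ a * (a`! * a`!)) <= a.*2.+2 * a.*2.+1 * (a.*2)`!)%N.
  by apply: leq_mul => //; rewrite -!muln2; nia.
by rewrite !mulnA; apply: leq_trans; rewrite leq_eqVlt; apply/orP; left; apply/eqP; ring.
Qed.

(** Halving the number of admissible values saves at least the constant ln 2 / 2 per cell; for b = 2
    a this is [fact_double] after taking logarithms. *)
Lemma meanln_gap a b : (0 < a)%N -> (a.*2 <= b)%N ->
  meanln a + ln 2 / 2 <= meanln b.
Proof.
move=> a0 /meanln_homo; apply: le_trans.
have a0' : 0 < a%:R :> R by rewrite ltr0n.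
have a20 : 0 < (a.*2)%:R :> R by rewrite ltr0n double_gt0.
have E2 : (a.*2)%:R = 2 * a%:R :> R by rewrite -muln2 natrM mulrC.
rewrite -(ler_pM2l a20) meanlnE E2 mulrDr -mulrA meanlnE.
have := fact_double a; rewrite -(ler_nat R) -ler_ln ?posrE ?ltr0n ?fact_gt0 //; last first.
  by rewrite !muln_gt0 expn_gt0 fact_gt0.
rewrite natrM lnM ?posrE ?ltr0n ?muln_gt0 ?expn_gt0 ?fact_gt0 //.
rewrite natrM lnM ?posrE ?ltr0n ?fact_gt0 // natrX lnXn // -mulr_natr. lra.
Qed.

Lemma harmonic_le n : (0 < n)%N -> \sum_(i < n) (i.+1%:R)^-1 <= 1 + ln n%:R :> R.
Proof.
case: n => // n _; elim: n => [|n IH].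
  by rewrite big_ord_recl big_ord0 ln1 invr1.
by rewrite big_ord_recr /=; apply: le_trans (lerD IH (lnS_ge (ltn0Sn n))) _; lra.
Qed.

Lemma exp_partial_sum n : \sum_(j < n) (j`!%:R)^-1 <= expR 1 :> R.
Proof.
have h : {homo series (exp_coeff (1 : R)) : m k / (m <= k)%N >-> m <= k}.
  by apply: nondecreasing_series => i _ _; apply: exp_coeff_ge0; apply: ler01.
apply: le_trans (nondecreasing_cvgn_le h (is_cvg_series_exp_coeff 1) n).
rewrite seriesEnat /= big_mkord le_eqVlt; apply/orP; left; apply/eqP.
by apply: eq_bigr => i _; rewrite /exp_coeff /= expr1n mul1r.
Qed.

End Analysis.

(** * Bregman's theorem *)

Section Bregman.
Variables (R : realType) (T : finType).
Implicit Types (A : T -> {set T}) (X Y : {set T}) (S : {set {perm T}}) (f : {perm T}).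

(** Each value taken at i contributes exactly 1: the size of its fibre times the inverse of that
    size. *)
Lemma sum_inv_fiber S (i : T) (K : {set T}) :
  (forall f, f \in S -> f i \in K) ->
  \sum_(f in S) (#|[set g in S | g i == f i]|%:R)^-1 <= #|K|%:R :> R.
Proof.
move=> SK; rewrite (partition_big (fun f : {perm T} => f i) (mem K)) //=.
rewrite -sum1_card natr_sum; apply: ler_sum => k _.
rewrite (eq_bigr (fun=> (#|[set g in S | g i == k]|%:R)^-1)) => [|f /andP[_ /eqP->]] //.
rewrite sumr_const (_ : #|_| = #|[set g in S | g i == k]|); last first.
  by apply: eq_card => g; rewrite !inE.
have [->|n0] := eqVneq #|[set g in S | g i == k]| 0%N; first by rewrite mulr0n ler01.
by rewrite -(mulr_natr _^-1) mulVf ?pnatr_eq0.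
Qed.

(** The chain rule of entropy for a uniform f in S, multiplied by #|S|: the entropy of f i is at
    most ln #|K|, and the last sum is what remains once f i is known. Convexity enters as 1 - 1/x <=
    ln x at x = q d / P, where q is the size of a fibre, P = #|S| and d = #|K|. *)
Lemma entropy_split S (i : T) (K : {set T}) : (0 < #|S|)%N ->
  (forall f, f \in S -> f i \in K) ->
  #|S|%:R * ln #|S|%:R <= #|S|%:R * ln #|K|%:R
    + \sum_(f in S) ln #|[set g in S | g i == f i]|%:R :> R.
Proof.
move=> S0 SK; have P0 : 0 < #|S|%:R :> R by rewrite ltr0n.
have /card_gt0P[f0 f0S] := S0.
have K0 : 0 < #|K|%:R :> R by rewrite ltr0n; apply/card_gt0P; exists (f0 i); apply: SK.
set P := #|S|%:R in P0 *; set d := #|K|%:R in K0 *.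
have h (f : {perm T}) : f \in S ->
    ln P - ln d + 1 - P / d * (#|[set g in S | g i == f i]|%:R)^-1
      <= ln #|[set g in S | g i == f i]|%:R.
  move=> fS; set q : R := #|_|%:R.
  have q0 : 0 < q by rewrite ltr0n; apply/card_gt0P; exists f; rewrite inE fS eqxx.
  have := ln_ge_1V (divr_gt0 q0 (divr_gt0 P0 K0)).
  by rewrite !ln_div ?posrE ?divr_gt0 // invf_div; lra.
have : \sum_(f in S) (ln P - ln d + 1 - P / d * (#|[set g in S | g i == f i]|%:R)^-1)
   <= \sum_(f in S) ln #|[set g in S | g i == f i]|%:R by apply: ler_sum.
rewrite sumrB -mulr_sumr sumr_const -[_ *+ #|S|]mulr_natl -/P.
have := ler_wpM2l (ltW (divr_gt0 P0 K0)) (sum_inv_fiber SK).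
rewrite -/d divfK ?gt_eqF //; set s := \sum_(f in S) (_)^-1; set u := \sum_(f in S) _.
move=> a b; nra.
Qed.

(** Since f maps X onto Y, every value in A c and Y is attained, and one of them is attained by c
    itself. *)
Lemma card_hits f X Y A c : #|X| = #|Y| -> {in X, forall i, f i \in Y} -> c \in X -> f c \in A c ->
  #|[set i in X :\ c | f i \in A c]| = #|A c :&: Y|.-1.
Proof.
move=> XY fXY cX fcA.
have fX : f @: X = Y.
  apply/eqP; rewrite eqEcard card_imset ?XY ?leqnn ?andbT; last exact: perm_inj.
  by apply/subsetP => _ /imsetP[i iX ->]; apply: fXY.
have -> : A c :&: Y = f @: [set i in X | f i \in A c].
  apply/setP => y; rewrite inE -fX; apply/andP/imsetP => [[yA /imsetP[i iX e]]|[i]].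
    by exists i => //; rewrite inE iX -e.
  by rewrite inE => /andP[iX fiA] ->; split => //; apply: imset_f.
rewrite card_imset; last exact: perm_inj.
rewrite (cardsD1 c [set i in X | _]) inE cX fcA /=.
by apply: eq_card => i; rewrite !inE andbA.
Qed.

(* Schrijver's proof: [entropy_split] is summed over all rows i, and each
   row c loses one admissible value exactly when f i is admissible for c. *)
Theorem bregman A m : forall X Y S, #|X| = m -> #|Y| = m ->
  (forall f, f \in S -> {in X, forall c, f c \in A c :&: Y}) ->
  {in S &, forall f g : {perm T}, {in X, f =1 g} -> f = g} -> (0 < #|S|)%N ->
  ln #|S|%:R <= \sum_(c in X) meanln R #|A c :&: Y|.
Proof.
elim: m => [|m IH] X Y S Xm Ym SA Sinj S0.
  have S1 : (#|S| <= 1)%N.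
    apply/card_le1_eqP => f g fS gS; apply: Sinj => // c.
    by move/cards0_eq: Xm => ->; rewrite inE.
  rewrite (_ : #|S| = 1)%N ?ln1; last by apply/eqP; rewrite eqn_leq S1.
  by rewrite (cards0_eq Xm) big_set0.
have P0 : 0 < #|S|%:R :> R by rewrite ltr0n.
have step i : i \in X -> #|S|%:R * ln #|S|%:R <= #|S|%:R * ln #|A i :&: Y|%:R
    + \sum_(f in S) \sum_(c in X :\ i) meanln R #|A c :&: (Y :\ f i)|.
  move=> iX; apply: le_trans (entropy_split S0 (i := i) (K := A i :&: Y) _) _.
    by move=> f fS; apply: SA.
  rewrite lerD2l; apply: ler_sum => f fS; apply: IH.
  - by move: Xm; rewrite (cardsD1 i) iX add1n => -[].
  - by move: Ym; rewrite (cardsD1 (f i)) (setIP (SA _ fS _ iX)).2 add1n => -[].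
  - move=> g; rewrite inE => /andP[gS /eqP gi] c /setD1P[ci cX].
    rewrite setIDA in_setD1 SA // andbT -gi; apply: contraNneq ci => /perm_inj ->.
    by rewrite eqxx.
  - move=> g h; rewrite !inE => /andP[gS /eqP gi] /andP[hS /eqP hi] gh.
    apply: Sinj => // c cX; have [->|ci] := eqVneq c i; first by rewrite gi hi.
    by apply: gh; rewrite !inE ci.
  - by apply/card_gt0P; exists f; rewrite inE fS eqxx.
(* For fixed f, exactly d - 1 of the m other rows remove a value of row c and the remaining m + 1 -
   d leave all d; [meanlnS] collects the terms. *)
have inner f c : f \in S -> c \in X ->
    ln #|A c :&: Y|%:R + \sum_(i in X :\ c) meanln R #|A c :&: (Y :\ f i)|
      = m.+1%:R * meanln R #|A c :&: Y|.
  move=> fS cX; set d := #|A c :&: Y|.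
  have fcAY : f c \in A c :&: Y by apply: SA.
  have hit : #|[set i in X :\ c | f i \in A c]| = d.-1.
    apply: card_hits => //; first by rewrite Xm Ym.
      by move=> i iX; have /setIP[] := SA _ fS _ iX.
    by have /setIP[] := fcAY.
  have d0 : (0 < d)%N by apply/card_gt0P; exists (f c).
  rewrite (bigID (fun i => f i \in A c)) /=.
  rewrite (eq_bigr (fun=> meanln R d.-1)); last first.
    move=> i /andP[/setD1P[_ iX] fiA]; congr meanln; rewrite /d (cardsD1 (f i) (A c :&: Y)).
    by rewrite inE fiA (setIP (SA _ fS _ iX)).2 /= setIDA.
  rewrite [X in _ + (_ + X)](eq_bigr (fun=> meanln R d)); last first.
    move=> i /andP[/setD1P[_ iX] fiA]; congr meanln; rewrite /d; apply: eq_card => z.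
    rewrite !inE; case: eqP => [->|] //; by rewrite (negbTE fiA).
  rewrite !sumr_const.
  have c1 : #|[pred i in X :\ c | f i \in A c]| = d.-1.
    by rewrite -hit; apply: eq_card => z; rewrite !inE.
  have c2 : #|[pred i in X :\ c | f i \notin A c]| = (m.+1 - d)%N.
    have := cardID [pred i | f i \in A c] (mem (X :\ c)).
    rewrite (_ : #|[predI X :\ c & [pred i | f i \in A c]]| = d.-1); last first.
      by rewrite -hit; apply: eq_card => z; rewrite !inE.
    rewrite (_ : #|[predD X :\ c & [pred i | f i \in A c]]| =
       #|[pred i in X :\ c | f i \notin A c]|); last first.
      by apply: eq_card => z; rewrite !inE andbC.
    move: Xm; rewrite (cardsD1 c) cX add1n => -[->]; lia.
  rewrite c1 c2; have dm : (d <= m.+1)%N by rewrite -Ym subset_leq_card ?subsetIr.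
  have := meanlnS R d.-1; rewrite prednK // -(mulr_natl (meanln R d.-1)) -(mulr_natl (meanln R d)) addrA => ->.
  by rewrite -mulrDl -natrD subnKC.
rewrite -(ler_pM2l P0) -(ler_pM2l (ltr0Sn R m)).
apply: le_trans (_ : \sum_(i in X) #|S|%:R * ln #|S|%:R <= _).
  by rewrite sumr_const Xm mulr_natl.
apply: le_trans (ler_sum _ step) _.
rewrite big_split /= -mulr_sumr.
(* After the sums over i and c are exchanged, [inner] produces the terms - ln #|A c :&: Y|, which
   cancel those of [step]. *)
have -> : \sum_(i in X) \sum_(f in S) \sum_(c in X :\ i) meanln R #|A c :&: (Y :\ f i)|
   = \sum_(f in S) \sum_(c in X) (m.+1%:R * meanln R #|A c :&: Y| - ln #|A c :&: Y|%:R).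
  rewrite exchange_big /=; apply: eq_bigr => f fS.
  rewrite (exchange_big_dep (mem X)) /=; last by move=> i c _ /setD1P[].
  apply: eq_bigr => c cX; rewrite -(inner f) // addrC addKr.
  by apply: eq_bigl => i; rewrite !inE cX andbT eq_sym andbC.
rewrite sumr_const sumrB -mulr_sumr -mulr_natl; lra.
Qed.

End Bregman.

(** * A lower bound for permanents *)

Section Exchange.
Variables (n : nat) (A : 'I_n -> {set 'I_n}).
Implicit Types (psi : {ffun 'I_n -> 'I_n}) (i j x : 'I_n).

Definition hits psi j := #|[set i | psi i == j]|.

(* Interpolates between the product of the row sums (k = 0) and the
   permanent (k = n). *)
Definition placements (k : nat) : {set {ffun 'I_n -> 'I_n}} :=
  [set psi : {ffun 'I_n -> 'I_n} | [forall i, psi i \in A i] && [forall j : 'I_n, (j < k)%N ==> (hits psi j == 1%N)]].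

Lemma placementsP k psi :
  reflect ((forall i, psi i \in A i) /\ (forall j : 'I_n, (j < k)%N -> hits psi j = 1%N))
          (psi \in placements k).
Proof.
rewrite inE; apply: (iffP andP) => -[/forallP h1 h2]; split => //.
  by move=> j jk; apply/eqP; move/forallP: h2 => /(_ j) /implyP; apply.
by apply/forallP => j; apply/implyP => jk; apply/eqP; apply: h2.
Qed.

Lemma hits1P psi j :
  reflect (exists i, psi i = j /\ forall i', psi i' = j -> i' = i) (hits psi j == 1%N).
Proof.
apply: (iffP cards1P) => -[i].
  move/setP => h; exists i; split; first by have := h i; rewrite !inE eqxx => /eqP.
  by move=> i' e; have := h i'; rewrite !inE e eqxx => /esym/eqP.
move=> [e u]; exists i; apply/setP => i'; rewrite !inE.
by apply/eqP/eqP => [/u|->].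
Qed.

(* The row following i on the alternating path of psi1 and psi2. *)
Definition follow (k : nat) psi1 psi2 i :=
  if (psi1 i < k)%N then odflt i [pick i' | psi2 i' == psi1 i] else i.

Definition path_rows k psi1 psi2 x := [set i | fconnect (follow k psi1 psi2) x i].

(** Swapping psi1 and psi2 along the path from a row x with psi2 x = k moves one hit of column k
    from psi2 to psi1, while every column below k stays hit exactly once by each. *)
Definition exchange k psi1 psi2 x : {ffun 'I_n -> 'I_n} :=
  [ffun i => if i \in path_rows k psi1 psi2 x then psi2 i else psi1 i].

Definition exchange' k psi1 psi2 x : {ffun 'I_n -> 'I_n} :=
  [ffun i => if i \in path_rows k psi1 psi2 x then psi1 i else psi2 i].

Lemma placement_inj (k : nat) psi i i' : psi \in placements k -> (psi i < k)%N ->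
  psi i = psi i' -> i = i'.
Proof.
move=> /placementsP[_ h] /h/eqP/hits1P[i0 [_ u]] e.
by rewrite (u i) // (u i') // -e.
Qed.

Section Pair.
Variables (k : 'I_n) (psi1 psi2 : {ffun 'I_n -> 'I_n}) (x : 'I_n).
Hypotheses (psi1P : psi1 \in placements k) (psi2P : psi2 \in placements k).
Hypotheses (psi1k : hits psi1 k = 0%N) (psi2x : psi2 x = k).

Let P := path_rows k psi1 psi2 x.
Let nxt := follow k psi1 psi2.

Lemma follow_hit i : (psi1 i < k)%N -> psi2 (nxt i) = psi1 i.
Proof.
move=> ik; rewrite /nxt /follow ik; case: pickP => [i' /eqP //|no].
have [_ /(_ _ ik)/eqP/hits1P[i' [e _]]] := placementsP _ _ psi2P.
by have := no i'; rewrite e eqxx.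
Qed.

Lemma path_rows_start : x \in P. Proof. by rewrite inE connect0. Qed.

Lemma path_rows_pred i : i \in P -> i != x ->
  exists z, [/\ z \in P, (psi1 z < k)%N & psi2 i = psi1 z].
Proof.
rewrite inE => /iter_findex <-; move: (findex _ _ _) => m.
elim: m => [|m IH] /=; first by rewrite eqxx.
set z := iter m _ x in IH *; have zP : z \in P by rewrite inE fconnect_iter.
have [zk|zk] := boolP (psi1 z < k)%N.
  by move=> _; exists z; split => //; apply: follow_hit.
by rewrite {1 2}/follow (negbTE zk).
Qed.

(** The two rows that meet a column below k lie on the path together or not at all, so the swap
    preserves single hits. Backwards, i' has a predecessor on the path because it is not the start,
    where psi2 takes the value k. *)
Lemma path_rows_closed i i' : (psi1 i < k)%N -> psi2 i' = psi1 i -> (i \in P) = (i' \in P).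
Proof.
move=> ik e; apply/idP/idP => [iP|i'P].
  have -> : i' = nxt i.
    by apply: (placement_inj psi2P); rewrite ?e // follow_hit.
  by move: iP; rewrite !inE => /connect_trans; apply; apply: fconnect1.
have i'x : i' != x.
  by apply: contraTneq ik => i'x; rewrite -e i'x psi2x ltnn.
have [z [zP zk e']] := path_rows_pred i'P i'x.
by rewrite (_ : i = z) //; apply: (placement_inj psi1P); rewrite // -e -e'.
Qed.

Lemma exchange_placement : exchange k psi1 psi2 x \in placements k.
Proof.
have [A1 h1] := placementsP _ _ psi1P; have [A2 h2] := placementsP _ _ psi2P.
apply/placementsP; split => [i|j jk]; first by rewrite ffunE; case: ifP.
have /eqP/hits1P[i1 [e1 u1]] := h1 j jk; have /eqP/hits1P[i2 [e2 u2]] := h2 j jk.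
have c : (i1 \in P) = (i2 \in P) by apply: path_rows_closed; rewrite ?e1 ?e2.
apply/eqP/hits1P; have [iP|iP] := boolP (i2 \in P).
  exists i2; rewrite ffunE iP; split => // i; rewrite ffunE; case: ifPn => iP' e.
    exact: u2.
  by move: iP'; rewrite (u1 _ e) c iP.
exists i1; rewrite ffunE c (negbTE iP); split => // i; rewrite ffunE; case: ifPn => iP' e.
  by move: iP'; rewrite (u2 _ e) -/P (negbTE iP).
exact: u1.
Qed.

Lemma exchange'_placement : exchange' k psi1 psi2 x \in placements k.
Proof.
have [A1 h1] := placementsP _ _ psi1P; have [A2 h2] := placementsP _ _ psi2P.
apply/placementsP; split => [i|j jk]; first by rewrite ffunE; case: ifP.
have /eqP/hits1P[i1 [e1 u1]] := h1 j jk; have /eqP/hits1P[i2 [e2 u2]] := h2 j jk.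
have c : (i1 \in P) = (i2 \in P) by apply: path_rows_closed; rewrite ?e1 ?e2.
apply/eqP/hits1P; have [iP|iP] := boolP (i2 \in P).
  exists i1; rewrite ffunE c iP; split => // i; rewrite ffunE; case: ifPn => iP' e.
    exact: u1.
  by move: iP'; rewrite (u2 _ e) -/P iP.
exists i2; rewrite ffunE (negbTE iP); split => // i; rewrite ffunE; case: ifPn => iP' e.
  by move: iP'; rewrite (u1 _ e) -/P c (negbTE iP).
exact: u2.
Qed.

Lemma psi1_neq i : psi1 i != k.
Proof.
by apply/eqP => e; move/cards0_eq/setP: psi1k => /(_ i); rewrite !inE e eqxx.
Qed.

(** This recovers x from the exchanged pair, as needed for injectivity in [coef_logconcave]. *)
Lemma exchange_hit i : (exchange k psi1 psi2 x i == k) = (i == x).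
Proof.
rewrite ffunE; have [->|ix] := eqVneq i x.
  by rewrite path_rows_start psi2x eqxx.
case: ifPn => [iP|_]; last exact: negbTE (psi1_neq i).
have [z [_ zk ->]] := path_rows_pred iP ix.
exact: negbTE (psi1_neq z).
Qed.

Lemma exchange_hits : hits (exchange k psi1 psi2 x) k = 1%N.
Proof.
by apply/eqP/cards1P; exists x; apply/setP => i; rewrite !inE exchange_hit.
Qed.

Lemma exchange'_hits : (hits (exchange' k psi1 psi2 x) k).+1 = hits psi2 k.
Proof.
rewrite /hits (cardsD1 x [set i | psi2 i == k]) inE psi2x eqxx add1n; congr _.+1.
apply: eq_card => i; rewrite !inE ffunE; have [->|ix] := eqVneq i x.
  by rewrite path_rows_start (negbTE (psi1_neq x)).
case: ifPn => // iP; rewrite (negbTE (psi1_neq i)).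
have [z [_ zk ->]] := path_rows_pred iP ix.
by rewrite (negbTE (psi1_neq z)).
Qed.

(** On the path, [exchange'] agrees with psi1 and [exchange] with psi2, so the new pair in this
    order traces the same path; hence swapping twice is the identity. *)
Lemma path_rows_exchange :
  path_rows k (exchange' k psi1 psi2 x) (exchange k psi1 psi2 x) x = P.
Proof.
set g := follow k (exchange' k psi1 psi2 x) (exchange k psi1 psi2 x).
have gP i : i \in P -> g i = nxt i.
  move=> iP; rewrite /g /nxt /follow ffunE -/P iP; case: ifPn => // ik.
  have fP : nxt i \in P by rewrite -(path_rows_closed ik (follow_hit ik)).
  case: pickP => [i' /eqP e|/(_ (nxt i))]; last first.
    by rewrite ffunE -/P fP follow_hit // eqxx.
  have := follow_hit ik; rewrite /nxt /follow ik; case: pickP => [j /eqP ej|no] /=.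
    move=> _; apply: (placement_inj exchange_placement); first by rewrite e.
    have jP : j \in P by rewrite -(path_rows_closed ik ej).
    by rewrite e ffunE -/P jP.
  by move=> ei; have := no i; rewrite ei eqxx.
have itP m : iter m nxt x \in P by rewrite inE fconnect_iter.
have it m : iter m g x = iter m nxt x by elim: m => //= m ->; rewrite gP.
apply/setP => i; rewrite !inE; apply/idP/idP => /iter_findex <-.
  by rewrite it fconnect_iter.
by rewrite -it fconnect_iter.
Qed.

Lemma exchangeK :
  exchange k (exchange' k psi1 psi2 x) (exchange k psi1 psi2 x) x = psi2 /\
  exchange' k (exchange' k psi1 psi2 x) (exchange k psi1 psi2 x) x = psi1.
Proof.
by split; apply/ffunP => i; rewrite ffunE path_rows_exchange !ffunE -/P; case: (i \in P).
Qed.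

End Pair.
End Exchange.

(** * The linear coefficient of a polynomial with positive capacity *)

Section CoefBound.
Variables (R : realType) (c : nat -> R) (N : nat) (C : R).
Hypotheses (c_ge0 : forall m, 0 <= c m) (C_gt0 : 0 < C).
Hypothesis (c_logconcave : forall m, m.+1%:R * (c 0%N * c m.+1) <= c 1%N * c m).
Hypothesis (c_cap : forall t, 0 < t -> C * t <= \sum_(m < N) c m * t ^+ m).

(* The capacity step: the hypothesis forces [c m <= c 0 r ^ m / m!] with
   r = c 1 / c 0, so the series is at most [c 0 * e] at t = 1 / r. *)
Lemma capacity_coef1 : C <= expR 1 * c 1%N.
Proof.
have e1 : 1 <= expR 1 :> R by apply: le_trans (expR_ge1Dx 1); rewrite lerDl ler01.
(* Without a constant term the polynomial is c 1 t + O(t^2), so small t already yield C <= c 1. *)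
have [c0|c0] := eqVneq (c 0%N) 0.
  pose M := \sum_(m < N) c m.
  have M0 : 0 <= M by apply: sumr_ge0.
  have h t : 0 < t -> t <= 1 -> C <= c 1%N + t * M.
    move=> t0 t1; rewrite -(ler_pM2r t0); apply: le_trans (c_cap t0) _.
    have -> : (c 1%N + t * M) * t = c 1%N * t + \sum_(m < N) c m * t ^+ 2.
      by rewrite -mulr_suml -/M; ring.
    have [N1|N1] := ltnP 1 N; last first.
      rewrite ler_wpDl ?mulr_ge0 // ?(ltW t0) //; apply: ler_sum => -[[|m] mN] _ /=.
        by rewrite c0 !mul0r.
      by have : (m.+1 < 1)%N by apply: leq_trans N1.
    rewrite (bigD1 (Ordinal N1)) //= expr1 lerD2l big_mkcond /=.
    apply: ler_sum => -[[|[|m]] mN] _ /=.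
    - by rewrite c0 !mul0r.
    - by rewrite mulr_ge0 // exprn_ge0 // ltW.
    - rewrite ler_wpM2l // -addn2 exprD -[leRHS]mul1r.
      by rewrite ler_wpM2r ?exprn_ge0 ?exprn_ile1 // ltW.
  rewrite leNgt; apply/negP => lt; have D0 : 0 < C - c 1%N.
    have := c_ge0 1; nra.
  pose t := Num.min 1 ((C - c 1%N) / (2 * (M + 1))).
  have M1 : 0 < 2 * (M + 1) by lra.
  have t0 : 0 < t by rewrite lt_min ltr01 divr_gt0.
  have t1 : t <= 1 by rewrite ge_min lexx.
  have : t <= (C - c 1%N) / (2 * (M + 1)) by rewrite ge_min lexx orbT.
  by rewrite ler_pdivlMr // => tM; have := h t t0 t1; nra.
have {c0} c0 : 0 < c 0%N by rewrite lt_def c0 c_ge0.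
(* Here log-concavity annihilates all higher coefficients, and a constant polynomial violates
   [c_cap] at t = 2 c 0 / C. *)
have [c1|c1] := eqVneq (c 1%N) 0.
  have cS m : c m.+1 = 0.
    apply/eqP; rewrite eq_le c_ge0 andbT; have := c_logconcave m.
    by rewrite c1 mul0r mulrA pmulr_rle0 // mulr_gt0.
  have t0 : 0 < 2 * c 0%N / C by rewrite divr_gt0 // mulr_gt0.
  have := c_cap t0; rewrite mulrC divfK ?gt_eqF //.
  case: N => [|N']; first by rewrite big_ord0; lra.
  rewrite big_ord_recl big1 => [|i _]; last by rewrite cS mul0r.
  by rewrite expr0; lra.
have {c1} c1 : 0 < c 1%N by rewrite lt_def c1 c_ge0.
pose r := c 1%N / c 0%N; have r0 : 0 < r by rewrite divr_gt0.
have cm m : c m <= c 0%N * r ^+ m * (m`!%:R)^-1.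
  elim: m => [|m IH]; first by rewrite expr0 fact0 invr1 !mulr1.
  have f0 : 0 < m.+1%:R * c 0%N by rewrite mulr_gt0.
  rewrite -(ler_pM2l f0) -[leLHS]mulrA; apply: le_trans (c_logconcave m) _.
  apply: le_trans (ler_wpM2l (ltW c1) IH) _; rewrite le_eqVlt; apply/orP; left; apply/eqP.
  rewrite factS natrM exprS /r; field.
  by rewrite pnatr_eq0 -lt0n fact_gt0 [1 + _]addrC natr1 pnatr_eq0 (gt_eqF c0).
have rV0 : 0 < r^-1 by rewrite invr_gt0.
have := c_cap rV0; rewrite -(ler_pM2r r0) -mulrA mulVf ?gt_eqF // mulr1 => /le_trans.
apply; apply: (@le_trans _ _ (c 0%N * expR 1 * r)); last first.
  by rewrite le_eqVlt; apply/orP; left; apply/eqP; rewrite /r; field; rewrite gt_eqF.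
rewrite ler_wpM2r ?(ltW r0) //; apply: le_trans (ler_wpM2l (ltW c0) (exp_partial_sum R N)).
rewrite mulr_sumr; apply: ler_sum => i _; apply: le_trans (ler_wpM2r _ (cm i)) _.
  by rewrite exprn_ge0 // ltW.
rewrite le_eqVlt; apply/orP; left; apply/eqP; rewrite exprVn; field.
by rewrite !gt_eqF ?exprn_gt0 // ltr0n fact_gt0.
Qed.

End CoefBound.

(** * Gurvits' induction over the columns *)

Section Capacity.
Variables (R : realType) (n : nat) (A : 'I_n -> {set 'I_n}).
Implicit Types (psi : {ffun 'I_n -> 'I_n}) (x : 'I_n -> R) (k : 'I_n).

Definition weight x k psi : R := \prod_i (if psi i == k then 1 else x (psi i)).

(** The coefficient of (x k)^m in the sum of the monomials of [placements A k]; its value does not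
    involve x k. *)
Definition coef x k m : R := \sum_(psi in [set p in placements A k | hits p k == m]) weight x k psi.

Lemma weight_ge0 x k psi : (forall j, 0 <= x j) -> 0 <= weight x k psi.
Proof. by move=> x0; apply: prodr_ge0 => i _; case: ifP. Qed.

Lemma coef_ge0 x k m : (forall j, 0 <= x j) -> 0 <= coef x k m.
Proof. by move=> x0; apply: sumr_ge0 => psi _; apply: weight_ge0. Qed.

(** The factor m + 1 counts the rows x with psi2 x = k when psi2 has m + 1 hits. The exchange maps
    triples (psi1, psi2, x) injectively to pairs with 1 and m hits, and it preserves the product of
    the weights since it only swaps factors row by row. *)
Lemma coef_logconcave x k m : (forall j, 0 <= x j) ->
  m.+1%:R * (coef x k 0 * coef x k m.+1) <= coef x k 1 * coef x k m.
Proof.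
move=> x0; pose Q j := [set p in placements A k | hits p k == j].
pose D := [set t : {ffun 'I_n -> 'I_n} * {ffun 'I_n -> 'I_n} * 'I_n |
   [&& t.1.1 \in Q 0%N, t.1.2 \in Q m.+1 & t.1.2 t.2 == k]].
pose h (t : {ffun 'I_n -> 'I_n} * {ffun 'I_n -> 'I_n} * 'I_n) :=
  (exchange k t.1.1 t.1.2 t.2, exchange' k t.1.1 t.1.2 t.2).
pose G (t : {ffun 'I_n -> 'I_n} * {ffun 'I_n -> 'I_n}) := weight x k t.1 * weight x k t.2.
have G0 t : 0 <= G t by rewrite mulr_ge0 ?weight_ge0.
have DP t : t \in D -> [/\ t.1.1 \in placements A k, t.1.2 \in placements A k,
    hits t.1.1 k = 0%N, t.1.2 t.2 = k & hits t.1.2 k = m.+1].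
  by rewrite !inE => /and3P[/andP[-> /eqP->] /andP[-> /eqP->] /eqP->].
have hinj : {in D &, injective h}.
  move=> [[p1 p2] i] [[q1 q2] j] /DP[/= a1 a2 a3 a4 _] /DP[/= b1 b2 b3 b4 _] [e e'].
  have ij : i = j.
    by apply/eqP; rewrite -(exchange_hit b2 b3 b4) -e (exchange_hit a2 a3 a4).
  rewrite -ij in b4 e e' *.
  have [E1 E2] := exchangeK a1 a2 a4; have [F1 F2] := exchangeK b1 b2 b4.
  by move: E1 E2; rewrite e e' F1 F2 => -> ->.
have -> : m.+1%:R * (coef x k 0 * coef x k m.+1) = \sum_(t in D) G (h t).
  have -> : \sum_(t in D) G (h t) = \sum_(t in D) G t.1.
    apply: eq_bigr => t /DP[a1 a2 a3 a4 _]; rewrite /G /weight -!big_split /=.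
    by apply: eq_bigr => i _; rewrite !ffunE; case: (i \in _) => //; rewrite mulrC.
  rewrite (eq_bigl (fun t => [&& t.1.1 \in Q 0%N & t.1.2 \in Q m.+1] && (t.1.2 t.2 == k)));
    last by move=> t; rewrite inE andbA.
  rewrite -(pair_big_dep (fun p => [&& p.1 \in Q 0%N & p.2 \in Q m.+1])
     (fun p i => p.2 i == k) (fun p i => G p)) /=.
  rewrite /coef big_distrlr /= pair_big /= mulr_sumr.
  apply: eq_bigr => p /andP[_]; rewrite inE => /andP[_ /eqP pk].
  rewrite sumr_const -[in RHS]mulr_natl -pk /hits; congr (_%:R * _).
  by apply: eq_card => i; rewrite inE.
rewrite -(big_imset G hinj) /= /coef big_distrlr /= pair_big /=.
rewrite [leRHS](bigID (mem (h @: D))) /=.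
rewrite [X in _ <= X + _](_ : _ = \sum_(t in h @: D) G t).
  by rewrite lerDl sumr_ge0 // => t _; apply: G0.
apply: eq_bigl => t; rewrite andb_idl // => /imsetP[[[p q] i] /DP[/= a1 a2 a3 a4 a5] ->] /=.
have h' := exchange'_hits a2 a3 a4; rewrite a5 in h'; case: h' => h'.
apply/andP; split; rewrite inE; apply/andP; split.
- exact: exchange_placement.
- by rewrite (exchange_hits a2).
- exact: exchange'_placement.
- by rewrite h'.
Qed.

Lemma prod_weight x k t psi : x k = t ->
  \prod_i x (psi i) = weight x k psi * t ^+ hits psi k.
Proof.
move=> xk; rewrite /weight /hits -prodr_const [in RHS]big_mkcond /=.
rewrite [X in _ * X]big_mkcond -big_split /=; apply: eq_bigr => i _; rewrite inE.
by case: eqP => [->|_]; rewrite ?mul1r ?mulr1 ?xk.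
Qed.

Lemma placement_poly_coef x k (k' : nat) : k' = k :> nat ->
  \sum_(psi in placements A k') \prod_i x (psi i) = \sum_(m < n.+1) coef x k m * x k ^+ m.
Proof.
move=> ->.
rewrite (partition_big (fun psi => inord (hits psi k) : 'I_n.+1) xpredT) //=.
apply: eq_bigr => m _; rewrite /coef mulr_suml.
apply: eq_big => [psi|psi /andP[_ /eqP <-]].
  rewrite !inE -val_eqE /= inordK // ltnS -[leqRHS](card_ord n); exact: max_card.
rewrite inordK ?(prod_weight psi (erefl (x k))) //.
by rewrite ltnS -[leqRHS](card_ord n); exact: max_card.
Qed.

Lemma placements_next x k (k' : nat) : k' = k.+1 ->
  \sum_(psi in placements A k') \prod_i x (psi i) = x k * coef x k 1.
Proof.
move=> ->; rewrite /coef mulr_sumr; apply: eq_big => [psi|psi].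
  rewrite !inE -andbA; congr andb; apply/forallP/andP => [h|[/forallP h1 h2] j].
    split; last by have := h k; rewrite leqnn.
    by apply/forallP => j; apply/implyP => jk; apply: (implyP (h j)); rewrite ltnS ltnW.
  apply/implyP; rewrite ltnS leq_eqVlt => /orP[|jk]; last exact: (implyP (h1 j)).
  by rewrite val_eqE => /eqP ->.
case/placementsP => _ /(_ k (leqnn _)) h.
by rewrite (prod_weight psi (erefl (x k))) h mulrC expr1.
Qed.

Variable d : nat.
Hypotheses (row_reg : forall i, #|A i| = d) (col_reg : forall j, #|[set i | j \in A i]| = d).

(** AM-GM in each row. Column regularity makes each x j occur d times in the product over all rows,
    which gives the d-th power of the claim. *)
Lemma capacity0 x : (forall j, 0 < x j) ->
  d%:R ^+ n * \prod_j x j <= \prod_i \sum_(j in A i) x j.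
Proof.
move=> x0; have [->|d0] := posnP d.
  have [n0|n0] := posnP n; last first.
    rewrite expr0n eqn0Ngt n0 mul0r; apply: prodr_ge0 => i _.
    by apply: sumr_ge0 => j _; apply: ltW.
  by rewrite [X in _ ^+ X]n0 expr0 mul1r !big_pred0 // => i;
    have := leq_ltn_trans (leq0n i) (ltn_ord i); rewrite n0.
have s0 i : 0 <= \sum_(j in A i) x j by apply: sumr_ge0 => j _; apply: ltW.
rewrite -(@ler_pXn2r _ d) ?nnegrE //; last first.
- exact: prodr_ge0.
- by rewrite mulr_ge0 ?exprn_ge0 ?prodr_ge0 // => j _; apply: ltW.
rewrite exprMn -exprM mulnC exprM -!prodrXl.
have -> : \prod_j x j ^+ d = \prod_i \prod_(j in A i) x j.
  rewrite (exchange_big_dep xpredT) //=; apply: eq_bigr => j _.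
  by rewrite -(col_reg j) -prodr_const; apply: eq_bigl => i; rewrite inE.
rewrite -[n in _ ^+ n](card_ord n) -prodr_const -big_split /=.
apply: ler_prod => i _; rewrite mulr_ge0 ?exprn_ge0 ?prodr_ge0 //=; last first.
  by move=> j _; apply: ltW.
have [+ _] := @leif_AGM R _ (mem (A i)) x (fun j _ => ltW (x0 j)).
rewrite row_reg expr_div_n ler_pdivlMr ?exprn_gt0 ?ltr0n //.
by rewrite mulrC.
Qed.

(** Requiring a single hit in column k extracts the linear coefficient in x k and costs a factor e
    by [capacity_coef1]. The bound is kept for all positive x because the induction step varies one
    coordinate. *)
Lemma capacity (k : nat) x : (k <= n)%N -> (forall j, 0 < x j) ->
  d%:R ^+ n * \prod_j x j <= expR 1 ^+ k * \sum_(psi in placements A k) \prod_i x (psi i).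
Proof.
elim: k x => [|k IH] x kn x0.
  rewrite expr0 mul1r; apply: le_trans (capacity0 x0) _.
  rewrite (bigA_distr_big_dep _ (fun i j => x j)) /= le_eqVlt; apply/orP; left; apply/eqP.
  apply: eq_bigl => psi; apply/idP/idP => [/familyP h|/placementsP[h _]].
    by apply/placementsP; split=> // i; apply: h.
  by apply/familyP => i; apply: h.
pose kk := Ordinal kn; rewrite (@placements_next x kk) // exprSr.
have [d0|d0] := posnP d.
  have n0 : n != 0%N by rewrite -lt0n (leq_trans _ kn).
  rewrite d0 expr0n (negbTE n0) mul0r !mulr_ge0 ?exprn_ge0 ?expR_ge0 ?coef_ge0 ?(ltW (x0 _)) //.
  by move=> j; apply: ltW.
pose C := (expR 1 ^+ k)^-1 * (d%:R ^+ n * \prod_(j | j != kk) x j).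
have eK : 0 < expR 1 ^+ k :> R by rewrite exprn_gt0 ?expR_gt0.
have C0 : 0 < C.
  apply: mulr_gt0; first by rewrite invr_gt0.
  by apply: mulr_gt0; [rewrite exprn_gt0 ?ltr0n | apply: prodr_gt0].
have cap : C <= expR 1 * coef x kk 1.
  apply: (@capacity_coef1 _ _ n.+1) => // [m|m|t t0].
  - by apply: coef_ge0 => j; apply: ltW.
  - by apply: coef_logconcave => j; apply: ltW.
  pose x' j := if j == kk then t else x j.
  have x'0 j : 0 < x' j by rewrite /x'; case: ifP.
  (* [coef] at kk ignores the coordinate kk, which is thus free to serve as the variable t. *)
  have := IH x' (ltnW kn) x'0; rewrite (@placement_poly_coef x' kk) //.
  rewrite (bigD1 kk) //= {1}/x' eqxx (eq_bigr x) => [|j /negbTE jk]; last by rewrite /x' jk.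
  rewrite -ler_pdivrMl // => h.
  have -> : C * t = (expR 1 ^+ k)^-1 * (d%:R ^+ n * (t * \prod_(j | j != kk) x j)).
    by rewrite /C; ring.
  apply: le_trans h _.
  apply: ler_sum => m _; rewrite {2}/x' eqxx le_eqVlt; apply/orP; left; apply/eqP; congr (_ * _).
  by apply: eq_bigr => psi _; apply: eq_bigr => i _; rewrite /x'; case: eqP.
rewrite (bigD1 kk) //= -(ler_pM2l (x0 kk)) in cap *.
move: cap; rewrite /C -(ler_pM2l eK) => cap.
by apply: le_trans (le_trans _ cap) _; rewrite le_eqVlt; apply/orP; left; apply/eqP;
  [field; rewrite gt_eqF | ring].
Qed.

(** At x = 1 and k = n the placements are permutations. This is van der Waerden's bound with n!/n^n
    weakened to e^-n. *)
Theorem perm_lower_bound :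
  d%:R ^+ n <= expR 1 ^+ n * #|[set p : {perm 'I_n} | [forall i, p i \in A i]]|%:R :> R.
Proof.
have := @capacity n (fun=> 1) (leqnn n) (fun=> ltr01).
rewrite big1 ?mulr1 // => /le_trans; apply; rewrite ler_wpM2l ?exprn_ge0 ?expR_ge0 //.
rewrite sumr_const ler_nat.
have inj psi : psi \in placements A n -> injective psi.
  by move=> pP i i'; apply: placement_inj pP _.
pose f psi := odflt 1%g [pick p : {perm 'I_n} | [forall i, p i == psi i]].
have fE psi : psi \in placements A n -> f psi =1 psi.
  move=> pP i; rewrite /f; case: pickP => [p /forallP/(_ i)/eqP //|/(_ (perm (inj _ pP)))].
  by case/negP; apply/forallP => j; rewrite permE.
rewrite -(card_in_imset (f := f)); last first.
  by move=> p q pP qP e; apply/ffunP => i; rewrite -fE // -[RHS]fE // e.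
apply/subset_leq_card/subsetP => _ /imsetP[psi pP ->]; rewrite inE.
apply/forallP => i; rewrite fE //; have [h _] := placementsP _ _ _ pP; exact: h.
Qed.

End Capacity.

(** * Counting Latin squares row by row *)

Section Trees.
Variable R : realType.

(** Serves both for the rows of Latin rectangles ([discordant]) and for points in distinct orbits
    ([cross_orbit]). *)
Definition pairwise_tuples (V : finType) (r : rel V) k := [set t : k.-tuple V | pairwise r t].

Lemma pairwise_tuples_grow (V : finType) (r : rel V) k (b : R) :
  (forall t : k.-tuple V, pairwise r t -> b <= #|[set x | all (r x) t]|%:R) ->
  b * #|pairwise_tuples r k|%:R <= #|pairwise_tuples r k.+1|%:R.
Proof.
move=> hb; pose D := [set xt : V * k.-tuple V | pairwise r (xt.1 :: xt.2)].
apply: (@le_trans _ _ #|D|%:R); last first.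
  rewrite ler_nat -(card_imset D (f := fun xt => cons_tuple xt.1 xt.2)); last first.
    by move=> [x t] [y t'] /(congr1 val) /= [-> /val_inj ->].
  apply/subset_leq_card/subsetP => _ /imsetP[xt xtD ->]; rewrite inE; move: xtD; rewrite inE.
  by [].
rewrite -[in leRHS]sum1_card natr_sum (eq_bigl (fun xt : V * k.-tuple V => pairwise r xt.2 && all (r xt.1) xt.2));
  last by move=> xt; rewrite inE /= andbC.
rewrite (reindex (fun p : k.-tuple V * V => (p.2, p.1))) /=; last first.
  by exists (fun p => (p.2, p.1)) => -[].
rewrite -(pair_big_dep (fun t : k.-tuple V => pairwise r t) (fun t x => all (r x) t) (fun _ _ => 1)) /=.
rewrite mulr_natr -sumr_const big_mkcond [leRHS]big_mkcond /=.
apply: ler_sum => t _; rewrite inE; case: ifP => // /hb; rewrite -sum1_card natr_sum.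
by move/le_trans; apply; rewrite le_eqVlt; apply/orP; left; apply/eqP/eq_bigl => x; rewrite inE.
Qed.

(** The elements of S are the leaves of a tree that branches on obs 0, obs 1, and so on; b k bounds
    the branching at depth k. The induction splits S at the root. *)
Lemma tree_bound (U V : finType) m : forall (obs : nat -> U -> V) (b : nat -> R) (S : {set U}),
  (forall T T', T \in S -> T' \in S -> (forall i, (i < m)%N -> obs i T = obs i T') -> T = T') ->
  (forall k, 0 <= b k) ->
  (forall k T0, (k < m)%N -> T0 \in S ->
     #|[set obs k T | T in [set T in S | [forall i : 'I_k, obs i T == obs i T0]]]|%:R <= b k) ->
  #|S|%:R <= \prod_(k < m) b k.
Proof.
elim: m => [|m IH] obs b S inj b0 hb.
  rewrite big_ord0 lern1; apply/card_le1_eqP => T T' TS T'S; exact: inj.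
have [->|[T0 T0S]] := set_0Vmem S; first by rewrite cards0 prodr_ge0.
rewrite big_ord_recl /=.
have -> : #|S|%:R = \sum_(v in [set obs 0%N T | T in S]) #|[set T in S | obs 0%N T == v]|%:R :> R.
  rewrite -natr_sum -sum1_card (partition_big (obs 0%N) (mem [set obs 0%N T | T in S])) /=.
    by congr _%:R; apply: eq_bigr => v _; rewrite -sum1_card; apply: eq_bigl => T; rewrite inE.
  by move=> T TS; apply: imset_f.
apply: (@le_trans _ _ (\sum_(v in [set obs 0%N T | T in S]) \prod_(k < m) b k.+1)).
  apply: ler_sum => v _; apply: (IH (fun i => obs i.+1) (fun k => b k.+1)) => //.
    move=> T T'; rewrite !inE => /andP[TS /eqP e] /andP[T'S /eqP e'] h.
    by apply: inj => // -[|i] im; [rewrite e e' | apply: h].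
  move=> k T1 km; rewrite inE => /andP[T1S /eqP e1].
  apply: le_trans (hb k.+1 T1 km T1S); rewrite ler_nat; apply: subset_leq_card.
  apply: imsetS; apply/subsetP => T; rewrite !inE => /andP[/andP[-> /eqP e] /forallP h] /=.
  apply/forallP => -[[|i] ik] /=; first by rewrite e e1.
  exact: (h (Ordinal (ik : (i < k)%N))).
rewrite sumr_const -[leLHS]mulr_natl ler_wpM2r ?prodr_ge0 //.
apply: le_trans (hb 0%N T0 isT T0S); rewrite ler_nat; apply: subset_leq_card.
by apply: imsetS; apply/subsetP => T TS; rewrite inE TS; apply/forallP => -[].
Qed.

End Trees.

Section Latin.
Variable n : nat.
Implicit Types (T : 'M['I_n]_n) (H : {set 'I_n}).

Lemma latinP T : reflect ((forall x, injective (T x)) /\ (forall y, injective (T^~ y))) (latin_square T).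
Proof.
apply: (iffP andP) => -[h1 h2]; split.
- move=> x y y' e; have /forallP/(_ x)/forallP/(_ (T x y'))/cards1P[z /setP hz] := h1.
  have := hz y; have := hz y'; rewrite !inE e eqxx => /esym/eqP -> /esym/eqP -> //.
- move=> y x x' /= e; have /forallP/(_ y)/forallP/(_ (T x' y))/cards1P[z /setP hz] := h2.
  have := hz x; have := hz x'; rewrite !inE e eqxx => /esym/eqP -> /esym/eqP -> //.
- apply/forallP => x; apply/forallP => z; apply/cards1P; have [g gK Kg] := injF_bij (h1 x).
  by exists (g z); apply/setP => y; rewrite !inE; apply/eqP/eqP => [<-|->].
- apply/forallP => y; apply/forallP => z; apply/cards1P; have [g gK Kg] := injF_bij (h2 y).
  by exists (g z); apply/setP => x; rewrite !inE; apply/eqP/eqP => [<-|->].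
Qed.

Definition row_perm_of T r : {perm 'I_n} := odflt 1%g [pick p : {perm 'I_n} | [forall c, p c == T r c]].

Lemma row_perm_ofE T r c : latin_square T -> row_perm_of T r c = T r c.
Proof.
move=> /latinP[h _]; rewrite /row_perm_of.
case: pickP => [p /forallP/(_ c)/eqP //|/(_ (perm (h r)))].
by case/negP; apply/forallP => j; rewrite permE.
Qed.

Lemma eq_rows T T' : latin_square T -> latin_square T' ->
  (forall r, row_perm_of T r = row_perm_of T' r) -> T = T'.
Proof. by move=> l l' h; apply/matrixP => x y; rewrite -!row_perm_ofE // h. Qed.

(** The rows are revealed in the order rho 0, rho 1, ...; these are the values that column c has
    left after k of them. *)
Definition avail (rho : {perm 'I_n}) (k : nat) T c : {set 'I_n} :=
  [set s | [forall i : 'I_n, (i < k)%N ==> (T (rho i) c != s)]].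

Lemma card_lt_ord k : (k <= n)%N -> #|[set i : 'I_n | (i < k)%N]| = k.
Proof.
move=> kn; rewrite -sum1_card (eq_bigl (fun i : 'I_n => (i < k)%N)) => [|i]; last by rewrite inE.
by rewrite -(big_ord_widen _ (fun=> 1%N)) // sum1_card card_ord.
Qed.

Lemma card_avail rho k T c : latin_square T -> (k <= n)%N -> #|avail rho k T c| = (n - k)%N.
Proof.
move=> /latinP[_ h] kn; have -> : avail rho k T c = ~: ((fun i => T (rho i) c) @: [set i : 'I_n | (i < k)%N]).
  apply/setP => s; rewrite !inE; apply/forallP/negP => [a /imsetP[i]|a i].
    by rewrite inE => ik e; have := a i; rewrite ik e eqxx.
  by apply/implyP => ik; apply/eqP => e; apply: a; apply/imsetP; exists i; rewrite ?inE.
rewrite cardsCs setCK card_imset ?card_lt_ord ?card_ord //.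
by move=> i i' /h/perm_inj.
Qed.

End Latin.

(** * Latin squares from below *)

Section LowerBound.
Variables (R : realType) (n : nat).

Definition discordant (p q : {perm 'I_n}) := [forall c, p c != q c].

Definition open_values (t : seq {perm 'I_n}) c := [set s | all (fun q : {perm 'I_n} => q c != s) t].

Lemma card_open_values k (t : k.-tuple {perm 'I_n}) c : pairwise discordant t ->
  #|open_values t c| = (n - k)%N.
Proof.
move=> tP; have u : uniq [seq q c | q : {perm 'I_n} <- t].
  rewrite uniq_pairwise pairwise_map; apply: sub_pairwise tP => p q /forallP; exact.
have -> : open_values t c = ~: [set s in [seq q c | q : {perm 'I_n} <- t]].
  apply/setP => s; rewrite !inE; apply/allP/idP => [h|h q qt].
    by apply/mapP => -[q qt e]; have := h q qt; rewrite e eqxx.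
  by apply: contra h => /eqP <-; apply: (map_f (fun q : {perm 'I_n} => q c)).
by rewrite cardsCs setCK cardsE (card_uniqP u) size_map size_tuple card_ord.
Qed.

(** Each of the k rows puts s in one column, and these columns differ because the rows are
    discordant. This is the column regularity asked for by [perm_lower_bound]. *)
Lemma card_open_places k (t : k.-tuple {perm 'I_n}) s : pairwise discordant t ->
  #|[set c | s \in open_values t c]| = (n - k)%N.
Proof.
move=> tP; have u : uniq [seq (q^-1)%g s | q : {perm 'I_n} <- t].
  rewrite uniq_pairwise pairwise_map; apply: sub_pairwise tP => p q /forallP h /=.
  by apply: contraNneq (h (p^-1%g s)) => e; rewrite {2}e !permKV.
have -> : [set c | s \in open_values t c] = ~: [set c in [seq (q^-1)%g s | q : {perm 'I_n} <- t]].
  apply/setP => c; rewrite !inE; apply/allP/idP => [h|h q qt].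
    by apply/mapP => -[q qt e]; have := h q qt; rewrite e permKV eqxx.
  apply: contra h => /eqP <-; rewrite -[X in X \in _](permK q).
  exact: (map_f (fun q' : {perm 'I_n} => (q'^-1)%g (q c))).
by rewrite cardsCs setCK cardsE (card_uniqP u) size_map size_tuple card_ord.
Qed.

Lemma discordant_grow k :
  ((n - k)%:R / expR 1) ^+ n * #|pairwise_tuples discordant k|%:R
    <= #|pairwise_tuples discordant k.+1|%:R :> R.
Proof.
apply: pairwise_tuples_grow => t tP; rewrite expr_div_n ler_pdivrMr ?exprn_gt0 ?expR_gt0 //.
rewrite mulrC; apply: le_trans (@perm_lower_bound R n (open_values t) (n - k) _ _) _.
- by move=> c; apply: card_open_values.
- by move=> s; apply: card_open_places.
rewrite ler_wpM2l ?exprn_ge0 ?expR_ge0 // ler_nat; apply/subset_leq_card/subsetP => p.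
rewrite !inE => /forallP h; apply/allP => q qt; apply/forallP => c.
by have := h c; rewrite inE => /allP/(_ q qt); rewrite eq_sym.
Qed.

Lemma card_latin_ge :
  \prod_(k < n) ((n - k)%:R / expR 1) ^+ n <= #|[set T : 'M['I_n]_n | latin_square T]|%:R :> R.
Proof.
have H m : \prod_(k < m) ((n - k)%:R / expR 1) ^+ n <= #|pairwise_tuples discordant m|%:R :> R.
  elim: m => [|m IH].
    rewrite big_ord0 ler1n; apply/card_gt0P; exists [tuple]; by rewrite inE.
  rewrite big_ord_recr /= mulrC; apply: le_trans (discordant_grow m).
  by rewrite ler_wpM2l // exprn_ge0 // divr_ge0 ?expR_ge0.
apply: le_trans (H n) _; rewrite ler_nat.
pose f (t : n.-tuple {perm 'I_n}) : 'M['I_n]_n := \matrix_(x, y) tnth t x y.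
have finj : injective f.
  move=> t t' e; apply: eq_from_tnth => x; apply/permP => y.
  by have := congr1 (fun M : 'M_n => M x y) e; rewrite !mxE.
rewrite -(card_imset _ finj); apply/subset_leq_card/subsetP => _ /imsetP[t tP ->].
rewrite inE; apply/latinP; split => [x y y'|y x x' /=]; rewrite !mxE; first exact: perm_inj.
move: tP; rewrite inE => /(pairwiseP 1%g) tP.
wlog lt : x x' / (x < x')%N => [W|].
  by case: (ltngtP x x') => [lt|lt|/val_inj //] e; [|apply/esym]; apply: W => //; apply/esym.
move=> e; have /forallP/(_ y) : discordant (nth 1%g t x) (nth 1%g t x').
  by apply: tP => //; rewrite inE size_tuple.
by rewrite -!tnth_nth e eqxx.
Qed.

End LowerBound.

(** * Latin squares from above, and the saving due to a subloop *)

Section UpperBound.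
Variables (R : realType) (n : nat).
Implicit Types (T : 'M['I_n]_n) (H : {set 'I_n}) (S : {set 'M['I_n]_n}) (W : {set {perm 'I_n}}).

(** An instance of [tree_bound]. W stands for the rows rho k of the squares in S that agree with T0
    on the earlier rows; the hypothesis retains just two facts about them, that each occurs in some
    member of S and that its values are available. *)
Lemma latin_count (rho : {perm 'I_n}) (beta : nat -> R) S :
  (forall T, T \in S -> latin_square T) ->
  (forall (k : 'I_n) T0 W, T0 \in S ->
     (forall p, p \in W -> (exists2 T, T \in S & p = row_perm_of T (rho k)) /\
        forall c, p c \in avail rho k T0 c) ->
     (0 < #|W|)%N -> ln #|W|%:R <= beta k) ->
  #|S|%:R <= expR (\sum_(k < n) beta k).
Proof.
move=> latS hb; rewrite expR_sum.
pose obs i T := if insub i is Some j then row_perm_of T (rho j) else 1%g.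
have obsE (j : 'I_n) T : obs j T = row_perm_of T (rho j) by rewrite /obs valK.
apply: (@tree_bound R _ _ n obs (fun k => expR (beta k))).
- move=> T T' TS T'S h; apply: eq_rows; rewrite ?latS // => r.
  by have := h (rho^-1%g r) (ltn_ord _); rewrite !obsE permKV.
- by move=> k; apply: expR_ge0.
move=> k T0 kn T0S; set W := [set _ | _ in _].
have [->|[p0 p0W]] := set_0Vmem W; first by rewrite cards0 expR_ge0.
have W0 : (0 < #|W|)%N by apply/card_gt0P; exists p0.
rewrite -[leLHS]lnK ?posrE ?ltr0n // ler_expR; apply: (hb (Ordinal kn) T0) => // p.
case/imsetP => T; rewrite inE => /andP[TS /forallP h] ->; rewrite (obsE (Ordinal kn)); split.
  by exists T.
move=> c; rewrite inE; apply/forallP => i; apply/implyP => ik.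
have /eqP e := h (Ordinal ik); rewrite !obsE in e.
rewrite -row_perm_ofE ?latS // -e !row_perm_ofE ?latS //.
apply/eqP => e'; have [_ inj] := latinP _ (latS _ TS); have /perm_inj ik' := inj _ _ _ e'.
by move: ik; rewrite ik' ltnn.
Qed.

Lemma bregman_regular W (A : 'I_n -> {set 'I_n}) d :
  (forall p, p \in W -> forall c, p c \in A c) -> (forall c, #|A c| = d) -> (0 < #|W|)%N ->
  ln #|W|%:R <= n%:R * meanln R d.
Proof.
move=> WA Ad W0.
apply: le_trans (@bregman R _ A n setT setT W _ _ _ _ W0) _; rewrite ?cardsT ?card_ord //.
- by move=> p pW c _; rewrite inE WA ?inE.
- by move=> p q _ _ h; apply/permP => c; apply: h; rewrite inE.
under eq_bigr do rewrite setIT Ad.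
by rewrite big_const /= cardsT card_ord iter_addr_0 mulr_natl.
Qed.

Definition closed_in T H := [forall x in H, forall y in H, T x y \in H].

Lemma closed_inP T H : reflect {in H &, forall x y, T x y \in H} (closed_in T H).
Proof.
apply: (iffP forall_inP) => h x; last by move=> xH; apply/forall_inP => y; apply: h.
by move=> y xH; move: y; apply/forall_inP/h.
Qed.

Lemma closed_row T H x y : latin_square T -> closed_in T H -> x \in H ->
  (T x y \in H) = (y \in H).
Proof.
move=> /latinP[inj _] /closed_inP cl xH; apply/idP/idP => [|yH]; last exact: cl.
have {1}-> : H = T x @: H.
  apply/esym/eqP; rewrite eqEcard card_imset ?leqnn ?andbT //.
  by apply/subsetP => _ /imsetP[z zH ->]; apply: cl.
by case/imsetP => z zH /inj ->.
Qed.

(** For x outside H, the sets H and x H are disjoint: if x y lies in H with y in H, then right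
    translation by y, which permutes H, forces x into H. *)
Lemma closed_half T H : latin_square T -> closed_in T H -> H != setT -> (#|H|.*2 <= n)%N.
Proof.
move=> lat cl; rewrite eqEsubset subsetT /= => /subsetPn[x _ xH].
have [inj inj'] := latinP _ lat.
have d : [disjoint H & T x @: H].
  apply/pred0P => z /=; apply/negP => /andP[zH /imsetP[y yH e]].
  have : z \in (T^~ y) @: H.
    rewrite (_ : _ @: H = H) //; apply/eqP; rewrite eqEcard card_imset ?leqnn ?andbT //.
    by apply/subsetP => _ /imsetP[w wH ->]; apply: (closed_inP _ _ cl).
  by case/imsetP => w wH; rewrite e => /inj' xw; rewrite xw wH in xH.
rewrite -addnn -[X in (_ + X)%N](card_imset _ (inj x)) -cardsUI.
by move: d; rewrite -setI_eq0 => /eqP ->; rewrite cards0 addn0 -[leqRHS](card_ord n) max_card.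
Qed.

Lemma enum_first H : exists rho : {perm 'I_n}, forall i : 'I_n, (i < #|H|)%N = (rho i \in H).
Proof.
pose s := enum H ++ enum (~: H).
have us : uniq s.
  rewrite cat_uniq !enum_uniq andbT /=; apply/hasPn => x.
  by rewrite !mem_enum inE.
have ss : size s = n by rewrite size_cat -!cardE cardsC card_ord.
have inj : injective (fun i : 'I_n => nth i s i).
  move=> i j /= e; apply/val_inj/eqP; rewrite -(nth_uniq i _ _ us) ?ss ?ltn_ord //.
  by apply/eqP; rewrite e; apply: set_nth_default; rewrite ss.
exists (perm inj) => i; rewrite permE nth_cat -cardE.
have [lt|ge] := ltnP i #|H|.
  by rewrite -mem_enum mem_nth // -cardE.
have : nth i (enum (~: H)) (i - #|H|) \in enum (~: H).
  apply: mem_nth; rewrite -cardE [X in (_ < X)%N]cardsCs setCK card_ord ltn_sub2r //.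
  exact: leq_ltn_trans ge (ltn_ord i).
by rewrite mem_enum inE => /negbTE ->.
Qed.

(** The exponent that [bregman_regular] gives for all Latin squares; every saving is measured
    against it. *)
Definition logmain : R := \sum_(k < n) n%:R * meanln R (n - k).

(* Filling the rows of H first, the cells in the columns of H have at most
   #|H| - k <= (n - k) / 2 admissible values in row k instead of n - k. *)
Lemma closed_count H : (0 < #|H|)%N -> (#|H|.*2 <= n)%N ->
  #|[set T | latin_square T & closed_in T H]|%:R <=
    expR (logmain - #|H|%:R ^+ 2 * (ln 2 / 2)) :> R.
Proof.
set m := #|H| => m0 m2; have [rho rhoH] := enum_first H.
have mn : (m <= n)%N by apply: leq_trans m2; rewrite -addnn leq_addr.
(* In each of the m rows of H, the m cells in columns of H save ln 2 / 2 each. *)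
pose beta k : R := n%:R * meanln R (n - k) - (if (k < m)%N then m%:R * (ln 2 / 2) else 0).
have -> : logmain - m%:R ^+ 2 * (ln 2 / 2) = \sum_(k < n) beta k.
  rewrite /beta sumrB; congr (_ - _); rewrite -big_mkcond /=.
  rewrite (eq_bigl (fun k : 'I_n => k \in [set i : 'I_n | (i < m)%N])) => [|k]; last by rewrite inE.
  by rewrite sumr_const card_lt_ord // -[RHS]mulr_natl; ring.
apply: (latin_count (rho := rho)) => [T|k T0 W]; first by rewrite inE => /andP[].
rewrite inE => /andP[lat0 cl0] WP W0; have [_ inj0] := latinP _ lat0.
have kn : (k <= n)%N by apply: ltnW.
rewrite /beta; case: ifPn => [km|_]; last first.
  rewrite subr0; apply: bregman_regular W0; first by move=> p /WP[_]; apply.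
  by move=> c; apply: card_avail.
(* A row of H permutes H, hence also its complement, so both kinds of columns are confined. *)
pose A c := if c \in H then avail rho k T0 c :&: H else avail rho k T0 c :\: H.
have cA c : c \in H -> #|A c| = (m - k)%N.
  move=> cH; rewrite /A cH.
  have -> : avail rho k T0 c :&: H = H :\: (fun i => T0 (rho i) c) @: [set i : 'I_n | (i < k)%N].
    apply/setP => s; rewrite !inE andbC [RHS]andbC; congr andb.
    apply/forallP/negP => [a /imsetP[i]|a i].
      by rewrite inE => ik e; have := a i; rewrite ik e eqxx.
    by apply/implyP => ik; apply/eqP => e; apply: a; apply/imsetP; exists i; rewrite ?inE.
  rewrite cardsDS.
    by rewrite card_imset ?card_lt_ord // => i i' /inj0/perm_inj.
  apply/subsetP => _ /imsetP[i + ->]; rewrite inE => ik.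
  by apply: (closed_inP _ _ cl0) => //; rewrite -rhoH (ltn_trans ik).
have cAC c : c \notin H -> #|A c| = (n - m - k)%N.
  move=> cH; rewrite /A (negbTE cH) cardsD card_avail // subnAC; congr (_ - _)%N.
  (* Column c lies outside H, so the rows revealed so far, all in H, have used no value of H
     there. *)
  rewrite (setIidPr _) //; apply/subsetP => s sH; rewrite inE; apply/forallP => i.
  apply/implyP => ik; apply: contraNneq cH => e.
  by rewrite -(closed_row c lat0 cl0 (x := rho i)) ?e // -rhoH (ltn_trans ik).
have WA p : p \in W -> forall c, p c \in A c.
  case/WP => -[T + ->] pA c; rewrite inE => /andP[lat cl].
  have E : (row_perm_of T (rho k) c \in H) = (c \in H).
    by rewrite row_perm_ofE // (closed_row _ lat cl) // -rhoH.
  by rewrite /A; case: ifP => cH; rewrite inE ?E cH pA.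
apply: le_trans (@bregman R _ A n setT setT W _ _ _ _ W0) _; rewrite ?cardsT ?card_ord //.
- by move=> p pW c _; rewrite inE WA ?inE.
- by move=> p q _ _ h; apply/permP => c; apply: h; rewrite inE.
under eq_bigr do rewrite setIT.
rewrite (bigID (mem H)) /= (eq_bigr (fun=> meanln R (m - k))) => [|c /andP[_ /cA->]] //.
rewrite [X in _ + X](eq_bigr (fun=> meanln R (n - m - k))) => [|c /andP[_ /cAC->]] //.
rewrite !sumr_const.
have -> : #|[pred c in [set: 'I_n] | c \in H]| = m by apply: eq_card => c; rewrite !inE.
have -> : #|[pred c in [set: 'I_n] | c \notin H]| = (n - m)%N.
  have := cardsC H; rewrite card_ord -/m => nE; rewrite -[X in (X - m)%N]nE addKn.
  by apply: eq_card => c; rewrite !inE.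
rewrite -(mulr_natl (meanln R (m - k))) -(mulr_natl (meanln R (n - m - k))).
have g1 : meanln R (m - k) + ln 2 / 2 <= meanln R (n - k).
  by apply: meanln_gap; [rewrite subn_gt0 | rewrite doubleB; lia].
have g2 : meanln R (n - m - k) <= meanln R (n - k) by apply: meanln_homo; lia.
have g3 : n%:R = m%:R + (n - m)%:R :> R by rewrite -natrD subnKC.
rewrite g3 mulrDl; have := ler_wpM2l (ler0n R m) g1; have := ler_wpM2l (ler0n R (n - m)) g2.
rewrite mulrDr; lra.
Qed.

End UpperBound.

(** * Permutations all of whose orbits are small *)

Section SmallOrbits.
Variables (n : nat).
Implicit Types (p q w : {perm 'I_n}) (U : {set 'I_n}).

Definition cross_orbit p : rel 'I_n := fun x y => x \notin porbit p y.

Lemma cross_orbit_sym p : symmetric (cross_orbit p).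
Proof. by move=> x y; rewrite /cross_orbit porbit_sym. Qed.

Lemma pairwise_neq (T : eqType) (r : rel T) (t : seq T) : symmetric r -> pairwise r t ->
  {in t &, forall x y, x != y -> r x y}.
Proof.
move=> rs; elim: t => //= a t IH /andP[/allP at_ tP] x y; rewrite !inE.
move=> /orP[/eqP->|xt] /orP[/eqP->|yt]; rewrite ?eqxx // => ne.
- exact: at_.
- by rewrite rs; apply: at_.
- exact: IH.
Qed.

(* The part of p outside U is a union of paths, and a transversal U of the
   orbits leaves only one way to close them up. *)
Lemma eq_perm_transversal p q U :
  {in U &, forall x y, x != y -> cross_orbit p x y} ->
  {in U &, forall x y, x != y -> cross_orbit q x y} ->
  {in ~: U, p =1 q} -> p = q.
Proof.
move=> Up Uq pq; apply/permP => u.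
have [uU|uU] := boolP (u \in U); last by apply: pq; rewrite inE.
set z := p u.
have zu : u \in porbit p z by rewrite porbit_sym -[z]/((p ^+ 1)%g u) mem_porbit.
have /porbitP[i0 e0] := zu.
have ex : exists i, (p ^+ i)%g z \in U by exists i0; rewrite -e0.
(* The walk from z = p u first returns to U after k steps, necessarily at u; until then q follows
   the same path. *)
case: (ex_minnP ex) => k kU kmin.
have it l : (l <= k)%N -> (q ^+ l)%g z = (p ^+ l)%g z.
  elim: l => [|l IH] lk; first by rewrite !expg0.
  rewrite !expgSr !permM IH ?(ltnW lk) // pq // inE.
  by apply: contraL lk => /kmin; rewrite -leqNgt.
have ku : (p ^+ k)%g z = u.
  apply/eqP; apply: contraTT (mem_porbit p k z) => ne.
  have := Up _ _ kU uU ne; rewrite /cross_orbit; apply: contra.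
  by move: zu; rewrite -eq_porbit_mem => /eqP ->.
have zq : u \in porbit q z by rewrite -ku -it // mem_porbit.
(* The q-predecessor of z lies in U, as otherwise p v = q v = p u. It shares the q-orbit of u, so it
   is u. *)
set v := (q^-1)%g z; have qv : q v = z by rewrite permKV.
have vU : v \in U.
  apply: contraT => vU; have : p v = p u by rewrite pq ?inE // qv.
  by move=> /perm_inj vu; rewrite vu uU in vU.
suff -> : u = v by rewrite qv.
apply/eqP; apply: contraTT zq => ne; have := Uq _ _ uU vU ne; rewrite /cross_orbit.
by rewrite -qv -[q v]/((q ^+ 1)%g v) porbit_perm.
Qed.

(** At most j h <= n / 2 points lie in orbits already met, so each new point has at least n / 2
    choices. *)
Lemma card_transversals (R : realType) p h j : (forall c, (#|porbit p c| <= h)%N) -> (2 * (j * h) <= n)%N ->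
  (n%:R / 2) ^+ j <= #|pairwise_tuples (cross_orbit p) j|%:R :> R.
Proof.
move=> ph jh.
have H m : (m <= j)%N -> (n%:R / 2) ^+ m <= #|pairwise_tuples (cross_orbit p) m|%:R :> R.
  elim: m => [|m IH] mj.
    by rewrite ler1n; apply/card_gt0P; exists [tuple]; rewrite inE.
  rewrite exprS; apply: (@le_trans _ _ (n%:R / 2 * #|pairwise_tuples (cross_orbit p) m|%:R)).
    by rewrite ler_wpM2l ?divr_ge0 // IH // ltnW.
  apply: pairwise_tuples_grow => t _; rewrite ler_pdivrMr // -natrM ler_nat.
  have sub : ~: (\bigcup_(y in [set y in t]) porbit p y) \subset [set x | all (cross_orbit p x) t].
    apply/subsetP => x; rewrite !inE => hx; apply/allP => y yt; rewrite /cross_orbit.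
    by apply: contra hx => xy; apply/bigcupP; exists y; rewrite ?inE.
  have c : (#|\bigcup_(y in [set y in t]) porbit p y| <= m * h)%N.
    apply: leq_trans (_ : \sum_(y in [set y in t]) h <= _)%N.
      elim/big_ind2: _ => [|A a B b hA hB|y _]; rewrite ?cards0 //.
      by apply: leq_trans (leq_add hA hB); rewrite cardsU leq_subr.
    rewrite sum_nat_const leq_mul2r cardsE; apply/orP; right.
    by apply: leq_trans (card_size t) _; rewrite size_tuple.
  have := subset_leq_card sub; rewrite cardsCs setCK card_ord.
  have : (m * h <= j * h)%N by rewrite leq_mul2r ltnW ?orbT.
  by move: c jh; set a := #|_|; set b := #|_|; lia.
exact: H.
Qed.

Lemma uniq_transversal p j (u : j.-tuple 'I_n) : u \in pairwise_tuples (cross_orbit p) j -> uniq u.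
Proof.
rewrite inE uniq_pairwise; apply: sub_pairwise => x y; rewrite /cross_orbit /=.
by apply: contraNneq => ->; apply: porbit_id.
Qed.

Lemma transversal_neq p j (u : j.-tuple 'I_n) : u \in pairwise_tuples (cross_orbit p) j ->
  {in [set x in u] &, forall x y, x != y -> cross_orbit p x y}.
Proof.
rewrite inE => /(pairwise_neq (@cross_orbit_sym p)) h x y; rewrite !inE; exact: h.
Qed.

Lemma meanln_le_ln (R : realType) d : (0 < d)%N -> meanln R d <= ln d%:R.
Proof.
move=> d0; have d0' : 0 < d%:R :> R by rewrite ltr0n.
apply: le_trans (meanln_le R d0) _.
have h : ln (1 + (d%:R - 1)) <= d%:R - 1 :> R by apply: le_ln1Dx; lra.
rewrite addrC subrK in h.
have : (1 + ln d%:R) / d%:R <= 1 :> R by rewrite ler_pdivrMr //; lra.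
lra.
Qed.

(* A permutation with small orbits has many transversals of size j; composing
   it with the permutations of such a transversal gives j! permutations that are
   admissible outside the transversal, and the original can be recovered. *)
Lemma small_orbit_count (R : realType) (W : {set {perm 'I_n}}) (A : 'I_n -> {set 'I_n}) d h j :
  (forall p, p \in W -> forall c, p c \in A c) -> (forall c, #|A c| = d) ->
  (0 < d)%N -> (n <= 2 * d)%N ->
  (forall p, p \in W -> forall c, (#|porbit p c| <= h)%N) -> (2 * (j * h) <= n)%N ->
  (0 < j <= n)%N -> 2 * ln 2 + 3 <= ln j%:R :> R -> (0 < #|W|)%N ->
  ln #|W|%:R <= n%:R * meanln R d - j%:R.
Proof.
move=> WA Ad d0 nd Wh jh /andP[j0 jn] lnj W0.
pose D := [set t : {perm 'I_n} * j.-tuple 'I_n * {perm 'I_n} |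
  [&& t.1.1 \in W & t.1.2 \in pairwise_tuples (cross_orbit t.1.1) j] && perm_on [set x in t.1.2] t.2].
pose f (t : {perm 'I_n} * j.-tuple 'I_n * {perm 'I_n}) := (t.1.2, (t.2 * t.1.1)%g).
have f_out t c : t \in D -> c \notin t.1.2 -> (f t).2 c = t.1.1 c.
  rewrite inE => /andP[_ wu] cu; rewrite /f /= permM (out_perm wu) //.
  by rewrite inE.
have finj : {in D &, injective f}.
  move=> [[p u] w] [[p' u'] w'] tD tD' e.
  have ou c := f_out _ c tD; have ou' c := f_out _ c tD'.
  move: tD tD'; rewrite !inE /= => /andP[/andP[_ up] wu] /andP[/andP[_ up'] wu'].
  rewrite /f /= in e ou ou'; case: e => uu e; rewrite -uu in ou' up' *.
  have pp : p = p'.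
    apply: (@eq_perm_transversal p p' [set x in u]) => [||c].
    - by apply: transversal_neq; rewrite inE.
    - by apply: transversal_neq; rewrite inE.
    - by rewrite !inE => cu; rewrite -ou // -ou' // e.
  by move: e; rewrite pp => /mulIg ->.
have D_ge : #|W|%:R * (n%:R / 2) ^+ j * (j`!)%:R <= #|D|%:R :> R.
  rewrite -[in leRHS]sum1_card natr_sum.
  rewrite (eq_bigl (fun t : {perm 'I_n} * j.-tuple 'I_n * {perm 'I_n} =>
    (fun pu => [&& pu.1 \in W & pu.2 \in pairwise_tuples (cross_orbit pu.1) j]) t.1 &&
    (fun pu w => perm_on [set x in pu.2] w) t.1 t.2)); last by move=> t; rewrite inE.
  rewrite -(pair_big_dep (fun pu : {perm 'I_n} * j.-tuple 'I_n => [&& pu.1 \in W & pu.2 \in pairwise_tuples (cross_orbit pu.1) j])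
    (fun pu w => perm_on [set x in pu.2] w) (fun _ _ => 1)) /=.
  rewrite (eq_bigr (fun=> (j`!)%:R)) => [|pu /andP[_ pu2]]; last first.
    rewrite sumr_const -[_ *+ _]/(_%:R); congr _%:R.
    have := card_perm [set x in pu.2]; rewrite cardsE (card_uniqP (uniq_transversal pu2)) size_tuple => <-.
    by apply: eq_card.
  rewrite -(pair_big_dep (mem W) (fun p u => u \in pairwise_tuples (cross_orbit p) j) (fun _ _ => (j`!)%:R)) /=.
  rewrite -mulrA mulr_natl -sumr_const; apply: ler_sum => p pW.
  rewrite sumr_const -[leRHS]mulr_natl ler_wpM2r //.
  exact: card_transversals (Wh p pW) jh.
(* For a fixed tuple u the products are counted by [bregman], with the j cells of u left
   unrestricted. *)
have E_le u : #|[set q | (u, q) \in f @: D]|%:R <=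
    expR (n%:R * meanln R d + j%:R * (meanln R n - meanln R d)) :> R.
  set E := [set q | _]; have [->|[q0 q0E]] := set_0Vmem E; first by rewrite cards0 expR_ge0.
  have E0 : (0 < #|E|)%N by apply/card_gt0P; exists q0.
  rewrite -[leLHS]lnK ?posrE ?ltr0n // ler_expR.
  have uu : uniq u.
    move: q0E; rewrite inE => /imsetP[t]; rewrite inE => /andP[/andP[_ /uniq_transversal h0] _] [-> _].
    exact: h0.
  pose B c := if c \in u then setT else A c.
  apply: le_trans (@bregman R _ B n setT setT E _ _ _ _ E0) _; rewrite ?cardsT ?card_ord //.
  - move=> q; rewrite inE => /imsetP[t tD [ut qt]] c _; rewrite inE [_ \in setT]inE andbT /B.
    case: ifPn => cu; first by rewrite inE.
    rewrite qt -[(_ * _)%g]/((f t).2) f_out -?ut //.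
    by apply: WA; move: tD; rewrite inE => /andP[/andP[]].
  - by move=> p q _ _ hpq; apply/permP => c; apply: hpq; rewrite inE.
  under eq_bigr do rewrite setIT.
  rewrite (bigID (mem u)) /= (eq_bigr (fun=> meanln R n)); last first.
    by move=> c /andP[_ cu]; rewrite /B cu cardsT card_ord.
  rewrite [X in _ + X](eq_bigr (fun=> meanln R d)); last first.
    by move=> c /andP[_ /negbTE cu]; rewrite /B cu Ad.
  rewrite !sumr_const.
  have -> : #|[pred c in [set: 'I_n] | c \in u]| = j.
    rewrite -[RHS](size_tuple u) -(card_uniqP uu).
    by apply: eq_card => c; rewrite !inE.
  have -> : #|[pred c in [set: 'I_n] | c \notin u]| = (n - j)%N.
    have := cardC (mem u); rewrite (card_uniqP uu) size_tuple card_ord => nE.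
    by rewrite -[X in (X - j)%N]nE addKn; apply: eq_card => c; rewrite !inE.
  rewrite -(mulr_natl (meanln R n)) -(mulr_natl (meanln R d)) natrB //; lra.
have D_le : #|D|%:R <= n%:R ^+ j * expR (n%:R * meanln R d + j%:R * (meanln R n - meanln R d)) :> R.
  rewrite -(card_in_imset finj) -sum1_card natr_sum.
  rewrite (eq_bigl (fun t => xpredT t.1 && ((t.1, t.2) \in f @: D))); last by case.
  rewrite -(pair_big_dep xpredT (fun u q => (u, q) \in f @: D) (fun _ _ => 1)) /=.
  rewrite -natrX -[X in (X ^ j)%N](card_ord n) -card_tuple mulr_natl -sumr_const.
  apply: ler_sum => u _; apply: le_trans (E_le u); rewrite sumr_const.
  by rewrite ler_nat; apply/subset_leq_card/subsetP => q; rewrite inE.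
have n0 : (0 < n)%N by apply: leq_trans jn.
have n0' : 0 < n%:R :> R by rewrite ltr0n.
have W0' : 0 < #|W|%:R :> R by rewrite ltr0n.
have n2 : 0 < n%:R / 2 :> R by rewrite divr_gt0.
have f0 : 0 < (j`!)%:R :> R by rewrite ltr0n fact_gt0.
have := le_trans D_ge D_le.
rewrite -ler_ln ?posrE ?mulr_gt0 ?exprn_gt0 ?expR_gt0 //.
rewrite !lnM ?posrE ?mulr_gt0 ?exprn_gt0 ?expR_gt0 ?invr_gt0 // expRK.
rewrite !lnXn // ln_div ?posrE // -(mulr_natl (ln n%:R)) -(mulr_natl (ln n%:R - _)).
rewrite -meanlnE; have j0' : 0 < j%:R :> R by rewrite ltr0n.
have := meanln_ge R j0; have := meanln_ge R d0; have := meanln_le_ln R n0.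
have : ln n%:R <= ln 2 + ln d%:R :> R.
  rewrite -lnM ?posrE ?ltr0n // ler_ln ?posrE ?mulr_gt0 ?ltr0n // -natrM ler_nat //.
move: lnj; set Lj := ln j%:R; set Ln := ln n%:R; set Ld := ln d%:R; set L2 := ln 2.
set Fj := meanln R j; set Fd := meanln R d; set Fn := meanln R n; set LW := ln _.
set J := j%:R in j0' *.
move=> h1 h2 h3 h4 h5 h6.
(* Here Fn <= ln 2 + ln d, Fd >= ln d - 1 and Fj >= ln j - 1 >= 2 ln 2 + 2; the lower bound on ln j
   is chosen to make the sum at most -1. *)
have : J * (Fn - Fd - Fj + L2) <= J * (-1) by rewrite ler_pM2l //; lra.
lra.
Qed.

End SmallOrbits.

(** * Loops that are not generated by two elements *)

Section Loops.
Variables (n : nat).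
Implicit Types (T : 'M['I_n]_n) (H : {set 'I_n}).

Lemma orbit_count (R : realType) h j : (2 * (j * h) <= n)%N -> (0 < j <= n)%N ->
  2 * ln 2 + 3 <= ln j%:R :> R ->
  #|[set T : 'M['I_n]_n | latin_square T & [forall r, forall c, (#|porbit (row_perm_of T r) c| <= h)%N]]|%:R
    <= expR (logmain R n - j%:R * (n%:R / 2)) :> R.
Proof.
(* Rounding up gives at least n / 2 rows with a saving, while k < m still implies n <= 2 (n - k). *)
move=> jh jn lnj; pose m := uphalf n.
pose beta k : R := n%:R * meanln R (n - k) - (if (k < m)%N then j%:R else 0).
have mn : (m <= n)%N by rewrite /m; lia.
apply: (@le_trans _ _ (expR (\sum_(k < n) beta k))); last first.
  rewrite ler_expR /beta sumrB /logmain lerD2l lerN2 -big_mkcond /=.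
  rewrite (eq_bigl (fun k : 'I_n => k \in [set i : 'I_n | (i < m)%N])) => [|k]; last by rewrite inE.
  rewrite sumr_const card_lt_ord // -[leRHS]mulr_natl mulrC ler_wpM2r //.
  by rewrite ler_pdivrMr // -natrM ler_nat /m; lia.
apply: (latin_count (rho := 1%g)) => [T|k T0 W]; first by rewrite inE => /andP[].
rewrite inE => /andP[lat0 _] WP W0.
have kn : (k <= n)%N by apply: ltnW.
have kn' : (0 < n - k)%N by rewrite subn_gt0.
have cA c := card_avail 1%g c lat0 kn.
have WA p : p \in W -> forall c, p c \in avail 1%g k T0 c by move=> /WP[].
rewrite /beta; case: ifPn => [km|_]; last by rewrite subr0; apply: bregman_regular WA cA W0.
apply: (small_orbit_count WA cA _ _ _ jh jn lnj W0) => //.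
  by move: km; rewrite /m; lia.
move=> p /WP[[T + ->] _] c; rewrite inE => /andP[_ /forallP/(_ k)].
by rewrite perm1 => /forallP/(_ c).
Qed.

(* Normalizing row and column 0 turns a Latin square into a loop. *)
Lemma card_latin_loops : (0 < n)%N ->
  (#|[set T : 'M['I_n]_n | latin_square T]| <= #|@is_loop n| * (n`! * n`!))%N.
Proof.
case: n => // m _; pose i0 : 'I_m.+1 := ord0.
pose rowp (T : 'M['I_m.+1]_m.+1) := row_perm_of T i0.
pose T1 (T : 'M['I_m.+1]_m.+1) : 'M['I_m.+1]_m.+1 := \matrix_(x, y) ((rowp T)^-1)%g (T x y).
pose colp (T : 'M['I_m.+1]_m.+1) : {perm 'I_m.+1} :=
  odflt 1%g [pick q : {perm 'I_m.+1} | [forall x, q x == T1 T x i0]].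
pose T2 (T : 'M['I_m.+1]_m.+1) : 'M['I_m.+1]_m.+1 := \matrix_(x, y) T1 T ((colp T)^-1 x)%g y.
have colpE (T : 'M['I_m.+1]_m.+1) x : latin_square T -> colp T x = T1 T x i0.
  move=> /latinP[_ inj]; rewrite /colp.
  have inj1 : injective (fun x => T1 T x i0) by move=> a b /=; rewrite !mxE => /perm_inj/inj.
  case: pickP => [p /forallP/(_ x)/eqP //|/(_ (perm inj1))].
  by case/negP; apply/forallP => j; rewrite permE.
(* The two normalizing permutations are recorded along with the loop, so that T can be recovered. *)
pose f (T : 'M['I_m.+1]_m.+1) := (T2 T, (rowp T, colp T)).
have finj : {in [set T : 'M['I_m.+1]_m.+1 | latin_square T] &, injective f}.
  move=> T T'; rewrite !inE => lat lat' [e2 e1 e0]; apply/matrixP => x y.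
  have := congr1 (fun M : 'M_m.+1 => M (colp T x) y) e2; rewrite !mxE permK e0 permK e1.
  exact: perm_inj.
rewrite -(card_in_imset finj) -!card_Sn.
have -> : (#|@is_loop m.+1| * (#|{perm 'I_m.+1}| * #|{perm 'I_m.+1}|) =
   #|[set t : 'M['I_m.+1]_m.+1 * ({perm 'I_m.+1} * {perm 'I_m.+1}) | is_loop t.1]|)%N.
  rewrite -card_prod -(cardsE (@is_loop m.+1)) -[X in (_ * X)%N]cardsT -cardsX; apply: eq_card => t.
  by rewrite !inE andbT.
apply/subset_leq_card/subsetP => _ /imsetP[T + ->]; rewrite !inE => lat /=.
have [inj inj'] := latinP _ lat.
have r0 y : T1 T i0 y = y by rewrite mxE -(row_perm_ofE i0 y lat) permK.
apply/andP; split.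
  apply/latinP; split => [x y y'|y x x' /=]; rewrite !mxE => /perm_inj; first exact: inj.
  by move/inj'/perm_inj.
apply/existsP; exists i0; apply/forallP => y; rewrite mxE.
have c0 : ((colp T)^-1)%g i0 = i0 by apply: (canLR (permK (colp T))); rewrite colpE // r0.
by rewrite c0 r0 eqxx mxE -colpE // permKV eqxx.
Qed.

Definition not_two_generated T :=
  [forall y, forall z, [exists H : {set 'I_n}, [&& y \in H, z \in H, closed_in T H & H != setT]]].

(** The orbit of c under left translation by r stays inside every closed set containing r and c.
    Some such set is proper, so a bound h on all proper closed sets bounds all orbits. *)
Lemma not_two_generated_cover T h : latin_square T -> not_two_generated T ->
  [forall r, forall c, (#|porbit (row_perm_of T r) c| <= h)%N] \/
  exists H, [/\ (h < #|H|)%N, (#|H|.*2 <= n)%N & closed_in T H].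
Proof.
move=> lat hard.
have [/forallP ex|] := boolP [forall H : {set 'I_n}, [&& closed_in T H & H != setT] ==> (#|H| <= h)%N]; last first.
  rewrite negb_forall => /existsP[H]; rewrite negb_imply -ltnNge => /andP[/andP[cl nT] hH].
  by right; exists H; split => //; apply: closed_half lat cl nT.
left; apply/forallP => r; apply/forallP => c.
have /forallP/(_ r)/forallP/(_ c)/existsP[H /and4P[rH cH cl nT]] := hard.
apply: leq_trans (implyP (ex H) _); last by rewrite cl.
apply/subset_leq_card/subsetP => x /porbitP[i ->].
elim: i => [|i IH]; first by rewrite expg0 perm1.
by rewrite expgSr permM row_perm_ofE // closed_row.
Qed.

Definition hard_loops := [set T : 'M['I_n]_n | is_loop T & not_two_generated T].

Lemma card_hard_loops (R : realType) h j : (2 * (j * h) <= n)%N -> (0 < j <= n)%N ->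
  2 * ln 2 + 3 <= ln j%:R :> R ->
  #|hard_loops|%:R <= expR (logmain R n - j%:R * (n%:R / 2)) +
    2 ^+ n * expR (logmain R n - h%:R ^+ 2 * (ln 2 / 2)) :> R.
Proof.
move=> jh jn lnj; pose O := [set T : 'M['I_n]_n | latin_square T &
  [forall r, forall c, (#|porbit (row_perm_of T r) c| <= h)%N]].
pose big_H := [set H : {set 'I_n} | (h < #|H|)%N && (#|H|.*2 <= n)%N].
pose C := \bigcup_(H in big_H) [set T : 'M['I_n]_n | latin_square T & closed_in T H].
have sub : hard_loops \subset O :|: C.
  apply/subsetP => T; rewrite !inE => /andP[/andP[lat _] hard].
  have [->|[H [hH nH cl]]] := not_two_generated_cover h lat hard; first by rewrite lat.
  by apply/orP; right; apply/bigcupP; exists H; rewrite !inE ?hH ?nH ?lat.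
apply: (@le_trans _ _ (#|O|%:R + #|C|%:R)).
  rewrite -natrD ler_nat; apply: leq_trans (subset_leq_card sub) _.
  by rewrite cardsU leq_subr.
apply: lerD; first exact: orbit_count.
set E := expR _.
apply: (@le_trans _ _ (\sum_(H in big_H) E)); last first.
  rewrite sumr_const -[leLHS]mulr_natl ler_wpM2r ?expR_ge0 // -natrX ler_nat.
  apply: leq_trans (max_card _) _.
  by rewrite -cardsT -powersetT card_powerset cardsT card_ord.
apply: (@le_trans _ _ (\sum_(H in big_H) #|[set T : 'M['I_n]_n | latin_square T & closed_in T H]|%:R)).
  rewrite -natr_sum ler_nat /C.
  elim/big_ind2: _ => [|A a B b hA hB|y _]; rewrite ?cards0 //.
  by apply: leq_trans (leq_add hA hB); rewrite cardsU leq_subr.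
apply: ler_sum => H; rewrite inE => /andP[hH nH].
apply: le_trans (closed_count R _ nH) _; first exact: leq_ltn_trans hH.
rewrite ler_expR lerD2l lerN2 ler_wpM2r ?divr_ge0 ?ln_ge0 ?ler1n //.
by rewrite ler_pXn2r ?nnegrE // ler_nat ltnW.
Qed.

End Loops.

(** * The choice of j and h, and the density estimate *)

Section Numerics.
Variable (R : realType).

Lemma logmain_le n : (0 < n)%N ->
  logmain R n <= \sum_(k < n) n%:R * (ln (n - k)%:R - 1) + n%:R * (1 + ln n%:R) ^+ 2.
Proof.
move=> n0; have L0 : 0 <= ln n%:R :> R by rewrite ln_ge0 // ler1n.
rewrite /logmain -!mulr_sumr -mulrDr ler_wpM2l //.
apply: (@le_trans _ _ (\sum_(k < n) ((ln (n - k)%:R - 1) + (1 + ln n%:R) / (n - k)%:R))).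
  apply: ler_sum => k _; have d0 : (0 < n - k)%N by rewrite subn_gt0.
  apply: le_trans (meanln_le R d0) _; rewrite lerD2l ler_wpM2r ?invr_ge0 // lerD2l.
  by rewrite ler_ln ?posrE ?ltr0n // ler_nat leq_subr.
rewrite big_split /= lerD2l -mulr_sumr expr2 ler_wpM2l ?addr_ge0 //.
rewrite (reindex_inj rev_ord_inj) /=; apply: le_trans (harmonic_le R n0).
by apply: ler_sum => k _; rewrite subKn.
Qed.

Lemma loops_ge n : (0 < n)%N ->
  expR (\sum_(k < n) n%:R * (ln (n - k)%:R - 1)) <= #|@is_loop n|%:R * expR (2 * (n%:R * ln n%:R)) :> R.
Proof.
move=> n0; apply: (@le_trans _ _ #|[set T : 'M['I_n]_n | latin_square T]|%:R).
  apply: le_trans (card_latin_ge R n); rewrite expR_sum; apply: ler_prod => k _.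
  rewrite expR_ge0 /= mulrC expRM_natr expRB lnK ?posrE ?ltr0n ?subn_gt0 //.
apply: (@le_trans _ _ (#|@is_loop n| * (n`! * n`!))%:R).
  by rewrite ler_nat card_latin_loops.
rewrite natrM ler_wpM2l // mulr_natl mulr2n expRD natrM.
have f : (n`!)%:R <= expR (n%:R * ln n%:R) :> R.
  rewrite -[leLHS]lnK ?posrE ?ltr0n ?fact_gt0 // ler_expR -meanlnE ler_wpM2l //.
  exact: meanln_le_ln.
by apply: ler_pM.
Qed.

(** Twelfth powers make j about n^(1/3) and h about n^(2/3) / 2 without taking roots, and j = u ^ 4
    beats ln(n)^2 already by the crude estimate ln n <= 12 u. *)
Lemma hard_loops_large n u : (256 <= u)%N -> (u ^ 12 <= n)%N -> (n < u.+1 ^ 12)%N ->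
  (#|hard_loops n| * n ^ n <= 2 * #|@is_loop n|)%N.
Proof.
move=> u0 un nu; have u1 : (0 < u)%N by apply: leq_trans u0.
have n0 : (0 < n)%N by apply: leq_trans un; rewrite expn_gt0 u1.
pose j := (u ^ 4)%N; pose h := (n %/ (2 * j))%N.
have j0 : (0 < j)%N by rewrite expn_gt0 u1.
have j20 : (0 < 2 * j)%N by rewrite muln_gt0.
have jn : (j <= n)%N by apply: leq_trans un; rewrite leq_pexp2l.
have jh : (2 * (j * h) <= n)%N by rewrite mulnA mulnC leq_trunc_div.
have ln2 : 1 / 2 <= ln 2 :> R.
  by have := @ln_ge_1V R 2 (ltr0n _ 2); lra.
have ln2' : ln 2 <= 1 :> R.
  by have := @le_ln1Dx R 1; rewrite (lt_trans _ ltr01) ?ltrN10 // => /(_ isT).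
have n0' : 0 < n%:R :> R by rewrite ltr0n.
set U : R := u%:R; have U0 : 256 <= U by rewrite ler_nat.
set N : R := n%:R in n0' *.
have lnU : ln 2 * 8 <= ln U.
  rewrite mulr_natr -lnXn // ler_ln ?posrE ?exprn_gt0 ?(lt_le_trans _ U0) //.
  by apply: le_trans U0; rewrite -natrX ler_nat.
have lnj : 2 * ln 2 + 3 <= ln j%:R :> R.
  have -> : ln j%:R = 4 * ln U :> R by rewrite natrX lnXn ?ltr0n // mulr_natl.
  lra.
set L := ln N; have L0 : 0 <= L by rewrite ln_ge0 // ler1n.
have L12 : L <= 12 * U.
  apply: (@le_trans _ _ (ln (u.+1 ^ 12)%:R)).
    by rewrite ler_ln ?posrE ?ltr0n ?expn_gt0 // ler_nat ltnW.
  rewrite natrX lnXn ?ltr0Sn // -(mulr_natl (ln _) 12) ler_wpM2l // -natr1 addrC.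
  by apply: le_ln1Dx; rewrite -/U; lra.
have L13 : 18 * (1 + L) <= 234 * U by lra.
(* 320 = 16 * 20, where the 16 is lost in [a] below and the 20 is wanted in [Xh]. Since 1 + L <= 13
   U and 18^2 >= 320, it suffices that 18 * 13 = 234 <= U, hence the threshold 256. *)
have X : 320 * (1 + L) ^+ 2 <= U ^+ 4.
  apply: (@le_trans _ _ ((18 * (1 + L)) ^+ 2)).
    have -> : (18 * (1 + L)) ^+ 2 = 324 * (1 + L) ^+ 2 by ring.
    by rewrite ler_wpM2r ?sqr_ge0 // ler_nat.
  have -> : U ^+ 4 = (U * U) ^+ 2 by ring.
  rewrite ler_pXn2r ?nnegrE ?mulr_ge0 ?addr_ge0 //; apply: le_trans L13 _.
  by rewrite ler_wpM2r // (le_trans _ U0) // ler_nat.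
have Xj : 10 * (1 + L) ^+ 2 <= j%:R.
  by rewrite natrX; apply: le_trans X; rewrite ler_wpM2r ?sqr_ge0 // ler_nat.
clear L13 lnU L12.
have UN : U ^+ 12 <= N by rewrite -natrX ler_nat.
set Hh : R := h%:R; have nh : N <= 4 * U ^+ 4 * Hh.
  have h1 : (0 < h)%N.
    rewrite divn_gt0 //; apply: (leq_trans _ un).
    rewrite (expnD u 4 8) mulnC leq_mul2l eqn0Ngt j0 /=.
    by apply: leq_trans (leq_pexp2l u1 (isT : 1 <= 8)%N); rewrite expn1 (leq_trans _ u0).
  have : (n <= 2 * j * h.+1)%N by rewrite ltnW // mulnC -ltn_divLR.
  move=> /leq_trans/(_ (_ : 2 * j * h.+1 <= 4 * j * h)%N) => nh.
  rewrite -natrX -!natrM ler_nat; apply: nh.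
  have -> : (4 * j * h = 2 * j * (2 * h))%N by ring.
  by rewrite leq_mul2l [(2 * h)%N]mul2n -addnn -[h.+1]add1n leq_add2r h1 orbT.
have Xh : 20 * N * (1 + L) ^+ 2 <= Hh ^+ 2.
  have Hh0 : 0 <= Hh by [].
  have a : N ^+ 2 <= 16 * U ^+ 8 * Hh ^+ 2.
    have -> : 16 * U ^+ 8 * Hh ^+ 2 = (4 * U ^+ 4 * Hh) ^+ 2 by ring.
    by rewrite ler_pXn2r ?nnegrE ?(ltW n0') // (le_trans (ltW n0') nh).
  have U8 : 0 < U ^+ 8 by rewrite exprn_gt0 // (lt_le_trans _ U0).
  have b : N * U ^+ 4 <= 16 * Hh ^+ 2.
    rewrite -(ler_pM2r U8) -mulrA -exprD; apply: le_trans (_ : N * N <= _).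
      by rewrite ler_wpM2l // ltW.
    by rewrite -expr2 mulrAC.
  have := ler_wpM2l (ltW n0') X; clear - b; lra.
clear U0 UN nh X.
have main := card_hard_loops (R := R) jh (introT andP (conj j0 jn)) lnj.
rewrite -(ler_nat R) [leRHS]natrM (mulr_natl _ 2) mulr2n natrM natrX -/N.
have NN : N ^+ n = expR (N * L) by rewrite mulrC expRM_natr lnK.
rewrite NN; apply: le_trans (ler_wpM2r (expR_ge0 _) main) _.
have lg := logmain_le n0; have lo := loops_ge n0; rewrite -/N -/L in lg lo.
set low := \sum_(k < n) _ in lg lo.
have two : 2 ^+ n <= expR N by rewrite -[N]mulr1 expRM_natl lerXn2r ?nnegrE ?expR_ge0 // (le_trans _ (expR_ge1Dx 1)).
(* The required saving E pays N (1 + L)^2 for the gap between the two counts, 2 N L for (n!)^2 and N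
   L for n^n. *)
have fin E : N * (1 + L) ^+ 2 + 3 * (N * L) <= E ->
    expR (logmain R n - E) * expR (N * L) <= #|@is_loop n|%:R.
  move=> hE; rewrite -(ler_pM2r (expR_gt0 (2 * (N * L)))); apply: le_trans lo.
  by rewrite -!expRD ler_expR; lra.
have NL : N * L <= N * (1 + L) ^+ 2 by rewrite ler_wpM2l ?(ltW n0') //; nra.
have N1 : N <= N * (1 + L) ^+ 2 by rewrite -[leLHS]mulr1 ler_wpM2l ?(ltW n0') //; nra.
rewrite mulrDl; apply: lerD.
  apply: fin; have := ler_wpM2r (ltW n0') Xj; lra.
apply: le_trans (fin (h%:R ^+ 2 * (ln 2 / 2) - N) _); last first.
  rewrite -/Hh; have := ler_wpM2l (sqr_ge0 Hh) ln2; lra.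
apply: ler_wpM2r; first exact: expR_ge0.
have -> : logmain R n - (h%:R ^+ 2 * (ln 2 / 2) - N) = N + (logmain R n - h%:R ^+ 2 * (ln 2 / 2)) by ring.
by rewrite [leRHS]expRD; apply: ler_wpM2r; first exact: expR_ge0.
Qed.

End Numerics.

Theorem hard_loops_rare : exists K : nat, forall n, (0 < n)%N ->
  (#|hard_loops n| * n ^ n <= K * #|@is_loop n|)%N.
Proof.
have [u0 large] : exists u0, forall n u, (u0 <= u)%N -> (u ^ 12 <= n)%N -> (n < u.+1 ^ 12)%N ->
    (#|hard_loops n| * n ^ n <= 2 * #|@is_loop n|)%N.
  by exists 256 => n u; apply: (@hard_loops_large Rdefinitions.R).
(* The first summand bounds n ^ n when n <= u0 ^ 12; the 2 is the constant for large n. *)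
exists ((u0 ^ 12) ^ (u0 ^ 12) + 2)%N => n n0.
have ex : exists u, (u ^ 12 <= n)%N by exists 1%N; rewrite exp1n.
have bd u : (u ^ 12 <= n)%N -> (u <= n)%N.
  by case: u => // u; apply: leq_trans; rewrite -[leqLHS]expn1 leq_pexp2l.
case: (ex_maxnP ex bd) => u un umax.
have nu : (n < u.+1 ^ 12)%N by rewrite ltnNge; apply/negP => /umax; rewrite ltnn.
have [u0u|uu0] := leqP u0 u.
  by apply: leq_trans (large n u u0u un nu) _; rewrite leq_mul2r leq_addl orbT.
have nN : (n <= u0 ^ 12)%N by apply: leq_trans (ltnW nu) _; rewrite leq_exp2r.
rewrite mulnC; apply: leq_mul.
  apply: leq_trans (leq_addr _ _); apply: leq_trans (leq_pexp2l n0 nN) _.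
  by rewrite leq_exp2r // expn_gt0 (leq_ltn_trans _ uu0).
by apply/subset_leq_card/subsetP => T; rewrite inE => /andP[].
Qed.

(** * Reasoning about programs *)

Section Logic.
Local Open Scope nat_scope.

Fixpoint written_regs (P : prog) : seq nat :=
  match P with
  | Assign r _ => [:: r]
  | Seq P Q | If _ P Q => written_regs P ++ written_regs Q
  | While _ P => written_regs P
  | _ => [::]
  end.

Fixpoint written_arrs (P : prog) : seq nat :=
  match P with
  | Put a _ _ => [:: a]
  | Seq P Q | If _ P Q => written_arrs P ++ written_arrs Q
  | While _ P => written_arrs P
  | _ => [::]
  end.

Definition agree_off (rs xs : seq nat) (s s' : state) :=
  (forall r, r \notin rs -> reg s' r = reg s r) /\
  (forall a i, a \notin xs -> arr s' a i = arr s a i).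

Lemma agree_off_trans rs xs s1 s2 s3 :
  agree_off rs xs s1 s2 -> agree_off rs xs s2 s3 -> agree_off rs xs s1 s3.
Proof.
move=> [h1 h2] [h3 h4]; split=> [r hr|a i ha]; first by rewrite h3 ?h1.
by rewrite h4 ?h2.
Qed.

Lemma agree_off_sub rs xs rs' xs' s s' : {subset rs <= rs'} -> {subset xs <= xs'} ->
  agree_off rs xs s s' -> agree_off rs' xs' s s'.
Proof.
move=> h h' [h1 h2]; split=> [r hr|a i ha]; first by apply: h1; apply: contra hr => /h.
by apply: h2; apply: contra ha => /h'.
Qed.

Lemma exec_frame P s t s' : exec P s t s' -> agree_off (written_regs P) (written_arrs P) s s'.
Proof.
elim=> {P s t s'} //=.
- by move=> s r e; split=> // r'; rewrite inE /= => /negbTE ->.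
- by move=> s a i e; split=> // a' i'; rewrite inE /= => /negbTE ->.
- move=> s s1 s2 P Q t u _ h1 _ h2; apply: agree_off_trans.
    by apply: agree_off_sub h1 => x hx; rewrite mem_cat hx.
  by apply: agree_off_sub h2 => x hx; rewrite mem_cat hx orbT.
- by move=> s s1 e P Q t _ _; apply: agree_off_sub => x hx; rewrite mem_cat hx.
- by move=> s s1 e P Q t _ _; apply: agree_off_sub => x hx; rewrite mem_cat hx orbT.
- by move=> s s1 s2 e P t u _ _ h1 _ h2; apply: agree_off_trans h2.
Qed.

(** A Hoare triple for total correctness at one start state. The budget b is only an upper bound, so
    later budgets may be rounded up. *)
Definition runs (P : prog) (s : state) (b : nat) (Q : state -> Prop) :=
  exists t s', [/\ exec P s t s', t <= b & Q s'].

Lemma runs_weaken P s b b' (Q Q' : state -> Prop) :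
  b <= b' -> (forall s', Q s' -> Q' s') -> runs P s b Q -> runs P s b' Q'.
Proof. by move=> bb h [t [s' [e tb q]]]; exists t, s'; split; [|apply: leq_trans bb|apply: h]. Qed.

Lemma runs_frame P s b Q :
  runs P s b Q -> runs P s b (fun s' => Q s' /\ agree_off (written_regs P) (written_arrs P) s s').
Proof. by move=> [t [s' [e tb q]]]; exists t, s'; split=> //; split=> //; apply: exec_frame e. Qed.

Lemma runs_skip s b (Q : state -> Prop) : 0 < b -> Q s -> runs Skip s b Q.
Proof. by move=> b0 q; exists 1, s; split=> //; constructor. Qed.

Lemma runs_assign s r e b (Q : state -> Prop) : cost e < b ->
  Q (set_reg s r (eval s e)) -> runs (Assign r e) s b Q.
Proof. by move=> cb q; exists (cost e).+1, (set_reg s r (eval s e)); split=> //; constructor. Qed.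

Lemma runs_put s a i e b (Q : state -> Prop) : cost i + cost e < b ->
  Q (set_arr s a (eval s i) (eval s e)) -> runs (Put a i e) s b Q.
Proof.
by move=> cb q; exists (cost i + cost e).+1, (set_arr s a (eval s i) (eval s e)); split=> //; constructor.
Qed.

Lemma runs_seq P1 P2 s b1 b2 b Q : b1 + b2 <= b ->
  runs P1 s b1 (fun s' => runs P2 s' b2 Q) -> runs (Seq P1 P2) s b Q.
Proof.
move=> bb [t [s1 [e1 t1 [u [s2 [e2 u2 q]]]]]]; exists (t + u), s2; split=> //.
  exact: ExecSeq e1 e2.
by apply: leq_trans bb; apply: leq_add.
Qed.

Lemma runs_if e P1 P2 s b b' Q : cost e + b < b' ->
  (eval s e != 0 -> runs P1 s b Q) -> (eval s e = 0 -> runs P2 s b Q) -> runs (If e P1 P2) s b' Q.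
Proof.
move=> bb h1 h2; case: (eqVneq (eval s e) 0) => [z|nz].
  have [t [s' [ex tb q]]] := h2 z; exists (cost e + t).+1, s'; split=> //.
    exact: ExecIfFalse.
  by apply: leq_trans bb; rewrite ltnS leq_add2l.
have [t [s' [ex tb q]]] := h1 nz; exists (cost e + t).+1, s'; split=> //.
  exact: ExecIfTrue.
by apply: leq_trans bb; rewrite ltnS leq_add2l.
Qed.

(** The index of Inv is the number of rounds still to come: it yields termination and the time bound
    at once. *)
Lemma runs_while e P s b m (Inv : nat -> state -> Prop) : Inv m s ->
  (forall k s', Inv k s' -> (eval s' e == 0) = (k == 0)) ->
  (forall k s', Inv k.+1 s' -> runs P s' b (Inv k)) ->
  runs (While e P) s (m * (b + (cost e).+1) + (cost e).+1) (Inv 0).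
Proof.
move=> + he hs; elim: m s => [|m IH] s inv.
  exists (cost e).+1, s; split=> //.
  by constructor; apply/eqP; rewrite (he 0 s inv).
have [t [s1 [e1 t1 inv1]]] := hs _ _ inv; have [u [s2 [e2 u2 q]]] := IH _ inv1.
exists (cost e + t + u).+1, s2; split=> //; last by lia.
by apply: ExecWhileTrue e1 e2; rewrite (he _ _ inv).
Qed.

Definition For (i r : nat) (P : prog) : prog :=
  Seq (Assign i (Const 0))
    (While (Defs.Sub (Reg r) (Reg i)) (Seq P (Assign i (Add (Reg i) (Const 1))))).

(** Here Inv counts completed rounds and is checked after the increment. Each round pays 4 for the
    guard and 4 for the increment; the final 6 are the initialization (2) and the last test (4). *)
Lemma runs_for s i r P b (Inv : nat -> state -> Prop) :
  i \notin written_regs P -> r \notin i :: written_regs P ->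
  Inv 0 (set_reg s i 0) ->
  (forall k s', k < reg s r -> agree_off (i :: written_regs P) (written_arrs P) s s' ->
     reg s' i = k -> Inv k s' -> runs P s' b (fun s'' => Inv k.+1 (set_reg s'' i k.+1))) ->
  runs (For i r P) s (reg s r * (b + 8) + 6)
    (fun s' => Inv (reg s r) s' /\ agree_off (i :: written_regs P) (written_arrs P) s s').
Proof.
move=> iP rP inv0 step; set N := reg s r.
pose J m s' := [/\ m <= N, reg s' i = N - m, Inv (N - m) s' &
  agree_off (i :: written_regs P) (written_arrs P) s s'].
have fr0 v s1 : agree_off (i :: written_regs P) (written_arrs P) s1 (set_reg s1 i v).
  by split=> // r' /=; rewrite inE negb_or => /andP[/negbTE ->].
apply: (@runs_seq _ _ _ 2 (N * ((b + 4) + 4) + 4)); first lia.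
apply: runs_assign => //=.
apply: (@runs_weaken _ _ (N * (b + 4 + 4) + 4) _ (J 0)) => //.
  by move=> s' [_ _]; rewrite subn0.
apply: (@runs_while _ _ _ (b + 4) N J).
- by split; rewrite ?subnn //= eqxx.
- move=> k s' [kN ri _ [fr _]] /=; rewrite ri fr // -/N; apply/eqP/eqP; lia.
move=> k s' [kN ri inv fr]; have kN' : N - k.+1 < N by lia.
apply: (@runs_seq _ _ _ b 4) => //.
apply: runs_weaken (leqnn _) _ (runs_frame (step _ _ kN' fr ri inv)) => s1 [inv1 fr1].
apply: runs_assign => //=.
have ri1 : reg s1 i = N - k.+1 by rewrite fr1.1.
have -> : reg s1 i + 1 = (N - k.+1).+1 by rewrite ri1 addn1.
have Nk : N - k = (N - k.+1).+1 by lia.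
split; rewrite ?Nk //=; first lia; first by rewrite eqxx.
apply: agree_off_trans fr _; apply: agree_off_trans (fr0 _ s1).
by apply: agree_off_sub fr1 => x hx //; rewrite inE hx orbT.
Qed.

End Logic.

(** * Labellings from generating tuples *)

Section Closure.
Local Open Scope nat_scope.
Implicit Types (l : seq nat) (n k m i j x y : nat) (d : nat -> nat).

Definition add_new x l := if x \in l then l else rcons l x.

(** The list grows during a pass while i and j always run up to n, so positions not yet filled are
    skipped. *)
Definition visit (op : nat -> nat -> nat) i l j :=
  if (i < size l) && (j < size l) then add_new (op (nth 0 l i) (nth 0 l j)) l else l.

Definition row_pass op i l m := foldl (visit op i) l (iota 0 m).

Definition pass op n l m := foldl (fun l i => row_pass op i l n) l (iota 0 m).

Definition rounds op n l m := iter m (fun l => pass op n l n) l.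

Definition generators d k := foldl (fun l x => add_new x l) [::] (mkseq d k).

Definition closure op n k d := rounds op n (generators d k) n.

Definition proper_list n l := uniq l && all (fun x => x < n) l.

Lemma prefix_eq_size l l' : prefix l l' -> size l = size l' -> l = l'.
Proof.
move=> /prefixP[s ->]; rewrite size_cat => h.
have /size0nil -> : size s = 0 by move: h; rewrite -[LHS]addn0 => /addnI.
by rewrite cats0.
Qed.

Lemma prefix_anti l l' : prefix l l' -> prefix l' l -> l = l'.
Proof.
by move=> pl /size_prefix pl'; apply: prefix_eq_size => //; apply/eqP; rewrite eqn_leq size_prefix.
Qed.

Section Fold.
Variables (T : Type) (f : seq nat -> T -> seq nat).

Lemma foldl_ind (P : seq nat -> Prop) l (s : seq T) :
  (forall l t, P l -> P (f l t)) -> P l -> P (foldl f l s).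
Proof. by move=> h; elim: s l => //= x s IH l /(h _ x)/IH. Qed.

Hypothesis f_prefix : forall l t, prefix l (f l t).

Lemma prefix_foldl l (s : seq T) : prefix l (foldl f l s).
Proof. by elim: s l => [|x s IH] l /=; [exact: prefix_refl | exact: prefix_trans (IH _)]. Qed.

(** Every step extends the list, so a fold that returns l cannot have changed it at any step. *)
Lemma foldl_fixed l (s : seq T) : foldl f l s = l -> forall i (t0 : T), i < size s -> f l (nth t0 s i) = l.
Proof.
elim: s => //= x s IH e.
have fx : f l x = l.
  by apply/esym/prefix_anti => //; rewrite -[X in prefix _ X]e prefix_foldl.
by move=> [|i] t0 //=; rewrite ltnS; apply: IH; rewrite -{2}e fx.
Qed.

End Fold.

Lemma prefix_add x l : prefix l (add_new x l).
Proof. by rewrite /add_new; case: ifP => _; rewrite ?prefix_refl ?prefix_rcons. Qed.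

Lemma mem_add x l : x \in add_new x l.
Proof. by rewrite /add_new; case: ifP => // _; rewrite mem_rcons mem_head. Qed.

Lemma prefix_visit op i l j : prefix l (visit op i l j).
Proof. by rewrite /visit; case: ifP => _; rewrite ?prefix_refl ?prefix_add. Qed.

Lemma prefix_row_pass op i l m : prefix l (row_pass op i l m).
Proof. by apply: prefix_foldl => l' j; apply: prefix_visit. Qed.

Lemma prefix_pass op n l m : prefix l (pass op n l m).
Proof. by apply: prefix_foldl => l' j; apply: prefix_row_pass. Qed.

Lemma prefix_rounds op n l m : prefix l (rounds op n l m).
Proof. by elim: m => [|m IH]; [exact: prefix_refl | exact: prefix_trans IH (prefix_pass _ _ _ _)]. Qed.

Lemma mem_prefix l l' x : prefix l l' -> x \in l -> x \in l'.
Proof. by move=> /prefixP[s ->]; rewrite mem_cat => ->. Qed.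

Section Proper.
Variables (op : nat -> nat -> nat) (n : nat).
Hypothesis op_lt : forall x y, x < n -> y < n -> op x y < n.

Lemma proper_nth l i : proper_list n l -> i < size l -> nth 0 l i < n.
Proof. by move=> /andP[_ /allP h] il; apply: h; apply: mem_nth. Qed.

Lemma proper_add x l : x < n -> proper_list n l -> proper_list n (add_new x l).
Proof.
move=> xn /andP[u a]; rewrite /add_new; case: ifPn => [_|xl]; apply/andP; split => //.
  by rewrite rcons_uniq xl.
by rewrite all_rcons xn.
Qed.

Lemma proper_visit i l j : proper_list n l -> proper_list n (visit op i l j).
Proof.
move=> pl; rewrite /visit; case: ifP => // /andP[il jl]; apply: proper_add => //.
by apply: op_lt; apply: proper_nth.
Qed.

Lemma proper_row_pass i l m : proper_list n l -> proper_list n (row_pass op i l m).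
Proof. by move=> pl; apply: (@foldl_ind _ _ (proper_list n)) => // l' j; apply: proper_visit. Qed.

Lemma proper_pass l m : proper_list n l -> proper_list n (pass op n l m).
Proof. by move=> pl; apply: (@foldl_ind _ _ (proper_list n)) => // l' j; apply: proper_row_pass. Qed.

Lemma proper_rounds l m : proper_list n l -> proper_list n (rounds op n l m).
Proof. by move=> pl; elim: m => //= m IH; apply: proper_pass. Qed.

Lemma size_proper l : proper_list n l -> size l <= n.
Proof.
move=> /andP[u /allP a]; rewrite -[leqRHS](size_iota 0); apply: (uniq_leq_size u) => x /a.
by rewrite mem_iota.
Qed.

Lemma generatorsS d k : generators d k.+1 = add_new (d k) (generators d k).
Proof. by rewrite /generators mkseqS foldl_rcons. Qed.

Lemma mem_generators d k p : p < k -> d p \in generators d k.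
Proof.
elim: k => // k IH; rewrite ltnS generatorsS leq_eqVlt => /orP[/eqP ->|/IH h].
  exact: mem_add.
exact: mem_prefix (prefix_add _ _) h.
Qed.

Lemma proper_generators d k : (forall p, p < k -> d p < n) -> proper_list n (generators d k).
Proof.
elim: k => // k IH h; rewrite generatorsS; apply: proper_add; first exact: h.
by apply: IH => p pk; apply: h; apply: ltnW.
Qed.

Lemma proper_closure d k : (forall p, p < k -> d p < n) -> proper_list n (closure op n k d).
Proof. by move=> h; apply: proper_rounds; apply: proper_generators. Qed.

Lemma mem_closure d k p : p < k -> d p \in closure op n k d.
Proof. by move=> pk; apply: mem_prefix (prefix_rounds _ _ _ _) (mem_generators _ pk). Qed.

Lemma pass_fixed_closed l : size l <= n -> pass op n l n = l ->
  forall x y, x \in l -> y \in l -> op x y \in l.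
Proof.
move=> ln e x y xl yl.
have xi : index x l < n by rewrite (leq_trans _ ln) // index_mem.
have yi : index y l < n by rewrite (leq_trans _ ln) // index_mem.
have ex := foldl_fixed (fun l' i => prefix_row_pass op i l' n) e (i := index x l) 0.
rewrite size_iota nth_iota // add0n in ex.
have := foldl_fixed (fun l' i => prefix_visit op _ l' i) (ex xi) (i := index y l) 0.
rewrite size_iota nth_iota // add0n => /(_ yi); rewrite /visit !index_mem xl yl /= !nth_index //.
by move=> <-; apply: mem_add.
Qed.

(** Until a fixed point is reached each round adds an element, and a proper list has at most n of
    them. *)
Lemma rounds_fixed l : proper_list n l -> 0 < size l ->
  pass op n (rounds op n l n) n = rounds op n l n.
Proof.
move=> pl l0.
suff H m : pass op n (rounds op n l m) n = rounds op n l m \/ m < size (rounds op n l m).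
  by case: (H n) => // lt; have := leq_trans lt (size_proper (proper_rounds n pl)); rewrite ltnn.
elim: m => [|m [IH|IH]]; first by right.
  by left; rewrite /= IH.
have pf := prefix_pass op n (rounds op n l m) n.
have /= [e|ne] := eqVneq (pass op n (rounds op n l m) n) (rounds op n l m).
  by left; rewrite /= e.
right => /=; apply: leq_trans (_ : (size (rounds op n l m)).+1 <= _) => //.
rewrite ltn_neqAle size_prefix // andbT; apply: contra ne => /eqP sz.
by rewrite eq_sym; apply/eqP/(prefix_eq_size pf).
Qed.

Lemma closure_closed d k : (forall p, p < k -> d p < n) -> 0 < k ->
  forall x y, x \in closure op n k d -> y \in closure op n k d -> op x y \in closure op n k d.
Proof.
move=> dn k0; have pg := proper_generators dn.
apply: pass_fixed_closed; first exact: size_proper (proper_rounds n pg).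
apply: rounds_fixed => //; have := mem_generators d k0.
by case: (generators d k).
Qed.

Lemma closure_all d : (forall p, p < n -> d p = p) -> size (closure op n n d) = n.
Proof.
move=> dE; have dn p : p < n -> d p < n by move=> pn; rewrite dE.
apply/eqP; rewrite eqn_leq size_proper ?proper_closure //=.
rewrite -[leqLHS](size_iota 0 n); apply: (uniq_leq_size (iota_uniq _ _)) => p.
by rewrite mem_iota /= add0n => pn; rewrite -(dE p) // mem_closure.
Qed.

End Proper.

(** The entry number idx, in row-major order, of the table relabelled by positions in l; the
    successor matches array 5, which stores positions plus 1. *)
Definition table_key (op : nat -> nat -> nat) n l (idx : nat) :=
  (index (op (nth 0 l (idx %/ n)) (nth 0 l (idx %% n))) l).+1.

(** * Isomorphisms commute with the construction of lists and tables *)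

Section Equivariance.
Variables (op op' : nat -> nat -> nat) (n : nat) (f : nat -> nat).
Hypothesis op_lt : forall x y, x < n -> y < n -> op x y < n.
Hypothesis f_inj : {in [pred x | x < n] &, injective f}.
Hypothesis f_op : forall x y, x < n -> y < n -> op' (f x) (f y) = f (op x y).

Lemma mem_map_lt x l : x < n -> all (fun y => y < n) l -> (f x \in map f l) = (x \in l).
Proof.
move=> xn /allP a; apply/mapP/idP => [[y yl e]|xl]; last by exists x.
by rewrite (f_inj _ _ e) // inE; apply: a.
Qed.

Lemma index_map_lt x l : x < n -> all (fun y => y < n) l -> index (f x) (map f l) = index x l.
Proof.
move=> xn; elim: l => //= y l IH /andP[yn a]; rewrite IH //.
by rewrite (inj_in_eq f_inj).
Qed.

Lemma map_add x l : x < n -> all (fun y => y < n) l -> add_new (f x) (map f l) = map f (add_new x l).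
Proof. by move=> xn a; rewrite /add_new mem_map_lt //; case: ifP => // _; rewrite map_rcons. Qed.

Lemma map_visit i l j : proper_list n l -> visit op' i (map f l) j = map f (visit op i l j).
Proof.
move=> pl; rewrite /visit size_map; case: ifP => // /andP[il jl].
rewrite !(nth_map 0) // f_op ?(proper_nth pl) // map_add //; last by case/andP: pl.
by apply: op_lt; apply: (proper_nth pl).
Qed.

Lemma map_foldl (T : Type) (g g' : seq nat -> T -> seq nat) l (s : seq T) :
  (forall l t, proper_list n l -> proper_list n (g l t)) ->
  (forall l t, proper_list n l -> g' (map f l) t = map f (g l t)) ->
  proper_list n l -> foldl g' (map f l) s = map f (foldl g l s).
Proof. by move=> h1 h2; elim: s l => //= x s IH l pl; rewrite h2 // IH // h1. Qed.

Lemma map_row_pass i l m : proper_list n l -> row_pass op' i (map f l) m = map f (row_pass op i l m).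
Proof.
by apply: map_foldl => l' j; [apply: (@proper_visit op n op_lt) | apply: map_visit].
Qed.

Lemma map_pass l m : proper_list n l -> pass op' n (map f l) m = map f (pass op n l m).
Proof.
by apply: map_foldl => l' j; [apply: (@proper_row_pass op n op_lt) | apply: map_row_pass].
Qed.

Lemma map_rounds l m : proper_list n l -> rounds op' n (map f l) m = map f (rounds op n l m).
Proof.
move=> pl; elim: m => //= m ->; apply: map_pass; exact: (@proper_rounds op n op_lt).
Qed.

Lemma map_generators d d' k : (forall p, p < k -> d p < n) -> (forall p, p < k -> d' p = f (d p)) ->
  generators d' k = map f (generators d k).
Proof.
elim: k => // k IH h h'; rewrite !generatorsS IH => [|p pk|p pk]; last 2 first.
- by apply: h; apply: ltnW.
- by apply: h'; apply: ltnW.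
rewrite h' // map_add ?h //.
have /andP[] : proper_list n (generators d k); last by [].
by apply: proper_generators => p pk; apply: h; apply: ltnW.
Qed.

Lemma map_closure d d' k : (forall p, p < k -> d p < n) -> (forall p, p < k -> d' p = f (d p)) ->
  closure op' n k d' = map f (closure op n k d).
Proof.
move=> h h'; rewrite /closure (map_generators h h') map_rounds //.
exact: proper_generators.
Qed.

Lemma table_key_map l idx : proper_list n l -> size l = n -> idx < n * n ->
  table_key op' n (map f l) idx = table_key op n l idx.
Proof.
move=> pl sl idxn; have n0 : 0 < n by case: (n) idxn.
have i1 : idx %/ n < size l by rewrite sl ltn_divLR.
have i2 : idx %% n < size l by rewrite sl ltn_mod.
rewrite /table_key !(nth_map 0) // f_op ?(proper_nth pl) // index_map_lt //.
  by apply: op_lt; apply: (proper_nth pl).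
by case/andP: pl.
Qed.

End Equivariance.

(** * Numbering of tuples, and the lexicographic order *)

Definition digit n p v := (v %/ n ^ p) %% n.

Lemma digit_surj n k d : (forall p, p < k -> d p < n) ->
  exists2 v, v < n ^ k & forall p, p < k -> digit n p v = d p.
Proof.
elim: k d => [|k IH] d h; first by exists 0.
have [v vn vd] := IH (fun p => d p.+1) (fun p => h p.+1).
have n0 : 0 < n by apply: leq_ltn_trans (h 0 _).
have d0 := h 0 isT.
exists (v * n + d 0); first by rewrite expnSr -ltn_divLR // divnMDl // divn_small // addn0.
move=> [|p] pk; rewrite /digit; first by rewrite expn0 divn1 modnMDl modn_small.
by rewrite expnS divnMA divnMDl // (divn_small d0) addn0 -/(digit n p v) vd.
Qed.

Definition lex_lt m (f g : nat -> nat) :=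
  exists p, [/\ p < m, (forall q, q < p -> f q = g q) & f p < g p].

Lemma lex_lt_trans m (f g h : nat -> nat) : lex_lt m f g -> lex_lt m g h -> lex_lt m f h.
Proof.
move=> [p [pm ep lp]] [q [qm eq lq]]; have [pq|qp|pq] := ltngtP p q.
- exists p; split=> // [r rp|]; last by rewrite -eq.
  by rewrite ep // eq // (ltn_trans rp).
- exists q; split=> // [r rq|]; last by rewrite ep.
  by rewrite ep ?eq // (ltn_trans rq).
- exists p; split=> // [r rp|]; first by rewrite ep // eq // -pq.
  by rewrite (ltn_trans lp) // pq.
Qed.

Lemma lex_total m (f g : nat -> nat) :
  [\/ forall q, q < m -> f q = g q, lex_lt m f g | lex_lt m g f].
Proof.
elim: m => [|m [IH|[p [pm e l]]|[p [pm e l]]]]; first by constructor 1.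
- have [lt|lt|e] := ltngtP (f m) (g m).
  + by constructor 2; exists m.
  + by constructor 3; exists m; split=> // q qm; rewrite IH.
  + constructor 1 => q; rewrite ltnS leq_eqVlt => /orP[/eqP ->|] //; exact: IH.
- by constructor 2; exists p; split=> //; apply: ltnW.
- by constructor 3; exists p; split=> //; apply: ltnW.
Qed.

End Closure.

(** * The program *)

(* Registers: 0 order n, 1 tuple length k, 2 whether a labelling was found,
   3 length of the list, 4 to 6 and 9 loop counters, 7 element to be listed,
   8 outcome of the comparison (1: the new table is less), 10 n * n, 11 carry,
   12 whether tuples remain.
   Arrays: 0 input table, 1 output, 2 multiples of n, 3 current tuple, 4 the list,
   5 position in the list plus 1 (0 if absent), 6 new table, 7 best table. *)

Section Program.
Local Open Scope nat_scope.

(** Register 3 is incremented before it is stored in array 5, so that 0 keeps the meaning of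
    absence. *)
Definition p_add : prog :=
  If (Get 5 (Reg 7)) Skip
    (Seq (Put 4 (Reg 3) (Reg 7))
      (Seq (Assign 3 (Add (Reg 3) (Const 1))) (Put 5 (Reg 7) (Reg 3)))).

Definition p_clear : prog :=
  Seq (Assign 3 (Const 0)) (For 4 0 (Put 5 (Reg 4) (Const 0))).

Definition p_load : prog := For 4 1 (Seq (Assign 7 (Get 3 (Reg 4))) p_add).

(** The row offset is read from the multiples of n in array 2, in place of a multiplication. *)
Definition e_product : expr := Get 0 (Add (Get 2 (Get 4 (Reg 4))) (Get 4 (Reg 5))).

Definition p_visit : prog :=
  If (Defs.Sub (Reg 3) (Reg 4))
    (If (Defs.Sub (Reg 3) (Reg 5)) (Seq (Assign 7 e_product) p_add) Skip) Skip.

Definition p_rounds : prog := For 6 0 (For 4 0 (For 5 0 p_visit)).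

Definition p_table : prog :=
  For 4 0 (For 5 0 (Put 6 (Add (Get 2 (Reg 4)) (Reg 5)) (Get 5 e_product))).

(** As long as nothing is recorded, the outcome is preset to 1 and the new table wins. Otherwise the
    first difference decides, and later cells are skipped. *)
Definition p_compare : prog :=
  Seq (Assign 8 (Defs.Sub (Const 1) (Reg 2)))
    (For 9 10 (If (Reg 8) Skip
      (If (Defs.Sub (Get 7 (Reg 9)) (Get 6 (Reg 9))) (Assign 8 (Const 1))
        (If (Defs.Sub (Get 6 (Reg 9)) (Get 7 (Reg 9))) (Assign 8 (Const 2)) Skip)))).

Definition p_copy : prog :=
  Seq (Assign 2 (Const 1))
    (Seq (For 9 10 (Put 7 (Reg 9) (Get 6 (Reg 9))))
      (For 4 0 (Put 1 (Reg 4) (Defs.Sub (Get 5 (Reg 4)) (Const 1))))).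

Definition p_record : prog :=
  Seq p_table (Seq p_compare
    (If (Reg 8) (If (Defs.Sub (Const 2) (Reg 8)) p_copy Skip) Skip)).

Definition p_process : prog :=
  Seq p_clear (Seq p_load (Seq p_rounds (If (Defs.Sub (Reg 0) (Reg 3)) Skip p_record))).

(** Addition of 1 in base n, lowest digit first. A carry out of the last digit clears register 12
    and ends the enumeration. *)
Definition p_increment : prog :=
  Seq (Assign 11 (Const 1))
    (Seq (For 4 1 (If (Reg 11)
        (Seq (Put 3 (Reg 4) (Add (Get 3 (Reg 4)) (Const 1)))
          (If (Defs.Sub (Reg 0) (Get 3 (Reg 4))) (Assign 11 (Const 0)) (Put 3 (Reg 4) (Const 0))))
        Skip))
      (Assign 12 (Defs.Sub (Const 1) (Reg 11)))).

Definition p_enumerate : prog :=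
  Seq (For 4 1 (Put 3 (Reg 4) (Const 0)))
    (Seq (Assign 12 (Const 1)) (While (Reg 12) (Seq p_process p_increment))).

(** The multiples of n are obtained by repeated addition; cell n of array 2 is filled as well, and n
    * n is read from it. *)
Definition p_main : prog :=
  Seq (For 4 0 (Put 2 (Add (Reg 4) (Const 1)) (Add (Get 2 (Reg 4)) (Reg 0))))
    (Seq (Assign 10 (Get 2 (Reg 0)))
      (Seq (Assign 1 (Const 2))
        (Seq p_enumerate
          (If (Reg 2) Skip (Seq (Assign 1 (Reg 0)) p_enumerate))))).

(** * Correctness and running time of the program *)

Section Specs.
Variables (n : nat) (op : nat -> nat -> nat).
Hypothesis op_lt : forall x y, x < n -> y < n -> op x y < n.
Implicit Types (s : state) (l : seq nat).

(** The data that stay fixed throughout [p_enumerate]; [env_agree] carries them along by looking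
    only at what a subprogram writes. *)
Definition env s := [/\ reg s 0 = n, reg s 10 = n * n, forall x, x < n -> arr s 2 x = x * n &
  forall x y, x < n -> y < n -> arr s 0 (x * n + y) = op x y].

Lemma env_agree rs xs s s' : env s -> agree_off rs xs s s' -> (0 \notin rs) && (10 \notin rs) ->
  (0 \notin xs) && (2 \notin xs) -> env s'.
Proof.
move=> [e1 e2 e3 e4] [f1 f2] /andP[r0 r10] /andP[x0 x2].
split; rewrite ?f1 //; first by move=> x xn; rewrite f2 // e3.
by move=> x y xn yn; rewrite f2 // e4.
Qed.

Definition holds s l := [/\ reg s 3 = size l, forall i, i < size l -> arr s 4 i = nth 0 l i &
  forall x, x < n -> arr s 5 x = if x \in l then (index x l).+1 else 0].

Lemma holds_agree rs xs s s' l : holds s l -> agree_off rs xs s s' -> 3 \notin rs ->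
  (4 \notin xs) && (5 \notin xs) -> holds s' l.
Proof.
move=> [h1 h2 h3] [f1 f2] r3 /andP[x4 x5]; split; rewrite ?f1 //.
  by move=> i il; rewrite f2 // h2.
by move=> x xn; rewrite f2 // h3.
Qed.

Lemma run_add s l x : proper_list n l -> x < n -> reg s 7 = x -> holds s l ->
  runs p_add s 20 (fun s' => holds s' (add_new x l)).
Proof.
move=> pl xn s7 [h1 h2 h3]; rewrite /add_new; apply: (@runs_if _ _ _ _ 14) => //=.
  rewrite s7 h3 //; case: ifP => // xl _; exact: runs_skip.
rewrite s7 h3 //; case: ifPn => // xl _.
apply: (@runs_seq _ _ _ 3 10) => //; apply: runs_put => //=.
apply: (@runs_seq _ _ _ 4 5) => //; apply: runs_assign => //=; apply: runs_put => //=.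
rewrite s7 h1; split=> /=; first by rewrite size_rcons addn1.
  move=> i; rewrite size_rcons ltnS nth_rcons; case: ltngtP => // il _.
  by rewrite h2.
move=> y yn; rewrite mem_rcons inE -cats1 index_cat.
have [->|yx] := eqVneq y x; first by rewrite (negbTE xl) /= eqxx addn0 addn1.
rewrite h3 //=; case: ifP => //.
Qed.

Lemma run_clear s : reg s 0 = n ->
  runs p_clear s (n * 12 + 10) (fun s' => holds s' [::]).
Proof.
move=> s0; apply: (@runs_seq _ _ _ 2 (n * 12 + 6)); first lia.
apply: runs_assign => //=.
pose Inv (i : nat) (s' : state) := forall x, x < i -> arr s' 5 x = 0.
set s1 := set_reg _ _ _; have s10 : reg s1 0 = n by [].
rewrite -s10; apply: runs_weaken (leqnn _) _ (@runs_for s1 4 0 (Put 5 (Reg 4) (Const 0)) 4 Inv _ _ _ _) => //.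
- move=> s' [inv [f1 f2]]; split=> //; first by rewrite f1.
  by move=> x xn /=; apply: inv; rewrite s10.
move=> i s' iN fr s4 inv; apply: runs_put => //= x; rewrite ltnS /= s4.
by case: eqP => //= ne xi; apply: inv; rewrite ltn_neqAle xi andbT; apply/eqP.
Qed.

Lemma run_load s k d : reg s 1 = k -> (forall p, p < k -> arr s 3 p = d p) ->
  (forall p, p < k -> d p < n) -> holds s [::] ->
  runs p_load s (k * 32 + 6) (fun s' => holds s' (generators d k)).
Proof.
move=> s1 sd dn h; pose Inv (i : nat) (s' : state) := holds s' (generators d i).
rewrite -s1; apply: runs_weaken (leqnn _) _ (@runs_for s 4 1 _ 24 Inv _ _ _ _) => //.
  by move=> s' [inv _]; rewrite s1 in inv *.
move=> i s' iN fr s4 inv; rewrite s1 in iN.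
apply: (@runs_seq _ _ _ 4 20) => //; apply: runs_assign => //=.
have si : arr s' 3 (reg s' 4) = d i by rewrite s4 fr.2 // sd.
have pg : proper_list n (generators d i).
  by apply: proper_generators => p pi; apply: dn; apply: ltn_trans iN.
apply: runs_weaken (leqnn _) _ (@run_add _ (generators d i) (d i) pg _ _ _) => //.
- by move=> s'' hs; rewrite /Inv generatorsS.
- exact: dn.
Qed.

Lemma eval_product s l i j : env s -> holds s l -> proper_list n l ->
  reg s 4 = i -> reg s 5 = j -> i < size l -> j < size l ->
  eval s e_product = op (nth 0 l i) (nth 0 l j).
Proof.
move=> [e1 e2 e3 e4] [h1 h2 h3] pl s4 s5 il jl /=.
by rewrite s4 s5 !h2 // e3 ?e4 ?(proper_nth pl).
Qed.

Lemma run_visit s l i j : env s -> holds s l -> proper_list n l -> reg s 4 = i -> reg s 5 = j ->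
  runs p_visit s 40 (fun s' => holds s' (visit op i l j)).
Proof.
move=> en h pl s4 s5; have h1 : reg s 3 = size l by case: h.
rewrite /visit; apply: (@runs_if _ _ _ _ 34) => //=; rewrite h1 s4; last first.
  by move=> /eqP; rewrite subn_eq0 leqNgt => /negbTE ->; apply: runs_skip.
rewrite subn_eq0 -ltnNge => il; apply: (@runs_if _ _ _ _ 30) => //=; rewrite h1 s5; last first.
  by move=> /eqP; rewrite subn_eq0 leqNgt => /negbTE ->; rewrite andbF; apply: runs_skip.
rewrite subn_eq0 -ltnNge => jl; rewrite il jl.
apply: (@runs_seq _ _ _ 8 20) => //; apply: runs_assign => //.
rewrite (eval_product en h pl s4 s5 il jl).
by apply: run_add => //; apply: op_lt; apply: proper_nth pl _.
Qed.

Lemma run_row_pass s l i : env s -> holds s l -> proper_list n l -> reg s 4 = i ->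
  runs (For 5 0 p_visit) s (n * 48 + 6) (fun s' => holds s' (row_pass op i l n)).
Proof.
move=> en h pl s4; have s0 : reg s 0 = n by case: en.
pose Inv (j : nat) (s' : state) := holds s' (row_pass op i l j).
rewrite -{1}s0; apply: runs_weaken (leqnn _) _ (@runs_for s 5 0 _ 40 Inv _ _ _ _) => //.
  by move=> s' [inv _]; rewrite s0 in inv.
move=> j s' jN fr s5 inv.
apply: runs_weaken (leqnn _) _ (@run_visit s' (row_pass op i l j) i j _ inv _ _ s5) => //.
- by move=> s'' hs; rewrite /Inv /row_pass -(addn1 j) iotaD foldl_cat.
- exact: env_agree en fr _ _.
- exact: proper_row_pass.
- by rewrite fr.1.
Qed.

Lemma run_pass s l : env s -> holds s l -> proper_list n l ->
  runs (For 4 0 (For 5 0 p_visit)) s (n * (n * 48 + 14) + 6) (fun s' => holds s' (pass op n l n)).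
Proof.
move=> en h pl; have s0 : reg s 0 = n by case: en.
pose Inv (j : nat) (s' : state) := holds s' (pass op n l j).
rewrite (_ : n * (n * 48 + 14) = reg s 0 * (n * 48 + 6 + 8)); last by rewrite s0; lia.
apply: runs_weaken (leqnn _) _ (@runs_for s 4 0 _ (n * 48 + 6) Inv _ _ _ _) => //.
  by move=> s' [inv _]; rewrite s0 in inv.
move=> i s' iN fr s4 inv.
apply: runs_weaken (leqnn _) _ (@run_row_pass s' (pass op n l i) i _ inv _ s4) => //.
- by move=> s'' hs; rewrite /Inv /pass -(addn1 i) iotaD foldl_cat.
- exact: env_agree en fr _ _.
- exact: proper_pass.
Qed.

Lemma run_rounds s l : env s -> holds s l -> proper_list n l ->
  runs p_rounds s (n * (n * (n * 48 + 14) + 14) + 6) (fun s' => holds s' (rounds op n l n)).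
Proof.
move=> en h pl; have s0 : reg s 0 = n by case: en.
pose Inv (j : nat) (s' : state) := holds s' (rounds op n l j).
rewrite (_ : n * (n * (n * 48 + 14) + 14) = reg s 0 * (n * (n * 48 + 14) + 6 + 8)); last by rewrite s0; lia.
apply: runs_weaken (leqnn _) _ (@runs_for s 6 0 _ (n * (n * 48 + 14) + 6) Inv _ _ _ _) => //.
  by move=> s' [inv _]; rewrite s0 in inv.
move=> i s' iN fr s4 inv.
apply: runs_weaken (leqnn _) _ (@run_pass s' (rounds op n l i) _ inv _) => //.
- exact: env_agree en fr _ _.
- exact: proper_rounds.
Qed.

Lemma cell_eq a b i j : b < n -> j < n -> (a * n + b == i * n + j) = (a == i) && (b == j).
Proof.
move=> bn jn; apply/eqP/andP => [e|[/eqP-> /eqP->] //].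
have n0 : 0 < n by apply: leq_ltn_trans bn.
have := congr1 (divn^~ n) e; rewrite /= !divnMDl // !divn_small // !addn0 => ai.
by move: e; rewrite ai => /addnI ->.
Qed.

Lemma run_table s l : env s -> holds s l -> proper_list n l -> size l = n ->
  runs p_table s (n * (n * 28 + 14) + 6)
    (fun s' => forall idx, idx < n * n -> arr s' 6 idx = table_key op n l idx).
Proof.
move=> en h pl sl; have s0 : reg s 0 = n by case: en.
pose K a b := (index (op (nth 0 l a) (nth 0 l b)) l).+1.
pose Inv i j (s' : state) := forall a b, b < n -> (a < i) || ((a == i) && (b < j)) ->
  arr s' 6 (a * n + b) = K a b.
have InvS i s' : Inv i n s' -> Inv i.+1 0 s'.
  move=> inv a b bn; rewrite andbF orbF ltnS leq_eqVlt => /orP[ai|ai]; apply: inv => //.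
    by rewrite ai bn orbT.
  by rewrite ai.
rewrite (_ : n * (n * 28 + 14) = reg s 0 * (n * 28 + 6 + 8)); last by rewrite s0; lia.
apply: runs_weaken (leqnn _) _ (@runs_for s 4 0 _ (n * 28 + 6) (Inv^~ 0) _ _ _ _) => //.
  move=> s' [inv _] idx idxn; rewrite s0 in inv.
  have n0 : 0 < n by case: (n) idxn.
  rewrite /table_key -/(K _ _) -inv ?ltn_mod //; first by rewrite -divn_eq.
  by rewrite ltn_divLR // idxn.
  by move=> a b bn; rewrite ltn0 andbF.
move=> i s' iN fr s4 inv; rewrite s0 in iN.
have en' := env_agree en fr isT isT; have h' := holds_agree h fr isT isT.
have s0' : reg s' 0 = n by case: en'.
rewrite -{1}s0'; apply: runs_weaken (leqnn _) _ (@runs_for s' 5 0 _ 20 (Inv i) _ _ _ _) => //.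
  by move=> s'' [inv' _]; apply: InvS; rewrite s0' in inv'.
move=> j s'' jN fr' s5 inv'; rewrite s0' in jN.
have en'' := env_agree en' fr' isT isT; have h'' := holds_agree h' fr' isT isT.
have s4' : reg s'' 4 = i by rewrite fr'.1.
have il : i < size l by rewrite sl.
have jl : j < size l by rewrite sl.
apply: runs_put => //=; move=> a b bn; rewrite -/(eval s'' e_product).
have ep := eval_product en'' h'' pl s4' s5 il jl; rewrite [arr s'' 0 _]ep.
have [_ _ e3 _] := en''; have [_ _ h3] := h''.
rewrite /= s4' s5 e3 // cell_eq // h3 ?op_lt ?(proper_nth pl) //.
(* A proper list of size n contains everything below n: appending a missing element would contradict
   [size_proper]. *)
have -> : op (nth 0 l i) (nth 0 l j) \in l.
  have [u _] := andP pl; apply: contraT => nin.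
  have := size_proper (proper_add (op_lt (proper_nth pl il) (proper_nth pl jl)) pl).
  by rewrite /add_new (negbTE nin) size_rcons sl ltnn.
move=> hab; case: andP => [[/eqP -> /eqP ->] //|ne]; apply: inv' => //.
case/orP: hab => [->//|/andP[ai bj]]; apply/orP; right; rewrite ai.
by move: bj; rewrite ltnS leq_eqVlt => /orP[bj|//]; case: ne.
Qed.

Definition compare_state q c f g := [\/ c = 0 /\ (forall r, r < q -> f r = g r), c = 1 /\ lex_lt q f g |
  c = 2 /\ lex_lt q g f].

Lemma lex_ltS q f g : lex_lt q f g -> lex_lt q.+1 f g.
Proof. by move=> [p [pq e l]]; exists p; split=> //; apply: ltnW. Qed.

Lemma lex_lt_irr q f : ~ lex_lt q f f.
Proof. by move=> [p [_ _]]; rewrite ltnn. Qed.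

Lemma compare_stateP q c f g : compare_state q c f g ->
  (c = 1 /\ lex_lt q f g) \/ ((c = 0 \/ c = 2) /\ ~ lex_lt q f g).
Proof.
case=> [[-> e]|[-> l]|[-> l]]; [right|by left|right]; split; auto.
  by move=> [p [pq _ l]]; rewrite e ?ltnn in l.
by move=> l'; apply: lex_lt_irr (lex_lt_trans l l').
Qed.

Lemma run_compare s : env s ->
  runs p_compare s (n * n * 48 + 20) (fun s' =>
    (reg s 2 = 0 -> reg s' 8 = 1) /\
    (reg s 2 = 1 -> compare_state (n * n) (reg s' 8) (arr s 6) (arr s 7))).
Proof.
move=> en; apply: (@runs_seq _ _ _ 4 (n * n * 48 + 6)); first lia.
apply: runs_assign => //=; set s1 := set_reg _ _ _.
have s10 : reg s1 10 = n * n by case: en.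
pose Inv q (s' : state) := (reg s 2 = 0 -> reg s' 8 = 1) /\
  (reg s 2 = 1 -> compare_state q (reg s' 8) (arr s 6) (arr s 7)).
rewrite -{1}s10; apply: runs_weaken (leqnn _) _ (@runs_for s1 9 10 _ 40 Inv _ _ _ _) => //.
- by move=> s' [inv _]; rewrite s10 in inv.
- by split=> /= ->; [rewrite subn0 | rewrite subnn; constructor 1].
move=> q s' qN fr s9 [inv0 inv1]; rewrite s10 in qN.
have a6 : arr s' 6 q = arr s 6 q by rewrite fr.2.
have a7 : arr s' 7 q = arr s 7 q by rewrite fr.2.
apply: (@runs_if _ _ _ _ 30) => //=.
  move=> s8; apply: runs_skip => //; split=> //= /inv1 [[e]|[e l]|[e l]].
  - by rewrite e in s8.
  - by constructor 2; split=> //; apply: lex_ltS.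
  - by constructor 3; split=> //; apply: lex_ltS.
move=> s8; have eqs : reg s 2 = 1 -> forall r, r < q -> arr s 6 r = arr s 7 r.
  by move=> /inv1 [[_ //]|[e]|[e]]; rewrite s8 in e.
have n0 : reg s 2 = 0 -> False by move/inv0; rewrite s8.
apply: (@runs_if _ _ _ _ 20) => //=; rewrite s9 a6 a7.
  rewrite subn_eq0 -ltnNge => lt; apply: runs_assign => //; split=> //= s2.
  by constructor 2; split=> //; exists q; split=> //; apply: eqs.
move=> /eqP; rewrite subn_eq0 => le; apply: (@runs_if _ _ _ _ 10) => //=; rewrite s9 a6 a7.
  rewrite subn_eq0 -ltnNge => lt; apply: runs_assign => //; split=> //= s2.
  constructor 3; split=> //; exists q; split=> // r rq; apply/esym; exact: eqs.
move=> /eqP; rewrite subn_eq0 => ge; apply: runs_skip => //; split=> //= s2.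
constructor 1; split=> // r; rewrite ltnS leq_eqVlt => /orP[/eqP->|]; last exact: eqs.
by apply/eqP; rewrite eqn_leq le ge.
Qed.

Lemma run_copy s l : env s -> holds s l -> size l = n -> proper_list n l ->
  runs p_copy s (n * n * 20 + n * 20 + 20) (fun s' => [/\ reg s' 2 = 1,
    forall idx, idx < n * n -> arr s' 7 idx = arr s 6 idx &
    forall x, x < n -> arr s' 1 x = index x l]).
Proof.
move=> en h sl pl; apply: (@runs_seq _ _ _ 2 (n * n * 20 + n * 20 + 12)); first lia.
apply: runs_assign => //=; set s1 := set_reg _ _ _.
apply: (@runs_seq _ _ _ (n * n * 20 + 6) (n * 20 + 6)); first lia.
have s10 : reg s1 10 = n * n by case: en.
pose Inv q (s' : state) := forall idx, idx < q -> arr s' 7 idx = arr s 6 idx.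
rewrite -{1}s10; apply: runs_weaken (leqnn _) _ (@runs_for s1 9 10 _ 12 Inv _ _ _ _) => //; last first.
  move=> q s' qN fr s9 inv; apply: runs_put => //= idx; rewrite /= s9 ltnS fr.2 //.
  by case: eqP => [-> //|ne] iq /=; apply: inv; rewrite ltn_neqAle iq andbT; apply/eqP.
move=> s2 [inv fr]; rewrite s10 in inv.
have s20 : reg s2 0 = n by rewrite fr.1 //; case: en.
pose Inv' q (s' : state) := forall x, x < q -> arr s' 1 x = index x l.
rewrite -{1}s20; apply: runs_weaken (leqnn _) _ (@runs_for s2 4 0 _ 12 Inv' _ _ _ _) => //.
  move=> s' [inv' fr']; rewrite s20 in inv'; split => //; first by rewrite fr'.1 // fr.1.
  by move=> idx idxn; rewrite fr'.2 // inv.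
move=> q s' qN fr' s4 inv'; rewrite s20 in qN; have [_ _ h3] := h.
apply: runs_put => //= x; rewrite /= s4 ltnS fr'.2 // fr.2 // h3 //.
have -> : q \in l.
  have [u _] := andP pl; apply: contraT => nin.
  by have := size_proper (proper_add qN pl); rewrite /add_new (negbTE nin) size_rcons sl ltnn.
rewrite subn1 /=; case: eqP => [-> //|ne] xq /=; apply: inv'.
by rewrite ltn_neqAle xq andbT; apply/eqP.
Qed.

Lemma lex_lt_ext q f g f' g' : (forall r, r < q -> f r = f' r) -> (forall r, r < q -> g r = g' r) ->
  lex_lt q f g -> lex_lt q f' g'.
Proof.
move=> ef eg [p [pq e l]]; exists p; split=> // [r rp|]; last by rewrite -ef // -eg.
by rewrite -ef ?(ltn_trans rp) // -eg ?(ltn_trans rp) // e.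
Qed.

(** * Enumeration of the tuples and selection of the least table *)

Section Tuples.
Variable k : nat.
Hypothesis n_gt0 : 0 < n.

Definition tuple_closure v := closure op n k (digit n ^~ v).

Definition candidate v := size (tuple_closure v) == n.

(* What arrays 1 and 7 record after the tuples numbered 0, ..., v - 1, where
   tuple number v consists of the k lowest digits of v in base n. *)
Definition best v s := (reg s 2 = 0 /\ forall w, w < v -> ~~ candidate w) \/
  (reg s 2 = 1 /\ exists w, [/\ w < v, candidate w,
     forall idx, idx < n * n -> arr s 7 idx = table_key op n (tuple_closure w) idx,
     forall x, x < n -> arr s 1 x = index x (tuple_closure w) &
     forall w', w' < v -> candidate w' ->
       ~ lex_lt (n * n) (table_key op n (tuple_closure w')) (table_key op n (tuple_closure w))]).

Lemma best_agree rs xs v s s' : best v s -> agree_off rs xs s s' -> 2 \notin rs ->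
  (1 \notin xs) && (7 \notin xs) -> best v s'.
Proof.
move=> b [f1 f2] r2 /andP[x1 x7].
case: b => [[h1 h2]|[h1 [w [wv cw h7 hx hm]]]]; first by left; rewrite f1.
right; rewrite f1 //; split => //; exists w; split=> //.
  by move=> idx idxn; rewrite f2 // h7.
by move=> x xn; rewrite f2 // hx.
Qed.

Lemma proper_tuple_closure v : proper_list n (tuple_closure v).
Proof. by apply: proper_closure => // p _; rewrite ltn_mod. Qed.

Definition record_bound := n * n * 100 + n * 50 + 100.

Lemma run_record s v : env s -> holds s (tuple_closure v) -> candidate v -> best v s ->
  runs p_record s record_bound (best v.+1).
Proof.
move=> en h cv bs; have sl : size (tuple_closure v) = n by apply/eqP.
have pl := proper_tuple_closure v; rewrite /record_bound.
apply: (@runs_seq _ _ _ (n * (n * 28 + 14) + 6) (n * n * 68 + n * 20 + 60)); first nia.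
apply: runs_weaken (leqnn _) _ (runs_frame (run_table en h pl sl)) => s1 [key1 fr1].
have en1 := env_agree en fr1 isT isT; have h1 := holds_agree h fr1 isT isT.
have b1 := best_agree bs fr1 isT isT.
apply: (@runs_seq _ _ _ (n * n * 48 + 20) (n * n * 20 + n * 20 + 40)); first nia.
apply: runs_weaken (leqnn _) _ (runs_frame (run_compare en1)) => s2 [[c0 c1] fr2].
have en2 := env_agree en1 fr2 isT isT; have h2 := holds_agree h1 fr2 isT isT.
have b2 := best_agree b1 fr2 isT isT.
have key2 idx : idx < n * n -> arr s2 6 idx = table_key op n (tuple_closure v) idx.
  by move=> idxn; rewrite fr2.2 // key1.
have r2 : reg s2 2 = reg s1 2 by rewrite fr2.1.
have copy : (forall w', w' < v -> candidate w' ->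
    ~ lex_lt (n * n) (table_key op n (tuple_closure w')) (table_key op n (tuple_closure v))) ->
    runs p_copy s2 (n * n * 20 + n * 20 + 20) (best v.+1).
  move=> hv; apply: runs_weaken (leqnn _) _ (run_copy en2 h2 sl pl) => s3 [r3 k3 o3].
  right; split=> //; exists v; split=> //.
    by move=> idx idxn; rewrite k3 // key2.
  move=> w'; rewrite ltnS leq_eqVlt => /orP[/eqP-> _|]; first exact: lex_lt_irr.
  exact: hv.
case: b2 => [[f0 nc]|[f1 [w [wv cw h7 hx hm]]]].
  have r8 : reg s2 8 = 1 by apply: c0; rewrite -r2.
  apply: (@runs_if _ _ _ _ (n * n * 20 + n * 20 + 30)); rewrite /= ?r8 //; first lia.
  move=> _; apply: (@runs_if _ _ _ _ (n * n * 20 + n * 20 + 20)); rewrite /= ?r8 //; first lia.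
  by move=> _; apply: copy => w' /nc/negbTE ->.
have keyB idx : idx < n * n -> arr s1 7 idx = table_key op n (tuple_closure w) idx.
  by move=> idxn; rewrite -h7 // fr2.2.
have := compare_stateP (c1 (etrans (esym r2) f1)) => -[[r8 lt]|[r8 nlt]].
  apply: (@runs_if _ _ _ _ (n * n * 20 + n * 20 + 30)); rewrite /= ?r8 //; first lia.
  move=> _; apply: (@runs_if _ _ _ _ (n * n * 20 + n * 20 + 20)); rewrite /= ?r8 //; first lia.
  move=> _; apply: copy => w' w'v cw' lt'; apply: (hm w' w'v cw').
  apply: lex_lt_trans lt' _; apply: lex_lt_ext lt => //.
have bb : best v.+1 s2.
  right; split=> //; exists w; split=> //; first exact: ltnW.
  move=> w'; rewrite ltnS leq_eqVlt => /orP[/eqP-> _|]; last exact: hm.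
  by move=> lt; apply: nlt; apply: lex_lt_ext lt => idx idxn; rewrite ?key1 ?keyB.
apply: (@runs_if _ _ _ _ 10); rewrite /=; first lia.
  move=> r8n; apply: (@runs_if _ _ _ _ 2) => //=; case: r8 => r8; rewrite ?r8 // in r8n *.
  by move=> _; apply: runs_skip.
by move=> _; apply: runs_skip.
Qed.

Definition digits_of v s := forall p, p < k -> arr s 3 p = digit n p v.

Definition process_bound := n * 12 + k * 32 + n * (n * (n * 48 + 14) + 14) + record_bound + 50.

Lemma run_process s v : env s -> reg s 1 = k -> digits_of v s -> best v s ->
  runs p_process s process_bound (best v.+1).
Proof.
move=> en s1 dg b; have s0 : reg s 0 = n by case: en.
apply: (@runs_seq _ _ _ (n * 12 + 10) (k * 32 + n * (n * (n * 48 + 14) + 14) + record_bound + 40)).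
  by rewrite /process_bound; lia.
apply: runs_weaken (leqnn _) _ (runs_frame (run_clear s0)) => sa [ha fa].
have ena := env_agree en fa isT isT; have ba := best_agree b fa isT isT.
apply: (@runs_seq _ _ _ (k * 32 + 6) (n * (n * (n * 48 + 14) + 14) + record_bound + 30)); first lia.
have sa1 : reg sa 1 = k by rewrite fa.1.
apply: runs_weaken (leqnn _) _ (runs_frame (@run_load sa k (digit n ^~ v) sa1 _ _ ha)).
- move=> sb [hb fb].
  have enb := env_agree ena fb isT isT; have bb := best_agree ba fb isT isT.
  apply: (@runs_seq _ _ _ (n * (n * (n * 48 + 14) + 14) + 6) (record_bound + 20)); first lia.
  apply: runs_weaken (leqnn _) _ (runs_frame (run_rounds enb hb _)).
    move=> sc [hc fc].
    have enc := env_agree enb fc isT isT; have bc := best_agree bb fc isT isT.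
    have [rc _ _] := hc; have [rc0 _ _ _] := enc.
    have pl := proper_tuple_closure v.
    apply: (@runs_if _ _ _ _ record_bound); rewrite /= ?rc ?rc0; first lia.
      move=> lt; apply: runs_skip; first by rewrite /record_bound; lia.
      have nv : ~~ candidate v.
        by apply: contra lt => /eqP; rewrite /tuple_closure /closure => ->; rewrite subnn.
      case: bc => [[f0 nc]|[f1 [w [wv cw h7 hx hm]]]].
        by left; split=> // w; rewrite ltnS leq_eqVlt => /orP[/eqP-> //|]; apply: nc.
      right; split=> //; exists w; split=> //; first exact: ltnW.
      move=> w'; rewrite ltnS leq_eqVlt => /orP[/eqP-> |]; last exact: hm.
      by rewrite (negbTE nv).
    move=> /eqP; rewrite subn_eq0 => ge; apply: run_record => //.
    by rewrite /candidate eqn_leq (size_proper pl).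
  by apply: proper_generators => p _; rewrite ltn_mod.
- by move=> p pk; rewrite fa.2 // dg.
- by move=> p _; rewrite ltn_mod.
Qed.

(** A carry reaches digit p exactly when n ^ p divides v + 1; [run_increment] keeps this truth value
    in register 11. *)
Lemma digit_carry p v : n ^ p %| v.+1 ->
  digit n p v.+1 = (if (digit n p v).+1 == n then 0 else (digit n p v).+1) /\
  (n ^ p.+1 %| v.+1) = ((digit n p v).+1 == n).
Proof.
move=> dv; have np : 0 < n ^ p by rewrite expn_gt0 n_gt0.
have E : v.+1 %/ n ^ p = (v %/ n ^ p).+1 by rewrite divnS // dv add1n.
have D : (n %| (v %/ n ^ p).+1) = ((digit n p v).+1 == n).
  rewrite /digit {1}(divn_eq (v %/ n ^ p) n) -addnS dvdn_addr ?dvdn_mull //.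
  apply/idP/eqP => [h|->//]; apply/eqP; rewrite eqn_leq ltn_mod n_gt0 /=.
  exact: dvdn_leq h.
split; first by rewrite /digit E modnS D.
rewrite -D -E -[in LHS](divnK dv) expnS dvdn_pmul2r //.
Qed.

Lemma digit_nocarry p v : ~~ (n ^ p %| v.+1) ->
  digit n p v.+1 = digit n p v /\ ~~ (n ^ p.+1 %| v.+1).
Proof.
move=> dv; have np : 0 < n ^ p by rewrite expn_gt0 n_gt0.
split; first by rewrite /digit divnS // (negbTE dv).
by apply: contra dv; apply: dvdn_trans; rewrite expnS dvdn_mull.
Qed.

Lemma run_increment s v : env s -> reg s 1 = k -> digits_of v s ->
  runs p_increment s (k * 38 + 20) (fun s' => digits_of v.+1 s' /\ reg s' 12 = ~~ (n ^ k %| v.+1)).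
Proof.
move=> en sk dg; apply: (@runs_seq _ _ _ 2 (k * 38 + 18)); first lia.
apply: runs_assign => //=; set s1 := set_reg _ _ _.
apply: (@runs_seq _ _ _ (k * 38 + 6) 4); first lia.
pose Inv i (s' : state) := [/\ reg s' 11 = (n ^ i %| v.+1), forall p, p < i -> arr s' 3 p = digit n p v.+1 &
  forall p, i <= p < k -> arr s' 3 p = digit n p v].
have s11 : reg s1 1 = k by [].
have en1 : env s1 by [].
rewrite -{1}s11; apply: runs_weaken (leqnn _) _ (@runs_for s1 4 1 _ 30 Inv _ _ _ _) => //.
- move=> s' [[i1 i2 i3] fr]; rewrite s11 in i1 i2.
  apply: runs_assign => //=; rewrite i1; split; last by case: (_ %| _).
  by move=> p pk /=; apply: i2.
- by split=> //=; rewrite expn0 dvd1n.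
move=> i s' iN fr s4 [i1 i2 i3]; rewrite s11 in iN.
have en' : env s' := env_agree en1 fr isT isT; have [e0 _ _ _] := en'.
have di : arr s' 3 i = digit n i v by apply: i3; rewrite leqnn.
have upd (s'' : state) : (forall p, p != i -> arr s'' 3 p = arr s' 3 p) -> arr s'' 3 i = digit n i v.+1 ->
    reg s'' 11 = (n ^ i.+1 %| v.+1) -> Inv i.+1 (set_reg s'' 4 i.+1).
  move=> o e c; split=> // p /=.
    by rewrite ltnS leq_eqVlt => /orP[/eqP->//|pi]; rewrite o ?i2 // neq_ltn pi.
  by move=> /andP[ip pk]; rewrite o ?i3 ?(ltnW ip) // neq_ltn ip orbT.
apply: (@runs_if _ _ _ _ 26) => //=; rewrite i1; last first.
  move=> c; have dv : ~~ (n ^ i %| v.+1) by move: c; case: (_ %| _).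
  have [d1 d2] := digit_nocarry dv.
  by apply: runs_skip => //; apply: upd; rewrite ?d1 // i1 (negbTE dv) (negbTE d2).
move=> c; have dv : n ^ i %| v.+1 by move: c; case: (_ %| _).
have [d1 d2] := digit_carry dv.
apply: (@runs_seq _ _ _ 7 15) => //; apply: runs_put => //=; rewrite s4 di addn1.
have dn : (digit n i v).+1 <= n by rewrite ltn_mod.
apply: (@runs_if _ _ _ _ 5) => //=; rewrite s4 !eqxx /= e0.
  rewrite subn_eq0 -ltnNge => lt; apply: runs_assign => //=; apply: upd => //=.
  - by move=> p /negbTE ->.
  - by rewrite eqxx d1 ltn_eqF.
  - by rewrite d2 ltn_eqF.
move=> /eqP; rewrite subn_eq0 => ge; have eq : (digit n i v).+1 == n by rewrite eqn_leq dn.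
apply: runs_put => //=; apply: upd => //=.
- by move=> p /negbTE pi; rewrite s4 pi.
- by rewrite s4 eqxx d1 eq.
- by rewrite i1 d2 eq dv.
Qed.

Definition enumerate_bound := n ^ k * (process_bound + (k * 38 + 20) + 2) + k * 11 + 20.

Lemma run_enumerate s : env s -> reg s 1 = k -> reg s 2 = 0 ->
  runs p_enumerate s enumerate_bound (best (n ^ k)).
Proof.
move=> en sk s2; set b := process_bound + (k * 38 + 20).
apply: (@runs_seq _ _ _ (k * 11 + 6) (n ^ k * (b + 2) + 4)); first by rewrite /enumerate_bound; lia.
pose Inv0 i (s' : state) := forall p, p < i -> arr s' 3 p = 0.
rewrite -{1}sk; apply: runs_weaken (leqnn _) _ (@runs_for s 4 1 _ 3 Inv0 _ _ _ _) => //; last first.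
  move=> i s' iN fr s4 inv; apply: runs_put => //= p; rewrite /= s4 ltnS.
  by case: eqP => //= ne pi; apply: inv; rewrite ltn_neqAle pi andbT; apply/eqP.
move=> s1 [inv fr]; rewrite sk in inv.
apply: (@runs_seq _ _ _ 2 (n ^ k * (b + 2) + 2)); first lia.
apply: runs_assign => //=; set sb := set_reg _ _ _.
set N := n ^ k; have N0 : 0 < N by rewrite expn_gt0 n_gt0.
(* m counts the tuples still to be processed, so N - m is the number of the next one; the digits are
   asserted only while one remains. *)
pose J m (s' : state) := [/\ m <= N, env s', reg s' 1 = k, reg s' 12 = (m != 0) &
  (m != 0 -> digits_of (N - m) s') /\ best (N - m) s'].
have -> : N * (b + 2) + 2 = N * (b + (cost (Reg 12)).+1) + (cost (Reg 12)).+1 by [].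
apply: runs_weaken (leqnn _) _ (@runs_while _ _ _ b N J _ _ _).
- by move=> s' [_ _ _ _ [_]]; rewrite subn0.
- have frb : agree_off [:: 4; 12] [:: 3] s sb.
    apply: agree_off_trans (_ : agree_off _ _ s1 sb).
      have fr1 : agree_off [:: 4] [:: 3] s s1 := fr.
      by apply: agree_off_sub fr1 => x; rewrite !inE // => ->.
    by split=> // r; rewrite !inE negb_or /= => /andP[_ /negbTE->].
  split; rewrite ?subnn -?lt0n //.
  + exact: env_agree en frb isT isT.
  + by rewrite frb.1.
  + by rewrite N0.
  split; first by move=> _ p pk; rewrite /= inv // /digit div0n mod0n.
  by left; rewrite frb.1.
- by move=> m s' [_ _ _ + _] /= => ->; case: m.
move=> m s' [mN en' sk' _ [dg bs]].
apply: (@runs_seq _ _ _ process_bound (k * 38 + 20)) => //.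
have dg' := dg isT; have mN' : (N - m.+1).+1 = N - m by lia.
apply: runs_weaken (leqnn _) _ (runs_frame (run_process en' sk' dg' bs)) => sc [bc fc].
have enc := env_agree en' fc isT isT; have sc1 : reg sc 1 = k by rewrite fc.1.
have dgc : digits_of (N - m.+1) sc by move=> p pk; rewrite fc.2 // dg'.
apply: runs_weaken (leqnn _) _ (runs_frame (run_increment enc sc1 dgc)) => sd [[dgd rd] fd].
rewrite mN' in bc dgd rd.
split; [exact: ltnW | exact: env_agree enc fd isT isT | by rewrite fd.1 | | split=> //].
  rewrite rd; congr (nat_of_bool (~~ _)); apply/idP/eqP => [/dvdn_leq h|->]; last by rewrite subn0.
  by have := h (_ : 0 < N - m); lia.
exact: best_agree bc fd isT isT.
Qed.

End Tuples.
End Specs.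
End Program.

(** * The canonical labelling and its cost *)

Section Main.
Local Open Scope nat_scope.
Variable n : nat.
Implicit Types (T : 'M['I_n]_n).

Definition table_op T x y := arr (input T) 0 (x * n + y).

Lemma table_opE T (x y : 'I_n) : table_op T x y = T x y.
Proof. exact: input_cell. Qed.

Lemma table_op_lt T x y : x < n -> y < n -> table_op T x y < n.
Proof. by move=> xn yn; rewrite (table_opE T (Ordinal xn) (Ordinal yn)). Qed.

Definition pair_generated T := [exists w : 'I_(n ^ 2), candidate n (table_op T) 2 w].

Definition arity T := if pair_generated T then 2 else n.

Definition setup_bound := n * 16 + 40.

Definition main_bound T := setup_bound + enumerate_bound n 2 +
  (if pair_generated T then 0 else enumerate_bound n n).

(** The fallback cannot fail, because the tuple 0, ..., n - 1 lists every element. *)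
Lemma ex_candidate T : 0 < n -> exists2 w, w < n ^ arity T & candidate n (table_op T) (arity T) w.
Proof.
move=> n0; rewrite /arity; case: ifP => [/existsP[w cw]|_]; first by exists (w : nat).
have [w wn wE] := @digit_surj n n id (fun p pn => pn).
exists w => //; rewrite /candidate /tuple_closure closure_all //.
exact: table_op_lt.
Qed.

Definition lex_minimal T k w := [/\ w < n ^ k, candidate n (table_op T) k w &
  forall w', w' < n ^ k -> candidate n (table_op T) k w' ->
    ~ lex_lt (n * n) (table_key (table_op T) n (tuple_closure n (table_op T) k w'))
                     (table_key (table_op T) n (tuple_closure n (table_op T) k w))].

(** Several tuples may attain the minimum and their labellings may differ by automorphisms; the
    specification leaves the choice open. *)
Definition spec T (out : nat -> nat) := exists2 w, lex_minimal T (arity T) w &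
  forall x, x < n -> out x = index x (tuple_closure n (table_op T) (arity T) w).

Lemma best_spec T s k : best n (table_op T) k (n ^ k) s -> k = arity T -> 0 < n -> spec T (arr s 1).
Proof.
move=> b e n0; rewrite {}e in b; have [w wn cw] := ex_candidate T n0.
by case: b => [[_ /(_ w wn)/negP//]|[_ [w' [wn' cw' _ hx hm]]]]; exists w'.
Qed.

Lemma run_main T : 0 < n -> runs p_main (input T) (main_bound T) (fun s => spec T (arr s 1)).
Proof.
move=> n0; set op := table_op T; have opn x y : x < n -> y < n -> op x y < n by apply: table_op_lt.
set e2 := enumerate_bound n 2.
set en := if pair_generated T then 0 else enumerate_bound n n.
apply: (@runs_seq _ _ _ (n * 16 + 6) (e2 + en + 34)); first by rewrite /main_bound /setup_bound -/e2 -/en; lia.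
pose Inv i (s' : state) := forall x, x <= i -> arr s' 2 x = x * n.
rewrite -[X in X * 16]/(reg (input T) 0).
apply: runs_weaken (leqnn _) _ (@runs_for (input T) 4 0 _ 8 Inv _ _ _ _) => //; last first.
- move=> i s' iN fr s4 inv; apply: runs_put => //= x; rewrite /= s4 addn1.
  case: eqP => [-> _|ne] /=; first by rewrite inv // fr.1 //= mulSn addnC.
  by rewrite leq_eqVlt => /orP[/eqP //|]; rewrite ltnS; apply: inv.
- by move=> x; rewrite leqn0 => /eqP->.
move=> s1 [inv fr]; have s10 : reg s1 0 = n by rewrite fr.1.
apply: (@runs_seq _ _ _ 3 (e2 + en + 31)); first lia.
apply: runs_assign => //=.
apply: (@runs_seq _ _ _ 2 (e2 + en + 29)); first lia.
apply: runs_assign => //=; rewrite s10 inv //.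
set s2 := set_reg (set_reg s1 10 (n * n)) 1 2.
have env2 : env n op s2.
  split=> //; first by move=> x xn; apply: inv; apply: ltnW.
  by move=> x y xn yn; rewrite /= fr.2.
apply: (@runs_seq _ _ _ e2 (en + 20)); first lia.
have s22 : reg s2 2 = 0 by rewrite /= fr.1.
apply: runs_weaken (leqnn _) _ (runs_frame (@run_enumerate n op opn 2 n0 s2 env2 _ s22)) => // s3 [b3 fr3].
have env3 := env_agree env2 fr3 isT isT.
have [f3|f3] := eqVneq (reg s3 2) 0; last first.
  apply: (@runs_if _ _ _ _ 10) => /=; [lia|move=> _|by move=> e; rewrite e eqxx in f3].
  apply: runs_skip => //; apply: (best_spec b3 _ n0); rewrite /arity ifT //.
  case: b3 => [[e _]|[_ [w [wn cw _ _ _]]]]; first by rewrite e eqxx in f3.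
  by apply/existsP; exists (Ordinal wn).
have np : pair_generated T = false.
  case: b3 => [[_ h]|[e _]]; last by rewrite e in f3.
  by apply/negbTE/existsP => -[w]; apply/negP; apply: h.
rewrite /en np; apply: (@runs_if _ _ _ _ (enumerate_bound n n + 2)) => /=; [lia|by rewrite f3|move=> _].
apply: (@runs_seq _ _ _ 2 (enumerate_bound n n)); first lia.
apply: runs_assign => //=; set s4 := set_reg _ _ _.
have env4 : env n op s4 by [].
have s41 : reg s4 1 = n by rewrite /=; case: env3.
apply: runs_weaken (leqnn _) _ (@run_enumerate n op opn n n0 s4 env4 s41 f3) => s5 b5.
by apply: (best_spec b5 _ n0); rewrite /arity np.
Qed.

Definition act_nat (f : 'I_n -> 'I_n) x : nat := if insub x is Some i then nat_of_ord (f i) else x.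

Lemma act_natE f (i : 'I_n) : act_nat f i = f i.
Proof. by rewrite /act_nat valK. Qed.

Lemma isomorphic_sym T T' : isomorphic T T' -> isomorphic T' T.
Proof.
by move=> [pi h]; exists (pi^-1)%g => x y; apply: (canRL (permK pi)); rewrite -h !permKV.
Qed.

(** The image of tuple number w under the isomorphism is tuple number w' for some w'. Its list is
    the image list, with the same key, so isomorphic tables have the same set of candidate keys. *)
Lemma transfer T T' k w : 0 < n -> isomorphic T T' -> w < n ^ k -> candidate n (table_op T) k w ->
  exists w', [/\ w' < n ^ k, candidate n (table_op T') k w' &
    forall idx, idx < n * n -> table_key (table_op T') n (tuple_closure n (table_op T') k w') idx =
      table_key (table_op T) n (tuple_closure n (table_op T) k w) idx].
Proof.
move=> n0 [pi iso] wn cw; pose f := act_nat pi.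
have fn x : x < n -> f x < n by move=> xn; rewrite /f (act_natE pi (Ordinal xn)).
have finj : {in [pred x | x < n] &, injective f}.
  move=> x y; rewrite !inE => xn yn; rewrite /f (act_natE pi (Ordinal xn)) (act_natE pi (Ordinal yn)).
  by move=> /val_inj/perm_inj [].
have fop x y : x < n -> y < n -> table_op T' (f x) (f y) = f (table_op T x y).
  move=> xn yn; rewrite /f (act_natE pi (Ordinal xn)) (act_natE pi (Ordinal yn)).
  by rewrite (table_opE T (Ordinal xn) (Ordinal yn)) table_opE act_natE iso.
have dn p : digit n p w < n by rewrite ltn_mod.
have [w' wn' wE] := @digit_surj n k (fun p => f (digit n p w)) (fun p _ => fn _ (dn p)).
have E : tuple_closure n (table_op T') k w' = map f (tuple_closure n (table_op T) k w).
  apply: (map_closure (n := n)) => //; exact: table_op_lt.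
have pl := proper_tuple_closure (@table_op_lt T) k n0 w.
exists w'; split=> //; first by rewrite /candidate E size_map.
move=> idx idxn; rewrite E; apply: (table_key_map (n := n)) => //; first exact: table_op_lt.
exact/eqP.
Qed.

Lemma arity_iso T T' : 0 < n -> isomorphic T T' -> arity T = arity T'.
Proof.
move=> n0 iso; rewrite /arity; suff -> : pair_generated T = pair_generated T' by [].
apply/existsP/existsP => -[w cw].
  by have [w' [wn' cw' _]] := transfer n0 iso (ltn_ord w) cw; exists (Ordinal wn').
by have [w' [wn' cw' _]] := transfer n0 (isomorphic_sym iso) (ltn_ord w) cw; exists (Ordinal wn').
Qed.

(** The label c belongs to the element at position c of l, that is pi^-1 c = nth 0 l c; thus keys
    are the entries of the relabelled table plus 1. *)
Lemma relabel_key T (pi : {perm 'I_n}) l (a b : 'I_n) : proper_list n l -> size l = n ->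
  (forall x : 'I_n, pi x = index (x : nat) l :> nat) ->
  (relabel pi T a b).+1 = table_key (table_op T) n l (a * n + b).
Proof.
move=> /andP[ul al] sl piE; rewrite mxE piE.
have n0 : 0 < n by apply: leq_ltn_trans (ltn_ord a).
have inv (c : 'I_n) : nth 0 l c = (pi^-1)%g c.
  have pc : nat_of_ord c = index (nat_of_ord ((pi^-1)%g c)) l by rewrite -piE permKV.
  rewrite [in LHS]pc nth_index //.
  by rewrite -index_mem -pc sl.
rewrite /table_key divnMDl // divn_small // addn0 modnMDl modn_small //.
by rewrite !inv table_opE.
Qed.

(** If one of the two minimal keys were smaller, [transfer] would carry it to the other table and
    contradict minimality there. *)
Lemma spec_relabel T T' (pi pi' : {perm 'I_n}) : 0 < n -> isomorphic T T' ->
  spec T (fun x => act_nat pi x) -> spec T' (fun x => act_nat pi' x) ->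
  relabel pi T = relabel pi' T'.
Proof.
move=> n0 iso [w [wn cw wm] wE] [w' [wn' cw' wm'] wE'].
rewrite -(arity_iso n0 iso) in wn' cw' wm' wE'.
set k := arity T in wn cw wm wE wn' cw' wm' wE'.
have [u [un cu uE]] := transfer n0 iso wn cw.
have [u' [un' cu' uE']] := transfer n0 (isomorphic_sym iso) wn' cw'.
have pl := proper_tuple_closure (@table_op_lt T) k n0 w.
have pl' := proper_tuple_closure (@table_op_lt T') k n0 w'.
apply/matrixP => a b; apply/val_inj/succn_inj.
rewrite /= (relabel_key _ _ _ pl (eqP cw)) => [|x]; last by rewrite -wE // act_natE.
rewrite (relabel_key _ _ _ pl' (eqP cw')) => [|x]; last by rewrite -wE' // act_natE.
have idxn : a * n + b < n * n.
  by rewrite -ltn_divLR // divnMDl // divn_small // addn0.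
case: (lex_total (n * n) (table_key (table_op T) n (tuple_closure n (table_op T) k w))
  (table_key (table_op T') n (tuple_closure n (table_op T') k w'))) => [e|lt|lt]; first exact: e.
  by case: (wm' u un cu); apply: lex_lt_ext lt => // r rn; rewrite uE.
by case: (wm u' un' cu'); apply: lex_lt_ext lt => // r rn; rewrite uE'.
Qed.

Lemma spec_perm T out : 0 < n -> spec T out -> exists pi : {perm 'I_n},
  (forall x : 'I_n, out x = pi x) /\ spec T (fun x => act_nat pi x).
Proof.
move=> n0 [w mw wE]; have [wn cw wm] := mw.
have pl := proper_tuple_closure (@table_op_lt T) (arity T) n0 w.
set l := tuple_closure _ _ _ _ in pl wE.
have sl : size l = n by apply/eqP.
have mem x : x < n -> x \in l.
  move=> xn; have [u _] := andP pl; apply: contraT => nin.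
  by have := size_proper (proper_add xn pl); rewrite /add_new (negbTE nin) size_rcons sl ltnn.
have il (x : 'I_n) : index (x : nat) l < n by rewrite -[ltnRHS]sl index_mem mem.
have inj : injective (fun x : 'I_n => Ordinal (il x)).
  move=> x y /(congr1 val) /= e; apply: val_inj => /=.
  by rewrite -(nth_index 0 (mem x (ltn_ord x))) e nth_index // mem.
exists (perm inj); split=> [x|]; first by rewrite permE /= wE.
exists w => // x xn; rewrite (act_natE _ (Ordinal xn)) permE //.
Qed.

(** The list grown from y and z is closed, and it is proper because no pair is a candidate. *)
Lemma not_pair_generated T : 0 < n -> ~~ pair_generated T -> not_two_generated T.
Proof.
move=> n0 np; apply/forallP => y; apply/forallP => z.
pose d p := if p == 0 then nat_of_ord y else nat_of_ord z.
have dn p : p < 2 -> d p < n by rewrite /d; case: eqP.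
have [w wn wE] := digit_surj dn; set l := tuple_closure n (table_op T) 2 w.
have pl := proper_tuple_closure (@table_op_lt T) 2 n0 w.
apply/existsP; exists [set x : 'I_n | (x : nat) \in l].
have dn' p : p < 2 -> digit n p w < n by rewrite ltn_mod.
apply/and4P; split.
- by rewrite inE -[nat_of_ord y]/(d 0) -wE //; exact: (@mem_closure _ n (digit n ^~ w) 2).
- by rewrite inE -[nat_of_ord z]/(d 1) -wE //; exact: (@mem_closure _ n (digit n ^~ w) 2).
- apply/closed_inP => a b; rewrite !inE => al bl; rewrite -table_opE.
  exact: (closure_closed (@table_op_lt T) dn' isT al bl).
apply: contra np => /eqP full; apply/existsP; exists (Ordinal wn).
rewrite /candidate eqn_leq (size_proper pl) /= -[leqLHS](size_iota 0 n).
apply: (uniq_leq_size (iota_uniq _ _)) => x; rewrite mem_iota /= add0n => xn.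
by have := in_setT (Ordinal xn); rewrite -full inE.
Qed.

End Main.

Section Polynomials.

Definition polynomial (f : nat -> nat) := exists p : {poly rat}, forall n, p.[n%:R] = (f n)%:R.

Lemma polynomial_const c : polynomial (fun=> c).
Proof. by exists (c%:R%:P) => n; rewrite hornerC. Qed.

Lemma polynomial_id : polynomial id.
Proof. by exists 'X => n; rewrite hornerX. Qed.

Lemma polynomial_add f g : polynomial f -> polynomial g -> polynomial (fun n => f n + g n)%N.
Proof. by move=> [p hp] [q hq]; exists (p + q) => n; rewrite hornerD hp hq natrD. Qed.

Lemma polynomial_mul f g : polynomial f -> polynomial g -> polynomial (fun n => f n * g n)%N.
Proof. by move=> [p hp] [q hq]; exists (p * q) => n; rewrite hornerM hp hq natrM. Qed.

End Polynomials.

Theorem theorem6p2 :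
  exists (P : prog)
         (label : forall n : nat, 'M['I_n]_n -> {perm 'I_n})
         (time : forall n : nat, 'M['I_n]_n -> nat),
    [/\ forall (n : nat) (T : 'M['I_n]_n), is_loop T ->
          labels_in P T (label n T) (time n T),
        forall (n : nat) (T T' : 'M['I_n]_n), is_loop T -> is_loop T' ->
          isomorphic T T' ->
          relabel (label n T) T = relabel (label n T') T'
      & exists p : {poly rat}, forall n : nat, (0 < n)%N ->
          uniform_expectation (@is_loop n) (fun T => (time n T)%:R) <=
          p.[n%:R] ].
Proof.
have loop_gt0 n (T : 'M['I_n]_n) : is_loop T -> (0 < n)%N.
  by case/andP => _ /existsP[e _]; apply: leq_ltn_trans (ltn_ord e).
have H n (T : 'M['I_n]_n) : exists r : {perm 'I_n} * nat, is_loop T ->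
    [/\ labels_in p_main T r.1 r.2, (r.2 <= main_bound T)%N & spec T (fun x => act_nat r.1 x)].
  have [lT|nlT] := boolP (is_loop T); last by exists (1%g, 0%N).
  have n0 := loop_gt0 n T lT.
  have [t [s [ex tb sp]]] := run_main T n0; have [pi [out spi]] := spec_perm n0 sp.
  by exists (pi, t) => _; split => //; exists s.
(* [cid] chooses a permutation and an exact running time for each table; these become the functions
   [label] and [time]. *)
pose r n T := projT1 (cid (H n T)).
have rP n T := projT2 (cid (H n T)) : is_loop T -> [/\ labels_in p_main T (r n T).1 (r n T).2,
  ((r n T).2 <= main_bound T)%N & spec T (fun x => act_nat (r n T).1 x)].
exists p_main, (fun n T => (r n T).1), (fun n T => (r n T).2); split.
- by move=> n T /rP[].
- move=> n T T' lT lT' iso; have [_ _ s] := rP n T lT; have [_ _ s'] := rP n T' lT'.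
  exact: spec_relabel (loop_gt0 n T lT) iso s s'.
have [K rare] := hard_loops_rare.
pose f n := (setup_bound n + enumerate_bound n 2)%N.
(* g n is the cost of the second enumeration per tuple, with the initialization included:
   [enumerate_bound n n] is at most n ^ n * g n. *)
pose g n := (process_bound n n + (n * 38 + 20) + 2 + n * 11 + 20)%N.
have [p pE] : polynomial (fun n => f n + K * g n)%N.
  rewrite /f /g /setup_bound /enumerate_bound /process_bound /record_bound.
  repeat first [exact: polynomial_const | exact: polynomial_id | apply: polynomial_add | apply: polynomial_mul].
exists p => n n0; rewrite pE /uniform_expectation.
(* An expectation over an empty set is 0 by the convention for division by 0. *)
have [->|L0] := posnP #|@is_loop n|; first by rewrite invr0 mulr0 ler0n.
rewrite ler_pdivrMr ?ltr0n // -natr_sum -natrM ler_nat.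
(* The term n ^ n * g n is charged to [hard_loops] alone, and [rare] turns its total into K * g n
   per loop. *)
apply: (@leq_trans (\sum_(T in @is_loop n) (f n + (if T \in hard_loops n then n ^ n * g n else 0)))%N).
  apply: leq_sum => T lT; have [_ tb _] := rP n T lT; apply: leq_trans tb _.
  rewrite /main_bound leq_add2l; case: ifPn => // npT.
  rewrite inE [is_loop T]lT not_pair_generated //.
  rewrite /enumerate_bound /g; move: (_ + _ + 2)%N => a; rewrite !mulnDr -!addnA leq_add2l.
  by rewrite leq_add // leq_pmull // expn_gt0 n0.
rewrite big_split /= -big_mkcondr !sum_nat_const mulnDl [(f n * _)%N]mulnC leq_add2l.
rewrite (_ : #|_| = #|hard_loops n|); last first.
  by apply: eq_card => T; rewrite unfold_in /=; apply: andb_idl; rewrite inE => /andP[].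
by rewrite mulnA [leqRHS]mulnAC leq_mul2r rare // orbT.
Qed.
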